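(* In the following setting: $0<\eta<1$; $\boldsymbol{X}_1,\dots,\boldsymbol{X}_n$ independent $\mathbb{R}^d$-valued $\eta$-HC random vectors with $\mathbb{E}[\boldsymbol{X}_j]=0$, $\boldsymbol{S}=\sum_j\boldsymbol{X}_j$ with covariance $M$ satisfying $M[i,i]=1$ for all $i\in[d]$, $\sigma_j^2=\mathbb{E}[\|\boldsymbol{X}_j\|^2]$; a partition $\boldsymbol{H}_1,\dots,\boldsymbol{H}_t$ of $[n]$ given by $\boldsymbol{H}_\ell=h^{-1}(\ell)$ for $h$ uniform from a $b$-collision preserving family of hash functions $[n]\to[t]$ with $b\le2$; conditioned on the partition, random vectors $\boldsymbol{Y}_1,\dots,\boldsymbol{Y}_n$ with $\boldsymbol{Y}_j$ distributed as $\boldsymbol{X}_j$, $\{\boldsymbol{Y}_j:j\in\boldsymbol{H}_\ell\}$ $4$-wise independent for each $\ell$, independent across buckets; and $\boldsymbol{T}=\sum_j\boldsymbol{Y}_j$. Then for every translate $A\subseteq\mathbb{R}^d$ of a union of orthants, $$|\Pr[\boldsymbol{S}\in A]-\Pr[\boldsymbol{T}\in A]|\le O(\eta^{-1/2}d^{13/8})\cdot\Big(\frac{d^2}{t}+\sum_{j=1}^n\sigma_j^4\Big)^{1/8}.$$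
   Context: $\|\boldsymbol{X}\|_p=\mathbb{E}[\|\boldsymbol{X}\|^p]^{1/p}$ with Euclidean length. An $\mathbb{R}^d$-valued $\boldsymbol{X}$ is $\eta$-HC if $\|\boldsymbol{X}\|_4<\infty$ and $\|A+\eta\boldsymbol{X}\|_4\le\|A+\boldsymbol{X}\|_2$ for all $A\in\mathbb{R}^d$. A family $\mathcal{H}$ of functions $[n]\to[t]$ is $b$-collision preserving if for uniform $h\in\mathcal{H}$, $\Pr[h(i)=\ell]\le b/t$ for all $i,\ell$ and $\Pr[h(i)=h(j)]\le b/t$ for all $i\ne j$. $\mathrm{sgn}(x)=1$ if $x\ge0$, else $-1$; $A\subseteq\mathbb{R}^d$ is a translate of a union of orthants if there is $\Theta\in\mathbb{R}^d$ such that membership $X\in A$ depends only on the vector of coordinate signs of $X-\Theta$. *)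

(* Defs.v *)
From HB Require Import structures.
From mathcomp Require Import all_boot all_order all_algebra.
From mathcomp Require Import all_classical all_reals all_analysis.

Set Implicit Arguments.
Unset Strict Implicit.
Unset Printing Implicit Defensive.

Import Order.TTheory GRing.Theory Num.Theory.

Local Open Scope classical_set_scope.
Local Open Scope ring_scope.

(* The library equips tuples, but not row vectors, with the product
   sigma-algebra; this is the same construction on 'rV. *)
Definition rV_display : measure_display -> measure_display.
Proof. exact. Qed.

Section measurable_rV.
Context {dd : measure_display} {T : sigmaRingType dd} (d : nat).

Let coord : 'I_d -> 'rV[T]_d -> T := fun i x => x ord0 i.

Let rV_set0 : g_sigma_preimage coord set0.
Proof. exact: sigma_algebra0. Qed.

Let rV_setC A : g_sigma_preimage coord A -> g_sigma_preimage coord (~` A).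
Proof. exact: sigma_algebraC. Qed.

Let rV_bigcup (F : (set 'rV[T]_d)^nat) :
  (forall i, g_sigma_preimage coord (F i)) ->
  g_sigma_preimage coord (\bigcup_i (F i)).
Proof. exact: sigma_algebra_bigcup. Qed.

HB.instance Definition _ := @isMeasurable.Build (rV_display dd)
  'rV[T]_d (g_sigma_preimage coord) rV_set0 rV_setC rV_bigcup.

End measurable_rV.

Section vectors.
Context {R : realType} {d : nat}.

(* The library norm `|x| on 'rV is the sup norm. *)
Definition enorm (x : 'rV[R]_d) : R := Num.sqrt (\sum_(i < d) x ord0 i ^+ 2).

(* Unlike Num.sg, this takes the value 1 at 0. *)
Definition sgn1 (x : R) : R := if 0 <= x then 1 else -1.

Definition orthant_union_translate (A : set 'rV[R]_d) : Prop :=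
  exists (Theta : 'rV[R]_d) (U : set 'rV[R]_d),
    A = [set x | U (map_mx sgn1 (x - Theta))].

End vectors.

Section random_vectors.
Context {dd : measure_display} {Omega : measurableType dd} {R : realType}
  {d : nat} (P : probability Omega R).

Definition vnorm (p : R) (X : Omega -> 'rV[R]_d) : \bar R :=
  'N[P]_p%:E [EFin \o (enorm \o X)].

Definition hypercontractive (eta : R) (X : Omega -> 'rV[R]_d) : Prop :=
  (vnorm 4 X < +oo)%E /\
  forall a : 'rV[R]_d,
    (vnorm 4 (fun w => a + eta *: X w)%R <= vnorm 2 (fun w => a + X w)%R)%E.

Definition centered (X : Omega -> 'rV[R]_d) : Prop :=
  forall i : 'I_d, ('E_P[fun w => X w ord0 i] = 0)%E.

(* A variance that is not finite is mapped to 0 by [fine]. *)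
Definition cov_mx (X : Omega -> 'rV[R]_d) : 'M[R]_d :=
  \matrix_(i, j) fine (covariance P (fun w => X w ord0 i)
                                    (fun w => X w ord0 j)).

Definition second_moment (X : Omega -> 'rV[R]_d) : R :=
  fine 'E_P[fun w => (enorm (X w) ^+ 2)%R]%E.

End random_vectors.

(* Independence is stated for a set function Q, to be used both with a
   probability and with a conditional probability. *)
Section independence.
Context {dd : measure_display} {Omega : measurableType dd} {R : realType}.
Implicit Types Q : set Omega -> \bar R.

Definition cond_prob (P : probability Omega R) (B : set Omega)
    : set Omega -> \bar R :=
  fun A => (P (A `&` B) * ((fine (P B))^-1)%:E)%E.

Definition independent_systems Q (I : finType) (J : {set I})
    (F : I -> set (set Omega)) : Prop :=
  forall (K : {set I}) (E : I -> set Omega), K \subset J ->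
    (forall i, i \in K -> F i (E i)) ->
    Q (\bigcap_(i in [set` K]) E i) = (\prod_(i in K) Q (E i))%E.

Definition sigma_rv {dd' : measure_display} {T : measurableType dd'}
    (X : Omega -> T) : set (set Omega) :=
  preimage_set_system [set: Omega] X measurable.

Definition independent_rvs Q {dd' : measure_display}
    {T : measurableType dd'} (I : finType) (J : {set I})
    (X : I -> Omega -> T) : Prop :=
  independent_systems Q J (fun i => sigma_rv (X i)).

Definition kwise_independent_rvs Q (k : nat) {dd' : measure_display}
    {T : measurableType dd'} (I : finType) (J : {set I})
    (X : I -> Omega -> T) : Prop :=
  forall K : {set I}, K \subset J -> (#|K| <= k)%N -> independent_rvs Q K X.

Definition sigma_family {dd' : measure_display} {T : measurableType dd'}
    (I : finType) (J : {set I}) (X : I -> Omega -> T) : set (set Omega) :=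
  <<s \bigcup_(j in [set` J]) sigma_rv (X j) >>.

End independence.

Section hashing.
Context {R : realType} {n t : nat}.
Implicit Type H : {set {ffun 'I_n -> 'I_t}}.

Definition unif_prob H (E : pred {ffun 'I_n -> 'I_t}) : R :=
  #|[set h in H | E h]|%:R / #|H|%:R.

Definition collision_preserving (b : R) H : Prop :=
  (forall (i : 'I_n) (l : 'I_t),
     unif_prob H (fun h => h i == l) <= b / t%:R) /\
  (forall i j : 'I_n, i != j ->
     unif_prob H (fun h => h i == h j) <= b / t%:R).

Definition bucket (h : {ffun 'I_n -> 'I_t}) (l : 'I_t) : {set 'I_n} :=
  [set j | h j == l].

Definition uniform_rv {dd : measure_display} {Omega : measurableType dd}
    (P : probability Omega R) H (h : Omega -> {ffun 'I_n -> 'I_t}) : Prop :=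
  forall g : {ffun 'I_n -> 'I_t},
    measurable (h @^-1` [set g]) /\
    P (h @^-1` [set g]) = (if g \in H then #|H|%:R^-1 else 0)%:E.

End hashing.

(* Main.v *)
Require Import Defs.
From HB Require Import structures.
From mathcomp Require Import all_boot all_order all_algebra.
From mathcomp Require Import all_classical all_reals all_analysis.
From mathcomp Require Import measurable_realfun ring lra.

(** Let [Gamma] be [eta ^- 4] times the expectation over the hash function of
    the sum over buckets of the squared total variances.  Conditionally on the
    hash function, the bucket sums of [S] and of [T] are independent across
    buckets and have the same mixed moments up to order 4, so for a smooth test
    function Lindeberg's replacement of one bucket at a time costs only the
    fourth-order Taylor remainder; hypercontractivity bounds the fourth moments
    of the bucket sums, and the total cost is [d^O(1) kappa^4 Gamma] for a test
    function varying at scale [1 / kappa].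

    The indicator of a union of orthants is smoothed by products of logistic
    functions.  For each multi-index the sum over the [2 ^ d] sign patterns
    factors over the coordinates, which keeps the derivatives of order at most
    4 bounded by powers of [kappa], without any factor exponential in [d].

    The smoothing error is controlled by the probability that some coordinate
    of [S] or [T] is close to its threshold.  No comparison with a Gaussian is
    needed: the indicator of [|y| <= 1 / (2 N)] is dominated by the Fejer kernel
    [4 / N^2 * sum_(k, l < N) cos ((k - l) y)], whose expectation under [S] is
    bounded through the characteristic function, and whose expectation under
    [T] is close to the one under [S] since the kernel is itself smooth. *)

Set Implicit Arguments.
Unset Strict Implicit.
Unset Printing Implicit Defensive.

Import Order.TTheory GRing.Theory Num.Theory.
Import numFieldNormedType.Exports.

Local Open Scope classical_set_scope.
Local Open Scope ring_scope.

(** * Taylor expansion and jets *)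

(** A single integer [L] drives both scales: [kappa = L^3] and [N = L^2]. Outside the window
    [|y| <= 1 / (2 L^2)] seen by the Fejer kernel, the logistic tail [exp (- L^3 |y|)] is already
    below [16 / L^2], so the smoothing error has size [d / L^2], against a replacement error of
    order [d^5 L^12 Gamma]. [T] is only 4-wise independent inside a bucket, so its characteristic
    function is out of reach; this is why the small-ball bound is proved for [S] and then
    transported. For [S] it is available only at frequencies [m] with [m^4] times the sum of the
    fourth moments at most 1, which limits [N]. Let [Delta] be the bracket of the statement. [Gamma]
    is at most [2 eta^-4 Delta], since distinct indices collide with probability at most [2 / t] and
    the second moments [sigma_j^2] add up to [d]. With [r = eta^(-1/2) d^(5/8) Delta^(1/8)] one has
    [eta^-4 d^5 Delta = r^8]; taking [L^2] close to [1 / r] makes the first error a multiple of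
    [d r], the claimed bound, and the second a multiple of [r^2], which is smaller as long as
    [r < 1]. *)

Section taylor.
Context {R : realType}.
Implicit Types (f g h : R -> R) (x y s : R).

Lemma is_derive_sum_fun (I : Type) (r : seq I) (f : I -> R -> R) (df : I -> R) x :
  (forall i, is_derive x 1 (f i) (df i)) ->
  is_derive x 1 (fun s => \sum_(i <- r) f i s) (\sum_(i <- r) df i).
Proof.
move=> fP; elim: r => [|i r IHr].
  rewrite big_nil (_ : (fun _ => _) = cst 0); first exact: is_derive_cst.
  by apply/funext => s; rewrite big_nil.
rewrite big_cons (_ : (fun _ => _) = f i + (fun s => \sum_(i <- r) f i s)).
  exact: is_deriveD.
by apply/funext => s; rewrite big_cons.
Qed.

Lemma is_derive_prod_fun (I : eqType) (r : seq I) (f : I -> R -> R)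
    (df : I -> R) x : uniq r ->
  (forall i, is_derive x 1 (f i) (df i)) ->
  is_derive x 1 (fun s => \prod_(i <- r) f i s)
    (\sum_(i <- r) \prod_(j <- r) if j == i then df j else f j x).
Proof.
move=> + fP; elim: r => [_|i r IHr /= /andP[ir ur]].
  rewrite big_nil (_ : (fun _ => _) = cst 1); first exact: is_derive_cst.
  by apply/funext => s; rewrite big_nil.
rewrite (_ : (fun _ => _) = f i * (fun s => \prod_(i <- r) f i s)); last first.
  by apply/funext => s; rewrite big_cons.
apply: (is_derive_eq (is_deriveM (fP i) (IHr ur))).
rewrite big_cons addrC; congr (_ + _).
  rewrite big_cons eqxx /GRing.scale /= mulrC; congr (_ * _).
  rewrite big_seq [RHS]big_seq; apply: eq_bigr => j jr.
  by case: eqP => // ji; rewrite ji (negbTE ir) in jr.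
rewrite /GRing.scale /= big_distrr /= big_seq [RHS]big_seq.
apply: eq_bigr => j jr; rewrite big_cons; case: eqP => // ji.
by rewrite ji jr in ir.
Qed.

Lemma derive_bound_expn f df (B : R) (k : nat) :
  (forall s, is_derive s 1 f (df s)) -> f 0 = 0 ->
  (forall s, 0 <= s <= 1 -> `|df s| <= B * s ^+ k) ->
  forall s, 0 <= s <= 1 -> `|f s| <= B * s ^+ k.+1.
Proof.
move=> fdf f0 dfB s /andP[s0 s1].
have cf : {within `[0, s], continuous f}.
  apply: continuous_subspaceT => x; apply: differentiable_continuous.
  by apply/derivable1_diffP; case: (fdf x).
have [c] := MVT_segment s0 (fun x _ => fdf x) cf.
rewrite in_itv /= => /andP[c0 cs]; rewrite f0 !subr0 => ->.
rewrite normrM (ger0_norm s0) exprS mulrCA [leLHS]mulrC ler_wpM2l//.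
have c1 : 0 <= c <= 1 by rewrite c0 (le_trans cs).
apply: le_trans (dfB _ c1) _; rewrite ler_wpM2l//; last first.
  by apply: lerXn2r => //; rewrite ?nnegrE.
(* The bound at [s = 1] shows [0 <= B], which the comparison of powers requires. *)
have := dfB 1; rewrite expr1n mulr1 lexx ler01 => /(_ isT).
exact: le_trans.
Qed.

(* Each integration loses the factorial; only the order of the remainder matters. *)
Lemma taylor_remainder (g : nat -> R -> R) (K : nat) (B : R) :
  (forall k s, (k < K)%N -> is_derive s 1 (g k) (g k.+1 s)) ->
  (forall s, 0 <= s <= 1 -> `|g K s| <= B) ->
  forall s, 0 <= s <= 1 ->
  `|g 0%N s - \sum_(k < K) g k 0 * (k`!%:R^-1 * s ^+ k)| <= B * s ^+ K.
Proof.
elim: K g => [|K IH] g gd gB s s01.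
  by rewrite big_ord0 subr0 expr0 mulr1; exact: gB.
(* The derivative of the remainder [e] is the remainder [de] of the shifted sequence [g k.+1], to
   which the induction hypothesis applies. *)
pose e s := g 0%N s - \sum_(k < K.+1) g k 0 * (k`!%:R^-1 * s ^+ k).
pose de s := g 1%N s - \sum_(k < K) g k.+1 0 * (k`!%:R^-1 * s ^+ k).
apply: (@derive_bound_expn e de B K) => //.
- move=> u; have g0 := gd 0%N u isT.
  have S : is_derive u 1 (fun s => \sum_(k < K.+1) g k 0 * (k`!%:R^-1 * s ^+ k))
      (\sum_(k < K.+1) g k 0 * (k`!%:R^-1 * (k%:R * u ^+ k.-1))).
    apply: is_derive_sum_fun => k.
    rewrite (_ : (fun s => _) = (g k 0 * k`!%:R^-1) \*: ((id : R -> R) ^+ k)).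
      by apply: is_derive_eq; rewrite /GRing.scale /=; ring.
    by apply/funext => t; rewrite /= /GRing.scale /= mulrA exprfctE.
  apply: (is_derive_eq (is_deriveB g0 S)); congr (_ - _).
  rewrite big_ord_recl /= mul0r !mulr0 add0r; apply: eq_bigr => k _.
  rewrite /bump /= add1n factS natrM invfM.
  have : (k.+1%:R : R) != 0 by rewrite pnatr_eq0.
  move: (k`!%:R^-1) (k.+1%:R : R) => a b b0; field; exact: b0.
- by rewrite /e big_ord_recl /= fact0 invr1 expr0 !mulr1 big1 ?addr0 ?subrr //
    => k _; rewrite /bump /= expr0n /= !mulr0.
- by move=> u u01; apply: (IH (fun k => g k.+1)) => // k v kK; exact: gd.
Qed.

Lemma taylor1 (g : nat -> R -> R) (K : nat) (B : R) :
  (forall k s, (k < K)%N -> is_derive s 1 (g k) (g k.+1 s)) ->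
  (forall s, 0 <= s <= 1 -> `|g K s| <= B) ->
  `|g 0%N 1 - \sum_(k < K) g k 0 * k`!%:R^-1| <= B.
Proof.
move=> gd gB; have := taylor_remainder gd gB; move=> /(_ 1).
rewrite lexx ler01 expr1n mulr1 => /(_ isT); congr (`|_ - _| <= _).
by apply: eq_bigr => k _; rewrite expr1n mulr1.
Qed.

(** The [k]-th derivative of cosine as a phase shift, so that the bound by 1 is the same for all
    orders. *)
Definition dcos (k : nat) : R -> R := fun x => cos (x + k%:R * (pi / 2)).

Lemma dcosS k x : dcos k.+1 x = - sin (x + k%:R * (pi / 2)).
Proof.
by rewrite /dcos -addn1 natrD mulrDl mul1r addrA cosDpihalf.
Qed.

Lemma dcos_le1 k x : `|dcos k x| <= 1.
Proof. exact: cos_max. Qed.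

Lemma is_derive_dcos_line k (m y x : R) :
  is_derive x 1 (fun s => dcos k (y + s * m)) (m * dcos k.+1 (y + x * m)).
Proof.
pose a := y + k%:R * (pi / 2).
rewrite (_ : (fun s => _) = @cos R \o (cst a + m \*: id)); last first.
  by apply/funext => s; rewrite /dcos/a /= fctE /cst /= /GRing.scale /=; congr cos; ring.
apply: is_derive_eq; rewrite dcosS.
rewrite (_ : (cst a + m \*: id) x = y + x * m + k%:R * (pi / 2)).
  by rewrite /GRing.scale /= add0r mulr1 mulrC.
by rewrite /a fctE /= /GRing.scale /=; ring.
Qed.

Lemma dcos_taylor (j K : nat) (y m : R) :
  `|dcos j (y + m) - \sum_(k < K) m ^+ k * dcos (j + k) y * k`!%:R^-1|
    <= `|m| ^+ K.
Proof.
pose g k s := m ^+ k * dcos (j + k) (y + s * m).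
have := @taylor1 g K (`|m| ^+ K); rewrite /g expr0 !mul1r addn0 mul0r !addr0.
apply.
- move=> k s _.
  rewrite (_ : (fun s => _) = m ^+ k \*: (fun s => dcos (j + k) (y + s * m))) //.
  apply: (is_derive_eq (is_deriveZ _ (is_derive_dcos_line _ _ _ _))).
  by rewrite /GRing.scale /= exprSr addnS; ring.
- move=> s _; rewrite normrM normrX -[leRHS]mulr1 ler_wpM2l ?exprn_ge0//.
  exact: dcos_le1.
Qed.

Lemma dcos0 x : dcos 0 x = cos x.
Proof. by rewrite /dcos mul0r addr0. Qed.
Lemma dcos1 x : dcos 1 x = - sin x.
Proof. by rewrite dcosS mul0r addr0. Qed.
Lemma dcos2 x : dcos 2 x = - cos x.
Proof. by rewrite dcosS mul1r sinDpihalf. Qed.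
Lemma dcos3 x : dcos 3 x = sin x.
Proof.
by rewrite dcosS (_ : 2%:R * (pi / 2) = pi) ?sinDpi ?opprK// mulrC divfK.
Qed.

(** Taylor expansion of order 2 at 0; the coefficient 1 in place of 1/2 is the factorial dropped
    from the remainder. *)
Lemma cos_ge_quadratic (y : R) : 1 - y ^+ 2 <= cos y.
Proof.
have := dcos_taylor 0 2 0 y; rewrite add0r !big_ord_recl big_ord0 /= !add0n.
rewrite dcos0 /bump /= dcos1 dcos0 cos0 sin0 real_normK ?num_real// ler_norml.
by move=> /andP[+ _]; rewrite !factS fact0 !muln1 ?invr1 expr0 !mulr1; lra.
Qed.

Lemma cos_le_quartic (y : R) : cos y <= 1 - y ^+ 2 / 2 + y ^+ 4.
Proof.
have := dcos_taylor 0 4 0 y; rewrite add0r !big_ord_recl big_ord0 /= !add0n.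
rewrite /bump /= ?addn0 ?add1n dcos0 dcos1 dcos2 dcos3 dcos0 cos0 sin0.
rewrite (_ : `|y| ^+ 4 = y ^+ 4); last first.
  by rewrite -[4%N]/(2 * 2)%N exprM real_normK ?num_real// -exprM.
rewrite ler_norml => /andP[_]; rewrite !factS fact0 !muln1 ?invr1 expr0 !mulr1.
by rewrite ?mulrN ?oppr0 ?mulr0 ?mul0r ?addr0 ?add0r; lra.
Qed.

(** For a centered variable the linear term integrates to 0, so this bounds the mean of a sine by a
    second moment. *)
Lemma sin_sub_id (y : R) : `|sin y - y| <= y ^+ 2.
Proof.
have := dcos_taylor 1 2 0 y; rewrite add0r !big_ord_recl big_ord0 /= ?addn0.
rewrite /bump /= ?addn0 ?add1n !dcos1 dcos2 cos0 sin0 real_normK ?num_real//.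
rewrite !factS fact0 !muln1 ?invr1 expr0 !mulr1 oppr0 expr1.
rewrite -normrN; congr (`|_| <= _); lra.
Qed.

End taylor.

Section jets.
Context {R : realType} {d : nat}.
Notation V := 'rV[R]_d.
Implicit Types (phi : seq 'I_d -> V -> R) (x z : V).

(* A family indexed by words: [phi w] plays the role of the iterated partial
   derivative of [phi [::]] along the coordinates listed in [w]. *)
Definition jet (B : R) phi : Prop :=
  (forall w x z (s : R), (size w < 4)%N ->
    is_derive s (1 : R) (fun u : R => phi w (x + u *: z))
      (\sum_(i < d) z ord0 i * phi (i :: w) (x + s *: z))) /\
  (forall w x, size w = 4%N -> `|phi w x| <= B).

(** When [c] lists the values of a jet at a point, this is the [k]-th derivative in direction [z].
    Words in place of multi-indices avoid multinomial coefficients. *)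
Fixpoint dirsum (k : nat) (c : seq 'I_d -> R) (w : seq 'I_d) (z : V) : R :=
  if k is k'.+1 then \sum_(i < d) z ord0 i * dirsum k' c (i :: w) z else c w.

Definition jet_poly phi x z : R :=
  \sum_(k < 4) dirsum k (phi^~ x) [::] z * k`!%:R^-1.

Lemma norm_dirsum k (c : seq 'I_d -> R) (B : R) w z :
  (forall v, size v = (size w + k)%N -> `|c v| <= B) -> 
  `|dirsum k c w z| <= B * (\sum_(i < d) `|z ord0 i|) ^+ k.
Proof.
elim: k w => [|k IH] w cB /=.
  by rewrite expr0 mulr1; apply: cB; rewrite addn0.
apply: le_trans (ler_norm_sum _ _ _) _; rewrite exprS mulrCA mulr_suml.
apply: ler_sum => i _; rewrite normrM ler_wpM2l//; apply: IH => v vk.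
by apply: cB; rewrite vk /= addSnnS.
Qed.

(** One-dimensional Taylor expansion along the segment from [x] to [x + z]. The l1 norm of [z]
    appears because the partial derivatives are bounded one by one. *)
Lemma jet_taylor B phi x z : jet B phi ->
  `|phi [::] (x + z) - jet_poly phi x z| <= B * (\sum_(i < d) `|z ord0 i|) ^+ 4.
Proof.
move=> [phid phiB].
pose g k s := dirsum k (phi^~ (x + s *: z)) [::] z.
have D k w (s : R) : (size w + k < 4)%N ->
    is_derive s (1 : R) (fun u : R => dirsum k (phi^~ (x + u *: z)) w z)
      (dirsum k.+1 (phi^~ (x + s *: z)) w z).
  elim: k w => [|k IH] w wk; first by apply: phid; rewrite addn0 in wk.
  rewrite [dirsum k.+2]lock /= -lock; apply: is_derive_sum_fun => i.
  rewrite (_ : (fun u => _) =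
     z ord0 i \*: (fun u => dirsum k (phi^~ (x + u *: z)) (i :: w) z)) //.
  by apply: is_deriveZ; apply: IH; rewrite /= addSnnS.
have := @taylor1 R g 4 (B * (\sum_(i < d) `|z ord0 i|) ^+ 4).
rewrite /g /= scale1r scale0r addr0; apply.
  by move=> k s k4; apply: D.
by move=> s _; apply: (@norm_dirsum 4 (phi^~ (x + s *: z)) B [::]) => v v4; apply: phiB.
Qed.

(** Cauchy-Schwarz twice, at cost [d^2] and then [d]. *)
Lemma sum4_le (a : 'I_d -> R) : 
  (\sum_(i < d) `|a i|) ^+ 4 <= d%:R ^+ 3 * \sum_(i < d) a i ^+ 4.
Proof.
have sq (b : 'I_d -> R) :
    (\sum_(i < d) b i) ^+ 2 <= d%:R * \sum_(i < d) b i ^+ 2.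
  rewrite expr2 big_distrlr /=.
  apply: (@le_trans _ _ (\sum_(i < d) \sum_(j < d) (b i ^+ 2 / 2 + b j ^+ 2 / 2))).
    apply: ler_sum => i _; apply: ler_sum => j _.
    by have := sqr_ge0 (b i - b j); rewrite sqrrB; lra.
  have -> : \sum_(i < d) \sum_(j < d) (b i ^+ 2 / 2 + b j ^+ 2 / 2) =
      \sum_(i < d) (d%:R * (b i ^+ 2 / 2) + \sum_(j < d) b j ^+ 2 / 2).
    by apply: eq_bigr => i _; rewrite big_split /= sumr_const card_ord mulr_natl.
  rewrite big_split /= sumr_const card_ord -mulr_sumr -mulr_suml.
  by rewrite -[X in _ + X]mulr_natl -mulrDr; apply: ler_wpM2l => //; lra.
have h1 := sq (fun i => `|a i|).
have h2 := sq (fun i => a i ^+ 2).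
have e1 : \sum_(i < d) `|a i| ^+ 2 = \sum_(i < d) a i ^+ 2.
  by apply: eq_bigr => i _; rewrite real_normK ?num_real.
have e2 : \sum_(i < d) (a i ^+ 2) ^+ 2 = \sum_(i < d) a i ^+ 4.
  by apply: eq_bigr => i _; rewrite -exprM.
rewrite e1 in h1; rewrite e2 in h2.
rewrite -[4%N]/(2 * 2)%N exprM; apply: (@le_trans _ _ ((d%:R * \sum_(i < d) a i ^+ 2) ^+ 2)).
  rewrite lerXn2r ?nnegrE ?sqr_ge0// mulr_ge0// sumr_ge0// => i _.
  exact: sqr_ge0.
rewrite exprMn [d%:R ^+ 3]exprSr -mulrA ler_wpM2l ?exprn_ge0 //.
Qed.

End jets.

(** * Smooth test functions *)

Section cos_jet.
Context {R : realType} {d : nat}.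
Notation V := 'rV[R]_d.

(** The function depends on coordinate [i] alone, so a word with any other letter gives the zero
    derivative. These are the summands of the Fejer kernel. *)
Definition cos_jet (i : 'I_d) (m th : R) (w : seq 'I_d) (x : V) : R :=
  if all (pred1 i) w
  then m ^+ size w * dcos (size w) (m * (x ord0 i - th)) else 0.

Lemma cos_jet_nil i m th x : cos_jet i m th [::] x = cos (m * (x ord0 i - th)).
Proof. by rewrite /cos_jet /= expr0 mul1r dcos0. Qed.

Lemma cos_jetP i m th : jet (m ^+ 4) (cos_jet i m th).
Proof.
split=> [w x z s _|w x w4]; last first.
  rewrite /cos_jet w4; case: ifP => _; last first.
    by rewrite normr0 -[4%N]/(2 * 2)%N exprM sqr_ge0.
  rewrite normrM normrX -[leRHS]mulr1.
  rewrite (_ : `|m| ^+ 4 = m ^+ 4); last first.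
    by rewrite -[4%N]/(2 * 2)%N exprM real_normK ?num_real// -exprM.
  by rewrite ler_wpM2l ?dcos_le1// -[4%N]/(2 * 2)%N exprM sqr_ge0.
have [wi|wi] := boolP (all (pred1 i) w); last first.
  rewrite (_ : (fun u : R => _) = cst 0); last first.
    by apply/funext => u; rewrite /cos_jet (negPf wi).
  rewrite big1; first exact: is_derive_cst.
  by move=> j _; rewrite /cos_jet /= (negPf wi) andbF mulr0.
have -> : \sum_(j < d) z ord0 j * cos_jet i m th (j :: w) (x + s *: z) =
    z ord0 i * cos_jet i m th (i :: w) (x + s *: z).
  rewrite (bigD1 i) //= big1 ?addr0// => j ji.
  by rewrite /cos_jet /= (negPf ji) mulr0.
rewrite /cos_jet /= eqxx wi (_ : (fun u : R => _) = m ^+ size w \*: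
    (fun u => dcos (size w) (m * (x ord0 i - th) + u * (m * z ord0 i)))).
  apply: (is_derive_eq (is_deriveZ _ (is_derive_dcos_line _ _ _ _))).
  rewrite /GRing.scale /= exprSr !mxE.
  rewrite (_ : m * (x ord0 i - th) + s * (m * z ord0 i) =
    m * (x ord0 i + s * z ord0 i - th)); last by ring.
  by ring.
apply/funext => u; rewrite /= /GRing.scale /= !mxE; congr (_ * dcos _ _); ring.
Qed.

End cos_jet.

(** * Smooth weights of the two half-lines *)

Section logistic.
Context {R : realType}.
Implicit Types (x y : R) (k : nat) (b : bool).

Definition logistic x : R := (1 + expR (- x))^-1.

Lemma logistic_gt0 x : 0 < logistic x.
Proof. by rewrite invr_gt0 addr_gt0 ?expR_gt0. Qed.

Lemma logistic_lt1 x : logistic x < 1.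
Proof.
by rewrite invf_lt1 ?ltrDl ?addr_gt0 ?expR_gt0.
Qed.

Lemma logistic_le_expR x : logistic x <= expR x.
Proof.
rewrite /logistic -[leRHS]invrK -expRN lef_pV2 ?posrE ?expR_gt0//.
  by rewrite lerDr.
Qed.

Lemma logisticN x : 1 - logistic x = logistic (- x).
Proof.
rewrite /logistic opprK expRN; have := expR_gt0 x; move: (expR x) => e e0.
have e1 : e != 0 by lra.
have e2 : e + 1 != 0 by lra.
by field; rewrite addrC e2 e1.
Qed.

(** The logistic function solves [u' = u (1 - u)], so its derivatives are polynomials in [u]. They
    are factored for the estimates below; the last case is meant for [k = 4]. *)
Definition dlog_poly (k : nat) (u : R) : R :=
  match k with
  | 0 => u
  | 1 => u * (1 - u)
  | 2 => u * (1 - u) * (1 - 2 * u)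
  | 3 => u * (1 - u) * (1 - 6 * u + 6 * u ^+ 2)
  | _ => u * (1 - u) * (1 - 2 * u) * (1 - 12 * u + 12 * u ^+ 2)
  end.

Definition dlog k x := dlog_poly k (logistic x).

(* The smooth weights of the two half-lines: the logistic function and its
   complement, [k]-th derivatives. *)
Definition sgn_weight k b x : R :=
  if b then dlog k x else (k == 0)%N%:R - dlog k x.

Lemma is_derive_logistic x : is_derive x 1 logistic (dlog 1 x).
Proof.
have e0 : (1 + expR (- x)) != 0 by rewrite gt_eqF// addr_gt0 ?expR_gt0.
have D : is_derive x 1 (fun y => 1 + expR (- y)) (- expR (- x)).
  rewrite (_ : (fun y => _) = cst 1 + (@expR R \o (-%R))); last first.
    by apply/funext.
  by apply: is_derive_eq; rewrite add0r mulrN1.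
apply: (is_derive_eq (@is_deriveV _ (fun y => 1 + expR (- y)) _ _ _ e0 D)).
rewrite /dlog/= /logistic /GRing.scale /=.
have := expR_gt0 (- x); move: (expR (- x)) e0 => e e0 ep.
by field; rewrite ?(addrC e) ?e0.
Qed.

Lemma is_derive_dlog k x : (k < 4)%N -> is_derive x 1 (dlog k) (dlog k.+1 x).
Proof.
have D := is_derive_logistic x.
have H (p : {poly R}) : is_derive x 1 (fun y => p.[logistic y])
    (p^`().[logistic x] * dlog 1 x).
  exact: (@is_derive1_comp _ (horner p) logistic).
(* By the chain rule each order reduces to the polynomial identity [p' * u (1 - u) = next]. *)
have E (p : {poly R}) j : dlog j = (fun y => p.[logistic y]) ->
    p^`().[logistic x] * dlog 1 x = dlog j.+1 x ->
    is_derive x 1 (dlog j) (dlog j.+1 x).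
  by move=> -> <-.
case: k => [|[|[|[|//]]]] _.
- by apply: (E 'X); [apply/funext => y; rewrite /dlog /= hornerX|
    rewrite derivX hornerC mul1r].
- apply: (E ('X * (1 - 'X))); first by apply/funext => y; rewrite /dlog /= !hornerE.
  by rewrite /dlog /= !poly.derivE !hornerE /=; ring.
- apply: (E ('X * (1 - 'X) * (1 - 2%:P * 'X))).
    by apply/funext => y; rewrite /dlog /= !hornerE.
  by rewrite /dlog /= !poly.derivE !hornerE /=; ring.
- apply: (E ('X * (1 - 'X) * (1 - 6%:P * 'X + 6%:P * 'X * 'X))).
    by apply/funext => y; rewrite /dlog /= !hornerE.
  by rewrite /dlog /= !poly.derivE !hornerE /=; ring.
Qed.

Lemma is_derive_sgn_weight k b x : (k < 4)%N ->
  is_derive x 1 (sgn_weight k b) (sgn_weight k.+1 b x).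
Proof.
move=> k4; rewrite /sgn_weight; case: b; first exact: is_derive_dlog.
rewrite sub0r (_ : (fun x => _) = cst (k == 0)%N%:R - dlog k); last exact/funext.
by apply: (is_derive_eq (is_deriveB _ (is_derive_dlog _ k4))); rewrite sub0r.
Qed.

(** The bound has to be exactly 1, because it is multiplied over all [d] coordinates. For [k > 0]
    the two weights are opposite, so [1/2] is needed for each; this follows from
    [0 <= u (1 - u) <= 1/4]. *)
Lemma sum_sgn_weight k x : (k <= 4)%N ->
  `|sgn_weight k true x| + `|sgn_weight k false x| <= 1.
Proof.
have l0 := logistic_gt0 x; have l1 := logistic_lt1 x.
rewrite /sgn_weight /dlog; move: (logistic x) l0 l1 => u u0 u1.
case: k => [|k k4].
  by move=> _ /=; rewrite !ger0_norm; lra.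
rewrite sub0r normrN -mulr2n -mulr_natl.
suff: `|dlog_poly k.+1 u| <= 1 / 2 by lra.
have q0 : 0 <= u * (1 - u) <= 1 / 4.
  by have := sqr_ge0 (1 - 2 * u); rewrite expr2 => ?; apply/andP; split; nra.
have n1 : `|1 - 2 * u| <= 1 by rewrite ler_norml; apply/andP; split; lra.
have n2 : `|1 - 6 * u + 6 * u ^+ 2| <= 1.
  rewrite (_ : 1 - _ + _ = 1 - 6 * (u * (1 - u))); last by ring.
  by rewrite ler_norml; apply/andP; split; lra.
have n3 : `|1 - 12 * u + 12 * u ^+ 2| <= 2.
  rewrite (_ : 1 - _ + _ = 1 - 12 * (u * (1 - u))); last by ring.
  by rewrite ler_norml; apply/andP; split; lra.
have qn : `|u * (1 - u)| <= 1 / 4 by rewrite ger0_norm; lra.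
have M (a b A B : R) : `|a| <= A -> `|b| <= B -> `|a * b| <= A * B.
  by move=> aA bB; rewrite normrM ler_pM.
case: k k4 => [|[|[|[|//]]]] _; rewrite /dlog_poly.
- by lra.
- by have := M _ _ _ _ qn n1; lra.
- by have := M _ _ _ _ qn n2; lra.
- by have := M _ _ _ _ (M _ _ _ _ qn n1) n3; lra.
Qed.

Lemma sgn_weight0_ge0 b x : 0 <= sgn_weight 0 b x.
Proof.
rewrite /sgn_weight /dlog /=; have := logistic_gt0 x; have := logistic_lt1 x.
by case: b; lra.
Qed.

Lemma sum_sgn_weight0 x : sgn_weight 0 true x + sgn_weight 0 false x = 1.
Proof. by rewrite /sgn_weight eqxx addrC subrK. Qed.

Lemma sgn_weight0_compl x :
  1 - sgn_weight 0 (0 <= x) x <= expR (- `|x|).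
Proof.
rewrite /sgn_weight /dlog /=; case: ifP => x0.
  by rewrite ger0_norm// logisticN logistic_le_expR.
rewrite opprB addrC subrK ltr0_norm ?opprK ?logistic_le_expR//.
by rewrite ltNge x0.
Qed.

End logistic.

(** * Smoothed indicators of unions of orthants *)

Section orthant_jet.
Context {R : realType} {d : nat}.
Notation V := 'rV[R]_d.
Implicit Types (c : {ffun 'I_d -> bool} -> R) (kappa : R) (th x : V).

(** A mixture, with coefficients [c], of products of one-variable functions; the factor [i] is
    differentiated once per occurrence of [i] in [w], so a word enters only through its letter
    counts. *)
Definition orthant_jet c kappa th (w : seq 'I_d) (x : V) : R :=
  kappa ^+ size w * \sum_(s : {ffun 'I_d -> bool}) c s *
    \prod_(i < d) sgn_weight (count_mem i w) (s i)
      (kappa * (x ord0 i - th ord0 i)).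

Lemma sum_prod_bool (F : 'I_d -> bool -> R) :
  \sum_(s : {ffun 'I_d -> bool}) \prod_(i < d) F i (s i) =
  \prod_(i < d) (F i true + F i false).
Proof.
rewrite -(bigA_distr_bigA F); apply: eq_bigr => i _.
by rewrite big_bool.
Qed.

Lemma orthant_jet_bound c kappa th w x : (size w <= 4)%N ->
  (forall s, 0 <= c s <= 1) ->
  `|orthant_jet c kappa th w x| <= `|kappa| ^+ size w.
Proof.
move=> w4 c01; rewrite normrM normrX -[leRHS]mulr1 ler_wpM2l ?exprn_ge0//.
pose G i b := `|sgn_weight (count_mem i w) b (kappa * (x ord0 i - th ord0 i))|.
apply: (@le_trans _ _
    (\sum_(s : {ffun 'I_d -> bool}) \prod_(i < d) G i (s i))).
  apply: le_trans (ler_norm_sum _ _ _) _; apply: ler_sum => s _.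
  rewrite normrM normr_prod ger0_norm; last by case/andP: (c01 s).
  rewrite -[leRHS]mul1r ler_wpM2r ?prodr_ge0//.
  by case/andP: (c01 s).
rewrite sum_prod_bool; apply: prodr_ile1 => i _; rewrite addr_ge0 ?normr_ge0//=.
by rewrite sum_sgn_weight// (leq_trans (count_size _ _)).
Qed.

Lemma orthant_jetP c kappa th : 0 <= kappa -> (forall s, 0 <= c s <= 1) ->
  jet (kappa ^+ 4) (orthant_jet c kappa th).
Proof.
move=> k0 c01; split=> [w x z s w4|w x w4]; last first.
  by have := orthant_jet_bound kappa th x (eq_leq w4) c01; rewrite w4 (ger0_norm k0).
pose y (i : 'I_d) (u : R) := kappa * ((x + u *: z) ord0 i - th ord0 i).
have D (f : bool -> R -> R) (f' : bool -> R -> R) b (i : 'I_d) :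
    (forall t : R, is_derive t 1 (f b) (f' b t)) ->
    is_derive s 1 (fun u => f b (y i u)) (kappa * z ord0 i * f' b (y i s)).
  move=> fd.
  rewrite (_ : (fun u => _) = f b \o
      (cst (kappa * (x ord0 i - th ord0 i)) + (kappa * z ord0 i) \*: id)).
    apply: is_derive_eq; rewrite /GRing.scale /= fctE /cst add0r mulr1 mulrC.
    by rewrite /y /= !mxE /GRing.scale /=; congr (_ * f' _ _); ring.
  apply/funext => u; rewrite /y /= fctE /cst /= !mxE /GRing.scale /=.
  by congr (f b _); ring.
rewrite /orthant_jet.
rewrite (_ : (fun u : R => _) = kappa ^+ size w \*: (fun u : R =>
  \sum_(s : {ffun 'I_d -> bool}) c s * \prod_(i < d) sgn_weight (count_mem i w) (s i)
      (y i u))) //.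
(* Leibniz rule: one term per coordinate [i], where raising the order of the factor [i] amounts to
   passing from [w] to [i :: w]. *)
pose dd (t : {ffun 'I_d -> bool}) := c t *
  \sum_(i < d) \prod_(j < d) if j == i
    then kappa * z ord0 i * sgn_weight (count_mem i w).+1 (t i) (y i s)
    else sgn_weight (count_mem j w) (t j) (y j s).
have S : is_derive s (1 : R) (fun u : R => \sum_(t : {ffun 'I_d -> bool}) c t *
    \prod_(i < d) sgn_weight (count_mem i w) (t i) (y i u)) (\sum_t dd t).
  apply: is_derive_sum_fun => t.
  rewrite (_ : (fun u => _) = c t \*: (fun u =>
    \prod_(i < d) sgn_weight (count_mem i w) (t i) (y i u))) //.
  apply: is_deriveZ; apply: (is_derive_eq (is_derive_prod_fun
    (df := fun i => kappa * z ord0 i * sgn_weight (count_mem i w).+1 (t i) (y i s)) _ _)).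
  - exact: index_enum_uniq.
  - move=> i; apply: (D (sgn_weight (count_mem i w)) (sgn_weight (count_mem i w).+1)).
    move=> u; apply: is_derive_sgn_weight.
    exact: leq_ltn_trans (count_size _ _) w4.
  - by apply: eq_bigr => i _; apply: eq_bigr => j _; case: eqP => // ->.
apply: (is_derive_eq (is_deriveZ _ S)).
rewrite /GRing.scale /= /dd.
under [in RHS]eq_bigr do rewrite exprSr -!mulrA mulrCA.
rewrite -mulr_sumr; congr (_ * _).
under eq_bigr do rewrite mulr_sumr.
rewrite exchange_big /=; apply: eq_bigr => i _.
rewrite !mulr_sumr; apply: eq_bigr => t _.
have -> : \prod_(j < d) (if j == i
      then kappa * z ord0 i * sgn_weight (count_mem i w).+1 (t i) (y i s)
      else sgn_weight (count_mem j w) (t j) (y j s)) =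
    kappa * z ord0 i * \prod_(j < d) sgn_weight ((i == j) + count_mem j w) (t j)
      (y j s).
  rewrite (bigD1 i) //= eqxx [in RHS](bigD1 i) //= eqxx add1n -[LHS]mulrA.
  congr (_ * (_ * _)).
  by apply: eq_bigr => j ji; rewrite (negPf ji) eq_sym (negPf ji).
by rewrite /y /=; ring.
Qed.

(** The union bound for independent events of probabilities [t i]. The induction also carries that
    the partial products lie in [[0, 1]]. *)
Lemma prod_compl_le (t : 'I_d -> R) : (forall i, 0 <= t i <= 1) ->
  1 - \prod_(i < d) (1 - t i) <= \sum_(i < d) t i.
Proof.
move=> t01.
suff : forall r : seq 'I_d, 0 <= \prod_(i <- r) (1 - t i) <= 1 /\
   1 - \prod_(i <- r) (1 - t i) <= \sum_(i <- r) t i.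
  by move=> /(_ (index_enum _))[].
elim=> [|i r [/andP[p0 p1] IH]].
  by rewrite !big_nil lexx ler01 subrr.
rewrite !big_cons; have /andP[t0 t1] := t01 i.
move: (\prod_(j <- r) _) p0 p1 IH => p p0 p1 IH; split; last by nra.
by apply/andP; split; nra.
Qed.

(* The weights [prod_i sgn_weight 0 (s i)] form a probability distribution on
   sign patterns, so the error is at most the mass off the true pattern. *)
Lemma orthant_jet_approx c kappa th x : 0 < kappa ->
  (forall s, 0 <= c s <= 1) ->
  `|c [ffun i => 0 <= x ord0 i - th ord0 i] - orthant_jet c kappa th [::] x|
    <= \sum_(i < d) expR (- `|kappa * (x ord0 i - th ord0 i)|).
Proof.
move=> k0 c01; rewrite /orthant_jet expr0 mul1r.
pose p i b := sgn_weight 0 b (kappa * (x ord0 i - th ord0 i)).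
pose q (s : {ffun 'I_d -> bool}) := \prod_(i < d) p i (s i).
set s0 := [ffun i => _].
have q1 : \sum_s q s = 1.
  by rewrite sum_prod_bool big1// => i _; rewrite /p sum_sgn_weight0.
have q0 s : 0 <= q s by apply: prodr_ge0 => i _; exact: sgn_weight0_ge0.
have -> : c s0 - \sum_s c s * q s = \sum_s (c s0 - c s) * q s.
  under [RHS]eq_bigr do rewrite mulrBl.
  by rewrite sumrB -mulr_sumr q1 mulr1.
have Hle : `|\sum_s (c s0 - c s) * q s| <= 1 - q s0.
  rewrite (bigD1 s0) //= subrr mul0r add0r -q1 [in leRHS](bigD1 s0) //=.
  rewrite addrAC subrr add0r.
  apply: le_trans (ler_norm_sum _ _ _) _; apply: ler_sum => s _.
  rewrite normrM (ger0_norm (q0 s)) -[leRHS]mul1r ler_wpM2r//.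
  have /andP[? ?] := c01 s; have /andP[? ?] := c01 s0.
  by rewrite ler_norml; apply/andP; split; lra.
apply: le_trans Hle _.
pose t i := 1 - p i (s0 i).
have t01 i : 0 <= t i <= 1.
  rewrite /t; have := sgn_weight0_ge0 (s0 i) (kappa * (x ord0 i - th ord0 i)).
  have := sgn_weight0_ge0 (~~ s0 i) (kappa * (x ord0 i - th ord0 i)).
  have := sum_sgn_weight0 (kappa * (x ord0 i - th ord0 i)); rewrite -/(p i _).
  by case: (s0 i) => /=; rewrite -/(p i _) => ? ? ?; apply/andP; split; lra.
have := prod_compl_le t01.
rewrite (eq_bigr (fun i => p i (s0 i))); last by move=> i _; rewrite /t; ring.
move/le_trans; apply; apply: ler_sum => i _.
rewrite /t /p ffunE; have := sgn_weight0_compl (kappa * (x ord0 i - th ord0 i)).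
by rewrite pmulr_rge0.
Qed.

End orthant_jet.

(** * The Fejer kernel *)

Section fejer.
Context {R : realType}.
Implicit Types (y : R) (N L : nat).

Definition fejer N y : R :=
  4 / N%:R ^+ 2 * \sum_(k < N) \sum_(l < N) cos ((k%:R - l%:R) * y).

(** Both sides are the squared modulus of [sum_k exp (i k y)]; the right-hand one makes positivity
    visible. *)
Lemma fejerE N y : \sum_(k < N) \sum_(l < N) cos ((k%:R - l%:R) * y) =
  (\sum_(k < N) cos (k%:R * y)) ^+ 2 + (\sum_(k < N) sin (k%:R * y)) ^+ 2.
Proof.
rewrite !expr2 !big_distrlr /= -big_split; apply: eq_bigr => k _ /=.
rewrite -big_split; apply: eq_bigr => l _ /=.
by rewrite mulrBl cosB.
Qed.

Lemma fejer_ge0 N y : 0 <= fejer N y.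
Proof.
by rewrite /fejer fejerE mulr_ge0 ?divr_ge0 ?exprn_ge0 ?addr_ge0 ?sqr_ge0.
Qed.

(** Every angle [k y] is at most [1/2] in absolute value, so the cosine sum is at least [N / 2]; the
    normalisation [4 / N^2] is chosen to make its square count as 1. *)
Lemma fejer_ge1 N y : (0 < N)%N -> `|y| * (2 * N%:R) <= 1 -> 1 <= fejer N y.
Proof.
move=> N0 yN; rewrite /fejer fejerE.
have N0' : 0 < N%:R :> R by rewrite ltr0n.
have S : N%:R / 2 <= \sum_(k < N) cos (k%:R * y).
  have -> : N%:R / 2 = \sum_(k < N) (1 / 2 : R).
    by rewrite sumr_const card_ord -[RHS]mulr_natl mul1r.
  apply: ler_sum => k _; apply: le_trans (cos_ge_quadratic _).
  have kN : (k%:R : R) <= N%:R by rewrite ler_nat ltnW.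
  have : `|k%:R * y| <= 1 / 2.
    rewrite normrM normr_nat.
    have : k%:R * `|y| <= N%:R * `|y| by rewrite ler_wpM2r.
    lra.
  have := normr_ge0 (k%:R * y); rewrite -(real_normK (num_real (k%:R * y))).
  move: `|k%:R * y| => u u0 u1; rewrite expr2; nra.
have S2 : (N%:R / 2) ^+ 2 <= (\sum_(k < N) cos (k%:R * y)) ^+ 2.
  by rewrite lerXn2r// ?nnegrE ?divr_ge0// (le_trans _ S)// divr_ge0.
have P : 0 < 4 / N%:R ^+ 2 :> R by rewrite divr_gt0// exprn_gt0.
have P1 : 4 / N%:R ^+ 2 * (N%:R / 2) ^+ 2 = 1 :> R by field; rewrite gt_eqF.
apply: (@le_trans _ _ (4 / N%:R ^+ 2 * (N%:R / 2) ^+ 2)); first by rewrite P1.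
by rewrite ler_pM2l//; apply: le_trans S2 _; rewrite lerDl sqr_ge0.
Qed.

(** Inside the window [|y| <= 1 / (2 L^2)] the kernel dominates. Outside, [L^3 |y| > L / 2], and
    [exp (- L / 2)] is the square of [exp (- L / 4) <= 4 / L]. This is what ties [kappa = L^3] to
    [N = L^2]. *)
Lemma exp_tail_le_fejer L y : (0 < L)%N ->
  expR (- `|L%:R ^+ 3 * y|) <= fejer (L ^ 2) y + 16 / L%:R ^+ 2.
Proof.
move=> L0; have L0' : 0 < L%:R :> R by rewrite ltr0n.
have [yL|yL] := leP (`|y| * (2 * (L ^ 2)%:R)) 1.
  apply: (@le_trans _ _ (fejer (L ^ 2) y)).
    apply: le_trans (fejer_ge1 _ yL); last by rewrite expn_gt0 L0.
    by rewrite -expR0 ler_expR oppr_le0.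
  by rewrite lerDl divr_ge0// exprn_ge0.
apply: (@le_trans _ _ (16 / L%:R ^+ 2)); last by rewrite lerDr fejer_ge0.
rewrite natrX in yL.
apply: (@le_trans _ _ (expR (- (L%:R / 4)) ^+ 2)).
  rewrite -expRM_natl ler_expR mulrN lerN2 normrM ger0_norm ?exprn_ge0//.
  have : L%:R * 1 <= L%:R * (`|y| * (2 * L%:R ^+ 2)) by rewrite ler_pM2l// ltW.
  by move: `|y| => u; nra.
rewrite (_ : 16 / _ = (4 / L%:R) ^+ 2); last by field; rewrite gt_eqF.
rewrite lerXn2r ?nnegrE ?expR_ge0 ?divr_ge0// expRN.
rewrite -[leRHS]invf_div lef_pV2 ?posrE ?expR_gt0 ?divr_gt0//.
by have := expR_ge1Dx (L%:R / 4 : R); lra.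
Qed.

(** With truncated subtraction, [(k - l) + (l - k)] is [|k - l|]. Passing from [N] to [N + 1] adds a
    column and a row, each worth at most [A], and one diagonal entry. *)
Lemma sum_abs_diff_le (a : nat -> R) (b : nat -> nat -> R) (A0 A : R) N :
  a 0%N <= A0 -> (forall M, \sum_(m < M) a m.+1 <= A) ->
  (forall k l, b k l <= a ((k - l) + (l - k))%N) ->
  \sum_(k < N) \sum_(l < N) b k l <= N%:R * (A0 + 2 * A).
Proof.
move=> a0 aA ba; elim: N => [|N IH]; first by rewrite big_ord0 mul0r.
have rv : \sum_(k < N) a (N - k)%N <= A.
  rewrite (reindex_inj rev_ord_inj) /=; apply: le_trans (aA N).
  by apply: ler_sum => k _; rewrite subKn.
rewrite big_ord_recr /=.
have E1 : \sum_(k < N) \sum_(l < N.+1) b k l <= N%:R * (A0 + 2 * A) + A.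
  under eq_bigr do rewrite big_ord_recr /=.
  rewrite big_split /= lerD//; apply: le_trans rv; apply: ler_sum => k _.
  by apply: le_trans (ba _ _) _; rewrite (eqP (ltnW (ltn_ord k))) add0n.
have E2 : \sum_(l < N.+1) b N l <= A + A0.
  rewrite big_ord_recr /= lerD//; last first.
    by apply: le_trans (ba _ _) _; rewrite subnn.
  apply: le_trans rv; apply: ler_sum => k _.
  by apply: le_trans (ba _ _) _; rewrite (eqP (ltnW (ltn_ord k))) addn0.
by rewrite -natr1; lra.
Qed.

(** Telescoping: [4 / (4 + x^2) <= 8 / x - 8 / (x + 1)]. *)
Lemma sum_inv_sq M : \sum_(m < M) 4 / (4 + m.+1%:R ^+ 2) <= 8 :> R.
Proof.
suff : \sum_(m < M) 4 / (4 + m.+1%:R ^+ 2) <= 8 - 8 / M.+1%:R :> R.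
  move/le_trans; apply; rewrite lerBlDr lerDl.
  by rewrite divr_ge0.
elim: M => [|M IH]; first by rewrite big_ord0 divr1 subrr.
rewrite big_ord_recr /=; apply: le_trans (lerD IH (lexx _)) _.
have M0 : 0 < M.+1%:R :> R by rewrite ltr0n.
rewrite -(natr1 M.+1); move: (M.+1%:R : R) M0 => x x0.
have x2 : 0 < 4 + x ^+ 2 by rewrite addr_gt0// exprn_gt0.
rewrite -subr_ge0 (_ : _ - _ =
    (8 * (4 + x ^+ 2) - 4 * x * (x + 1)) / (x * (x + 1) * (4 + x ^+ 2))); last first.
  by field; rewrite (gt_eqF x0) (gt_eqF x2) gt_eqF// addr_gt0.
apply: divr_ge0; last first.
  by rewrite !mulr_ge0 ?(ltW x0) ?(ltW x2)// addr_ge0 ?(ltW x0).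
by have := sqr_ge0 (x - 1); rewrite !expr2; nra.
Qed.

(* [c k l] stands for the expectation of [cos ((k - l) (S - theta))]. *)
Lemma fejer_mean_le (c : nat -> nat -> R) (e : R) N : 0 <= e -> (0 < N)%N ->
  (forall k l, c k l <= e * (4 / (4 + ((k - l) + (l - k))%N%:R ^+ 2))) ->
  4 / N%:R ^+ 2 * (\sum_(k < N) \sum_(l < N) c k l) <= 68 * e / N%:R.
Proof.
move=> e0 N0 ce; have N0' : 0 < N%:R :> R by rewrite ltr0n.
(* The diagonal contributes [e] and each side at most [8 e]: in all [17 e] per row, and
   [4 * 17 = 68]. *)
have := @sum_abs_diff_le (fun m => e * (4 / (4 + m%:R ^+ 2))) c e (8 * e) N.
rewrite expr0n addr0 divff ?mulr1 ?lexx; last by rewrite gt_eqF.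
move=> /(_ isT) H.
have : \sum_(k < N) \sum_(l < N) c k l <= N%:R * (e + 2 * (8 * e)).
  by apply: H => // M; rewrite -mulr_sumr mulrC ler_wpM2r// sum_inv_sq.
have P : 0 < 4 / N%:R ^+ 2 :> R by rewrite divr_gt0// exprn_gt0.
rewrite -(ler_pM2l P) => /le_trans; apply.
rewrite le_eqVlt; apply/orP; left; apply/eqP.
by field; rewrite gt_eqF.
Qed.

End fejer.

(** * Means, laws and independent pairs *)

Section row_vector_measurability.
Context {dd : measure_display} {T : measurableType dd} {d : nat}.

Lemma measurable_coord (i : 'I_d) :
  measurable_fun [set: 'rV[T]_d] (fun x : 'rV[T]_d => x ord0 i).
Proof.
move=> _ Y mY; rewrite setTI; apply: sub_sigma_algebra => /=.
rewrite -bigcup_seq/=; exists i => /=; first by rewrite mem_index_enum.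
by exists Y => //; rewrite setTI.
Qed.

Lemma measurable_rV {dd' : measure_display} {S : measurableType dd'}
    (f : S -> 'rV[T]_d) :
  (forall i, measurable_fun [set: S] (fun w => f w ord0 i)) ->
  measurable_fun [set: S] f.
Proof.
move=> mf; apply: (measurability (\big[setU/set0]_(i < d)
    preimage_set_system setT (fun x : 'rV[T]_d => x ord0 i) measurable)) => //.
move=> _ [B + <-]; rewrite -bigcup_seq => -[i /= _ [C mC <-]].
by have := mf i measurableT C mC; rewrite !setTI.
Qed.

End row_vector_measurability.

Section row_vector_arithmetic.
Context {R : realType} {d : nat} {dd : measure_display} {S : measurableType dd}.
Implicit Types (f g : S -> 'rV[R]_d).

Lemma measurable_rVD f g : measurable_fun [set: S] f ->
  measurable_fun [set: S] g -> measurable_fun [set: S] (fun w => f w + g w).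
Proof.
move=> mf mg; apply: measurable_rV => i.
rewrite (_ : (fun w => _) = (fun w => f w ord0 i) \+ (fun w => g w ord0 i)).
  apply: measurable_funD.
    exact: (measurableT_comp (measurable_coord i) mf).
  exact: (measurableT_comp (measurable_coord i) mg).
by apply/funext => w; rewrite mxE.
Qed.

Lemma measurable_rV_sum (I : Type) (s : seq I) (f : I -> S -> 'rV[R]_d) :
  (forall i, measurable_fun [set: S] (f i)) ->
  measurable_fun [set: S] (fun w => \sum_(i <- s) f i w).
Proof.
move=> mf; elim: s => [|i s IH].
  by under eq_fun do rewrite big_nil; exact: measurable_cst.
by under eq_fun do rewrite big_cons; exact: measurable_rVD.
Qed.

Lemma measurable_rV_sum_in (I : eqType) (s : seq I) (f : I -> S -> 'rV[R]_d) :
  (forall i, i \in s -> measurable_fun [set: S] (f i)) ->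
  measurable_fun [set: S] (fun w => \sum_(i <- s) f i w).
Proof.
elim: s => [_|i s IH mf].
  by under eq_fun do rewrite big_nil; exact: measurable_cst.
under eq_fun do rewrite big_cons; apply: measurable_rVD.
  by apply: mf; rewrite mem_head.
by apply: IH => j js; apply: mf; rewrite inE js orbT.
Qed.

End row_vector_arithmetic.

Section mean.
Context {R : realType} {dd : measure_display} {Omega : measurableType dd}.
Variable P : probability Omega R.
Implicit Types (f g : Omega -> R).

Definition L1 f : Prop := P.-integrable [set: Omega] (EFin \o f).

Definition mean f : R := (\int[P]_w f w)%R.

Lemma L1_measurable f : L1 f -> measurable_fun [set: Omega] f.
Proof. by move=> /integrableP[/measurable_EFinP]. Qed.

Lemma L1_le f g : measurable_fun [set: Omega] f -> L1 g ->
  (forall w, `|f w| <= g w) -> L1 f.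
Proof.
move=> mf ig fg; apply: (le_integrable measurableT _ _ ig).
  exact/measurable_EFinP.
by move=> w _; rewrite /= lee_fin (le_trans (fg w))// ler_norm.
Qed.

Lemma L1_cst (c : R) : L1 (fun=> c).
Proof. exact: finite_measure_integrable_cst. Qed.

Lemma L1_bounded f (M : R) : measurable_fun [set: Omega] f ->
  (forall w, `|f w| <= M) -> L1 f.
Proof. by move=> mf fM; exact: L1_le mf (L1_cst M) fM. Qed.

Lemma L1D f g : L1 f -> L1 g -> L1 (fun w => f w + g w).
Proof. exact: integrableD. Qed.

Lemma L1Z (c : R) f : L1 f -> L1 (fun w => c * f w).
Proof. exact: integrableZl. Qed.

Lemma L1N f : L1 f -> L1 (fun w => - f w).
Proof.
by move=> /(L1Z (-1)); under eq_fun do rewrite mulN1r.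
Qed.

Lemma L1B f g : L1 f -> L1 g -> L1 (fun w => f w - g w).
Proof. by move=> If /L1N; exact: L1D. Qed.

Lemma L1_sum (I : Type) (s : seq I) (f : I -> Omega -> R) :
  (forall i, L1 (f i)) -> L1 (fun w => \sum_(i <- s) f i w).
Proof.
move=> If; elim: s => [|i s IH].
  by under eq_fun do rewrite big_nil; exact: L1_cst.
by under eq_fun do rewrite big_cons; exact: L1D.
Qed.

Lemma meanD f g : L1 f -> L1 g -> mean (fun w => f w + g w) = mean f + mean g.
Proof. exact: RintegralD. Qed.

Lemma meanB f g : L1 f -> L1 g -> mean (fun w => f w - g w) = mean f - mean g.
Proof. exact: RintegralB. Qed.

Lemma meanZ (c : R) f : L1 f -> mean (fun w => c * f w) = c * mean f.
Proof. exact: RintegralZl. Qed.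

Lemma mean_cst (c : R) : mean (fun=> c) = c.
Proof.
by rewrite /mean Rintegral_cst// (congr1 fine (probability_setT P)) mulr1.
Qed.

Lemma mean_sum (I : Type) (s : seq I) (f : I -> Omega -> R) :
  (forall i, L1 (f i)) ->
  mean (fun w => \sum_(i <- s) f i w) = \sum_(i <- s) mean (f i).
Proof.
move=> If; elim: s => [|i s IH].
  by under eq_fun do rewrite big_nil; rewrite mean_cst big_nil.
under eq_fun do rewrite big_cons; rewrite meanD// ?big_cons ?IH//.
exact: L1_sum.
Qed.

Lemma mean_le f g : L1 f -> L1 g -> (forall w, f w <= g w) -> mean f <= mean g.
Proof. by move=> If Ig fg; apply: le_Rintegral. Qed.

Lemma mean_ge0 f : (forall w, 0 <= f w) -> 0 <= mean f.
Proof. by move=> f0; apply: Rintegral_ge0. Qed.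

Lemma mean_norm f : L1 f -> `|mean f| <= mean (fun w => `|f w|).
Proof. exact: le_normr_Rintegral. Qed.

Lemma mean_norm_le f (M : R) : measurable_fun [set: Omega] f ->
  (forall w, `|f w| <= M) -> `|mean f| <= M.
Proof.
move=> mf fM; have If := L1_bounded mf fM.
apply: le_trans (mean_norm If) _; rewrite -[leRHS]mean_cst; apply: mean_le => //.
- by apply: (@L1_bounded _ M) => [|w]; [exact: measurableT_comp|rewrite normr_id].
- exact: L1_cst.
Qed.

Lemma mean_indic (A : set Omega) : measurable A ->
  mean (\1_A) = fine (P A).
Proof. by move=> mA; rewrite /mean /Rintegral integral_indic// setIT. Qed.

Lemma L1_indic (A : set Omega) : measurable A -> L1 (\1_A).
Proof.
move=> mA; apply: (@L1_bounded _ 1); first exact: measurable_indic.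
by move=> w; rewrite indicE; case: (_ \in _); rewrite ?normr1 ?normr0.
Qed.

End mean.

Section equal_laws.
Context {R : realType} {d1 d2 d3 : measure_display}
  {O1 : measurableType d1} {O2 : measurableType d2} {T : measurableType d3}.
Variables (P : probability O1 R) (Q : probability O2 R).
Variables (f : O1 -> T) (g : O2 -> T).
Hypotheses (mf : measurable_fun [set: O1] f) (mg : measurable_fun [set: O2] g).
Hypothesis fg : forall B, measurable B -> P (f @^-1` B) = Q (g @^-1` B).

Lemma ge0_integral_eq_law (F : T -> \bar R) : measurable_fun [set: T] F ->
  (forall x, 0 <= F x)%E ->
  (\int[P]_w F (f w) = \int[Q]_w F (g w))%E.
Proof.
move=> mF F0.
have := @ge0_integral_pushforward _ _ _ _ _ f mf P setT F measurableT mF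
  (fun x _ => F0 x).
have := @ge0_integral_pushforward _ _ _ _ _ g mg Q setT F measurableT mF
  (fun x _ => F0 x).
rewrite !preimage_setT /comp => <- <-.
by apply: eq_measure_integral => A mA _; exact: fg.
Qed.

Lemma L1_eq_law (F : T -> R) : measurable_fun [set: T] F ->
  L1 P (fun w => F (f w)) -> L1 Q (fun w => F (g w)).
Proof.
move=> mF /integrableP[_ I]; apply/integrableP; split.
  by apply/measurable_EFinP; exact: measurableT_comp.
have := ge0_integral_eq_law (F := fun x => `|(F x)%:E|%E).
move=> <- //; do 2 apply: measurableT_comp => //.
Qed.

Lemma mean_eq_law (F : T -> R) : measurable_fun [set: T] F ->
  mean P (fun w => F (f w)) = mean Q (fun w => F (g w)).
Proof.
move=> mF; congr fine; rewrite integralE [RHS]integralE.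
have mE : measurable_fun [set: T] (EFin \o F) by exact: measurableT_comp.
rewrite -[fun w => (F (f w))%:E]/((EFin \o F) \o f).
rewrite -[fun w => (F (g w))%:E]/((EFin \o F) \o g).
rewrite (funepos_comp (EFin \o F) f) (funepos_comp (EFin \o F) g).
rewrite (funeneg_comp (EFin \o F) f) (funeneg_comp (EFin \o F) g).
congr (_ - _)%E.
  by apply: (ge0_integral_eq_law (measurable_funepos mE)); exact: funepos_ge0.
by apply: (ge0_integral_eq_law (measurable_funeneg mE)); exact: funeneg_ge0.
Qed.

End equal_laws.

Section product_mean.
Context {R : realType} {d1 d2 : measure_display}
  {O1 : measurableType d1} {O2 : measurableType d2}.
Variables (P : probability O1 R) (Q : probability O2 R).
Variables (F : O1 * O2 -> R) (M : R).
Hypotheses (mF : measurable_fun [set: O1 * O2] F) (FM : forall x, `|F x| <= M).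

Let IF : L1 (P \x Q)%E F := L1_bounded _ mF FM.

Let sectionE x : (\int[Q]_y (F (x, y))%:E)%E = (mean Q (fun y => F (x, y)))%:E.
Proof.
rewrite /mean /Rintegral fineK//; apply: integrable_fin_num => //.
apply: (@L1_bounded _ _ _ Q _ M) => [|y]; last exact: FM.
exact: (measurableT_comp mF (pair1_measurable _)).
Qed.

Let sectionE2 y : (\int[P]_x (F (x, y))%:E)%E = (mean P (fun x => F (x, y)))%:E.
Proof.
rewrite /mean /Rintegral fineK//; apply: integrable_fin_num => //.
apply: (@L1_bounded _ _ _ P _ M) => [|x]; last exact: FM.
exact: (measurableT_comp mF (pair2_measurable _)).
Qed.

Lemma measurable_mean_section :
  measurable_fun [set: O1] (fun x => mean Q (fun y => F (x, y))).
Proof.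
apply/measurable_EFinP.
rewrite (_ : _ \o _ = (fun x => \int[Q]_y (F (x, y))%:E)%E).
  exact: (@measurable_fubini_F _ _ _ _ _ P Q (EFin \o F)).
by apply/funext => x; rewrite /= sectionE.
Qed.

Lemma mean_prod :
  mean (P \x Q)%E F = mean P (fun x => mean Q (fun y => F (x, y))).
Proof.
rewrite {1}/mean /Rintegral -integral12_prod_meas1// /fubini_F.
by congr fine; apply: eq_integral => x _; rewrite sectionE.
Qed.

Lemma mean_swap :
  mean P (fun x => mean Q (fun y => F (x, y))) =
  mean Q (fun y => mean P (fun x => F (x, y))).
Proof.
rewrite -mean_prod {1}/mean /Rintegral -integral21_prod_meas1// /fubini_G.
by congr fine; apply: eq_integral => y _; rewrite sectionE2.
Qed.

End product_mean.

Section conditioning.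
Context {R : realType} {dd : measure_display} {Omega : measurableType dd}.
Variable P : probability Omega R.

(** Makes every result on probability measures applicable to the conditional laws of the theorem. *)
Lemma cond_probability (E : set Omega) : measurable E -> P E != 0%E ->
  exists Q : probability Omega R, forall A, Q A = cond_prob P E A.
Proof.
move=> mE E0; exists (mnormalize (mrestr P mE) P) => A.
(* [mnormalize] returns a default measure when the total mass is zero or infinite; both cases are
   excluded here. *)
suff : (if (P (setT `&` E) == 0)%E || (P (setT `&` E) == +oo)%E then fun U => P U
    else fun U => (P (U `&` E) * ((fine (P (setT `&` E)))^-1)%:E)%E) A =
  cond_prob P E A by [].
rewrite setTI (negPf E0) /= lt_eqF//.
by rewrite (le_lt_trans (probability_le1 _ _))// ltry.
Qed.

Lemma fineP (A : set Omega) : measurable A -> (fine (P A))%:E = P A.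
Proof. by move=> mA; rewrite fineK// fin_num_measure. Qed.

End conditioning.

(** * Pairs of independent variables and Fubini *)

Section independent_pairs.
Context {R : realType} {dd d1 d2 : measure_display} {Omega : measurableType dd}
  {T1 : measurableType d1} {T2 : measurableType d2}.
Variable P : probability Omega R.
Variables (U : Omega -> T1) (W : Omega -> T2).
Hypotheses (mU : measurable_fun [set: Omega] U)
  (mW : measurable_fun [set: Omega] W).

Definition indep_pair : Prop := forall A B, measurable A -> measurable B ->
  P (U @^-1` A `&` W @^-1` B) = (P (U @^-1` A) * P (W @^-1` B))%E.

Let mU' : {mfun Omega >-> T1} := mfun_Sub (mem_set mU).
Let mW' : {mfun Omega >-> T2} := mfun_Sub (mem_set mW).
Let lU : probability T1 R := distribution P mU'.
Let lW : probability T2 R := distribution P mW'.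

Let lUE A : measurable A -> P (U @^-1` A) = lU (id @^-1` A). Proof. by []. Qed.
Let lWE A : measurable A -> P (W @^-1` A) = lW (id @^-1` A). Proof. by []. Qed.

Let prod_law D : measurable D -> indep_pair ->
  P ((fun w => (U w, W w)) @^-1` D) = (lU \x lW)%E D.
Proof.
move=> mD UW; have mUW := measurable_fun_pair mU mW.
pose X : {mfun Omega >-> (T1 * T2)%type} := mfun_Sub (mem_set mUW).
rewrite (@product_measure_unique _ _ _ _ _ lU lW (distribution P X)) => // A B mA mB; exact: UW.
Qed.

(** Independence of [E] and the pair is given on rectangles and wanted on all measurable sets.
    Conditioned on [E], the pair has the product law on rectangles, hence everywhere by uniqueness
    of the product measure, and that law is also its unconditioned one. *)
Lemma indep_event_pair (E : set Omega) (D : set (T1 * T2)) :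
  measurable E -> measurable D -> indep_pair ->
  (forall A B, measurable A -> measurable B ->
    P ((U @^-1` A `&` W @^-1` B) `&` E) =
    (P (U @^-1` A) * P (W @^-1` B) * P E)%E) ->
  P ((fun w => (U w, W w)) @^-1` D `&` E) =
  (P ((fun w => (U w, W w)) @^-1` D) * P E)%E.
Proof.
move=> mE mD UW UWE.
have mUW := measurable_fun_pair mU mW.
have mUD : measurable ((fun w => (U w, W w)) @^-1` D).
  by rewrite -[X in measurable X]setTI; exact: mUW.
(* A null event cannot be conditioned on, but then both sides are 0. *)
have [E0|E0] := eqVneq (P E) 0%E.
  rewrite E0 mule0; apply/eqP; rewrite eq_le measure_ge0 andbT -E0.
  by rewrite le_measure ?inE//; exact: measurableI.
have [Q QE] := cond_probability mE E0.
pose X : {mfun Omega >-> (T1 * T2)%type} := mfun_Sub (mem_set mUW).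
have PEfin : P E \is a fin_num by rewrite fin_num_measure.
have PEK : (P E * ((fine (P E))^-1)%:E)%E = 1%E.
  rewrite -[X in (X * _)%E]fineK// -EFinM divff// fine_eq0//.
have := prod_law mD UW.
rewrite (@product_measure_unique _ _ _ _ _ lU lW (distribution Q X)) //.
  move=> H.
  have -> : P ((fun w => (U w, W w)) @^-1` D) =
    Q ((fun w => (U w, W w)) @^-1` D) := H.
  rewrite QE /cond_prob.
  by rewrite -muleA [X in (_ * X)%E]muleC PEK mule1.
move=> A B mA mB.
suff : Q (U @^-1` A `&` W @^-1` B) = (lU A * lW B)%E by [].
by rewrite QE /cond_prob UWE// -muleA PEK mule1.
Qed.

Lemma mean_indep_pair (F : T1 * T2 -> R) (M : R) : indep_pair ->
  measurable_fun [set: T1 * T2] F -> (forall x, `|F x| <= M) ->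
  mean P (fun w => F (U w, W w)) =
  mean P (fun w => mean P (fun w' => F (U w, W w'))).
Proof.
move=> UW mF FM; have mUW := measurable_fun_pair mU mW.
rewrite (@mean_eq_law _ _ _ _ _ _ _ P (lU \x lW)%E (fun w => (U w, W w)) id)//;
  last by move=> D mD; rewrite prod_law.
rewrite (mean_prod _ _ mF FM).
rewrite -(@mean_eq_law _ _ _ _ _ _ _ P lU U id mU (@measurable_id _ _ _) lUE
  _ (measurable_mean_section lU lW mF FM)).
congr (mean P _); apply/funext => w.
rewrite -(@mean_eq_law _ _ _ _ _ _ _ P lW W id mW (@measurable_id _ _ _) lWE
  (fun y => F (U w, y)))//.
exact: (measurableT_comp mF (pair1_measurable _)).
Qed.

(** Moments require unbounded factors, which [mean_indep_pair] does not allow; integrability of the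
    product comes from Tonelli under the product law. *)
Lemma mean_indep_mul (f : T1 -> R) (g : T2 -> R) : indep_pair ->
  measurable_fun [set: T1] f -> measurable_fun [set: T2] g ->
  L1 P (fun w => f (U w)) -> L1 P (fun w => g (W w)) ->
  L1 P (fun w => f (U w) * g (W w)) /\
  mean P (fun w => f (U w) * g (W w)) =
    mean P (fun w => f (U w)) * mean P (fun w => g (W w)).
Proof.
move=> UW mf mg If Ig; have mUW := measurable_fun_pair mU mW.
pose F x : R := f x.1 * g x.2.
have mF : measurable_fun [set: T1 * T2] F.
  apply: measurable_funM.
    exact: (measurableT_comp mf measurable_fst).
  exact: (measurableT_comp mg measurable_snd).
have E : forall D, measurable D ->
    (lU \x lW)%E (id @^-1` D) = P ((fun w => (U w, W w)) @^-1` D).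
  by move=> D mD; rewrite prod_law.
have If' : L1 lU f := @L1_eq_law _ _ _ _ _ _ _ P lU U id mU
  (@measurable_id _ _ _) lUE _ mf If.
have Ig' : L1 lW g := @L1_eq_law _ _ _ _ _ _ _ P lW W id mW
  (@measurable_id _ _ _) lWE _ mg Ig.
have IF : L1 (lU \x lW)%E F.
  apply/integrable12ltyP; first exact/measurable_EFinP.
  rewrite (_ : (fun x => _) = (fun x => `|f x|%:E * \int[lW]_y `|(g y)%:E|)%E).
    rewrite ge0_integralZr//; [|by do 2 apply: measurableT_comp => //|
      exact: integral_ge0].
    rewrite lte_mul_pinfty//.
    - exact: integral_ge0.
    - by rewrite ge0_fin_numE ?integral_ge0//; case/integrableP: If'.
    - by case/integrableP: Ig'.
  apply/funext => x; rewrite -ge0_integralZl//.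
    by apply: eq_integral => y _; rewrite /= normrM EFinM.
  by do 2 apply: measurableT_comp => //.
split.
  exact: (@L1_eq_law _ _ _ _ _ _ _ (lU \x lW)%E P id
    (fun w => (U w, W w)) (@measurable_id _ _ _) mUW E F mF IF).
rewrite -(@mean_eq_law _ _ _ _ _ _ _ (lU \x lW)%E P id
    (fun w => (U w, W w)) (@measurable_id _ _ _) mUW E F mF).
rewrite (@mean_eq_law _ _ _ _ _ _ _ P lU U id mU (@measurable_id _ _ _) lUE _ mf).
rewrite (@mean_eq_law _ _ _ _ _ _ _ P lW W id mW (@measurable_id _ _ _) lWE _ mg).
have gE : (\int[lW]_y (g y)%:E = (mean lW g)%:E)%E.
  by rewrite fineK//; exact: integrable_fin_num.
rewrite [LHS]/mean /Rintegral -integral12_prod_meas1// /fubini_F.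
rewrite (eq_integral (fun x => (f x)%:E * (mean lW g)%:E)%E).
  rewrite integralZr// fineM//.
  exact: integrable_fin_num.
by move=> x _; rewrite -gE -integralZl.
Qed.

End independent_pairs.

(** * Independent families and the replacement argument *)

(** Summing over a list lets inductions peel off one index at a time. *)
Definition seq_sum {R : realType} {d : nat} {Omega : Type} {I : finType}
  (Z : I -> Omega -> 'rV[R]_d) (s : seq I) (w : Omega) : 'rV[R]_d :=
  \sum_(j <- s) Z j w.

Section independent_family.
Context {R : realType} {d : nat} {dd : measure_display}
  {Omega : measurableType dd}.
Notation V := 'rV[R]_d.
Variables (P : probability Omega R) (I : finType) (Z : I -> Omega -> V).
Hypothesis mZ : forall i, measurable_fun [set: Omega] (Z i).
Implicit Types (J K : {set I}) (F : set Omega) (E : I -> set V).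

Definition cylinder K E : set Omega := \bigcap_(i in [set` K]) (Z i @^-1` E i).

(** Independence of the family indexed by [J], jointly with the event [F]. The sure event gives back
    ordinary independence; other events record groups of variables already dealt with. *)
Definition indep_event F J : Prop := forall K E, K \subset J ->
  (forall i, measurable (E i)) ->
  P (F `&` cylinder K E) = (P F * \prod_(i in K) P (Z i @^-1` E i))%E.

Lemma measurable_preimage {d' : measure_display} {T : measurableType d'}
    (f : Omega -> T) (B : set T) :
  measurable_fun [set: Omega] f -> measurable B -> measurable (f @^-1` B).
Proof. by move=> mf mB; rewrite -[X in measurable X]setTI; exact: mf. Qed.

Lemma measurable_cylinder K E : (forall i, measurable (E i)) ->
  measurable (cylinder K E).
Proof.
move=> mE; apply: fin_bigcap_measurable => [|i _]; last exact: measurable_preimage.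
exact: finite_finset.
Qed.

Lemma measurable_seq_sum s : measurable_fun [set: Omega] (seq_sum Z s).
Proof. exact: measurable_rV_sum. Qed.

Lemma cylinder0 E : cylinder finset.set0 E = setT.
Proof. by apply/seteqP; split=> // w _ i /=; rewrite inE. Qed.

Lemma cylinderU1 K E i : cylinder (i |: K)%SET E = Z i @^-1` E i `&` cylinder K E.
Proof.
apply/seteqP; split=> [w H|w [Hi H] j /=].
  split; first by apply: H; rewrite /= !inE eqxx.
  by move=> j jK; apply: H; rewrite /= !inE jK orbT.
by rewrite !inE => /predU1P[->//|jK]; exact: H.
Qed.

Lemma eq_cylinder K E E' : (forall i, i \in K -> E i = E' i) ->
  cylinder K E = cylinder K E'.
Proof.
move=> EE; apply/seteqP; split=> w H i iK; have := H i iK;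
  by rewrite /= EE.
Qed.

Lemma independent_rvs_event J : independent_rvs P J Z -> indep_event setT J.
Proof.
move=> ind K E KJ mE; rewrite setTI probability_setT mul1e.
by apply: ind => // i _; exists (E i) => //; rewrite setTI.
Qed.

Section base.
Variable JJ : {set I}.
Hypothesis indT : indep_event setT JJ.

(** Induction on [s]. The sum over [l :: s] is a function of [Z l] and the sum over [s]. On
    rectangles the condition on [Z l] joins the cylinder as one more coordinate, which the induction
    hypothesis covers; [indep_event_pair] then reaches the set of pairs [(x, y)] with [x + y] in
    [B]. *)
Lemma indep_event_seq_sum s F J K E (B : set V) : uniq s -> measurable F ->
  J \subset JJ -> {subset s <= J} -> indep_event F J ->
  K \subset J -> {in K, forall i, i \notin s} ->
  (forall i, measurable (E i)) -> measurable B ->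
  P (F `&` seq_sum Z s @^-1` B `&` cylinder K E) =
  (P F * P (seq_sum Z s @^-1` B) * \prod_(i in K) P (Z i @^-1` E i))%E.
Proof.
elim: s F J K E B => [|l s IH] F J K E B.
  move=> _ mF _ _ ind KJ _ mE mB.
  have [B0|B0] := pselect (B 0).
    have -> : seq_sum Z [::] @^-1` B = setT.
      by apply/seteqP; split=> // w _; rewrite /seq_sum /= big_nil.
    by rewrite setIT probability_setT mule1 ind.
  have -> : seq_sum Z [::] @^-1` B = set0.
    by apply/seteqP; split=> // w; rewrite /seq_sum /= big_nil.
  by rewrite setI0 set0I !measure0 mule0 mul0e.
move=> /= /andP[ls us] mF JJJ sJ ind KJ Ks mE mB.
have lJ : l \in J by apply: sJ; rewrite mem_head.
have sJ' : {subset s <= J} by move=> i si; apply: sJ; rewrite inE si orbT.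
have lK : l \notin K by apply/negP => /Ks; rewrite mem_head.
have Ks' : {in K, forall i, i \notin s}.
  by move=> i /Ks; rewrite inE negb_or => /andP[].
have mW := measurable_seq_sum s.
(* The induction hypothesis for the sure event and the cylinder over the single index [l]. *)
have UW : indep_pair P (Z l) (seq_sum Z s).
  move=> A A' mA mA'.
  have := IH setT JJ [set l]%SET (fun=> A) A' us measurableT (subxx _)
    (fun i si => fintype.subsetP JJJ _ (sJ' i si)) indT.
  rewrite finset.sub1set (fintype.subsetP JJJ _ lJ) => /(_ isT).
  have -> : cylinder [set l]%SET (fun=> A) = Z l @^-1` A.
    by rewrite -(finset.setU0 [set l]%SET) cylinderU1 cylinder0 setIT.
  rewrite setTI probability_setT mul1e big_set1 setIC muleC; apply => //.
  by move=> i; rewrite inE => /eqP ->.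
have mC := measurable_cylinder K mE.
have mFC : measurable (F `&` cylinder K E) by exact: measurableI.
have PFC : P (F `&` cylinder K E) =
    (P F * \prod_(i in K) P (Z i @^-1` E i))%E by exact: ind.
pose D : set (V * V) := [set x | B (x.1 + x.2)].
have mD : measurable D.
  have mS : measurable_fun [set: V * V] (fun x : V * V => x.1 + x.2).
    by apply: measurable_rVD; [exact: measurable_fst|exact: measurable_snd].
  by rewrite -[D]setTI; exact: mS.
have DE : (fun w => (Z l w, seq_sum Z s w)) @^-1` D = seq_sum Z (l :: s) @^-1` B.
  by apply/seteqP; split=> w; rewrite /seq_sum /D /= big_cons.
have := @indep_event_pair _ _ _ _ _ _ _ P _ _ (mZ l) mW _ _ mFC mD UW.
rewrite DE PFC => H.
rewrite [X in P (X `&` _)]setIC -setIA H.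
  by rewrite muleA [X in (X * _)%E]muleC.
move=> A A' mA mA'.
(* Absorbs the condition on [Z l] into the cylinder; [l] is not in [K], so nothing is overwritten
   there. *)
pose E' i := if i == l then A else E i.
have mE' i : measurable (E' i) by rewrite /E'; case: ifP.
have lKJ : (l |: K)%SET \subset J by rewrite finset.subUset finset.sub1set lJ.
have lKs : {in (l |: K)%SET, forall i, i \notin s}.
  by move=> i; rewrite !inE => /predU1P[->//|]; exact: Ks'.
have := IH F J (l |: K)%SET E' A' us mF JJJ sJ' ind lKJ lKs mE' mA'.
have EE : forall i, i \in K -> E' i = E i.
  by move=> i iK; rewrite /E'; case: eqP => // il; rewrite -il iK in lK.
rewrite cylinderU1 (eq_cylinder EE) finset.big_setU1//= {1 2}/E' eqxx.
rewrite (eq_bigr (fun i => P (Z i @^-1` E i))); last by move=> i /EE ->.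
move=> K1.
rewrite muleACA [X in (X * _)%E]muleC muleACA -K1; congr (P _).
by apply/seteqP; split=> w [[? ?] [? ?]].
Qed.

End base.

Lemma indep_pair_seq_sum (s : seq I) l : independent_rvs P [set: I]%SET Z ->
  uniq s -> l \notin s -> indep_pair P (seq_sum Z s) (Z l).
Proof.
move=> /independent_rvs_event ind us ls A A' mA mA'.
have := @indep_event_seq_sum _ ind s setT [set: I]%SET [set l]%SET (fun=> A') A us
  measurableT (subxx _) (fun i _ => finset.in_setT i) ind (finset.subsetT _).
have -> : cylinder [set l]%SET (fun=> A') = Z l @^-1` A'.
  by rewrite -(finset.setU0 [set l]%SET) cylinderU1 cylinder0 setIT.
rewrite setTI probability_setT mul1e big_set1; apply => //.
by move=> i; rewrite inE => /eqP ->.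
Qed.

End independent_family.

Lemma indep_pairC {R : realType} {dd d1 d2 : measure_display}
  {Omega : measurableType dd} {T1 : measurableType d1} {T2 : measurableType d2}
  (P : probability Omega R) (U : Omega -> T1) (W : Omega -> T2) :
  indep_pair P U W -> indep_pair P W U.
Proof. by move=> UW A B mA mB; rewrite setIC UW// muleC. Qed.

Definition group_sum {R : realType} {d : nat} {Omega : Type} {I L : finType}
  (Z : I -> Omega -> 'rV[R]_d) (g : I -> L) (l : L) : Omega -> 'rV[R]_d :=
  seq_sum Z (enum [set i | g i == l]%SET).

Lemma sum_group_sum {R : realType} {d : nat} {Omega : Type} {I L : finType}
    (Z : I -> Omega -> 'rV[R]_d) (g : I -> L) (w : Omega) :
  \sum_(l : L) group_sum Z g l w = \sum_i Z i w.
Proof.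
rewrite [RHS](partition_big g xpredT)//=; apply: eq_bigr => l _.
rewrite /group_sum /seq_sum big_enum /=.
by apply: eq_bigl => i; rewrite inE.
Qed.

(** * Independence of sums over disjoint groups *)

Section grouping.
Context {R : realType} {d : nat} {dd : measure_display}
  {Omega : measurableType dd}.
Notation V := 'rV[R]_d.
Variables (P : probability Omega R) (I L : finType) (Z : I -> Omega -> V)
  (g : I -> L).
Hypothesis mZ : forall i, measurable_fun [set: Omega] (Z i).

Lemma independent_group_sum : independent_rvs P [set: I]%SET Z ->
  independent_rvs P [set: L]%SET (group_sum Z g).
Proof.
move=> /independent_rvs_event ind K E _ EK.
have {EK} [B [mB EB]] : exists B : L -> set V, (forall l, measurable (B l)) /\
    forall l, l \in K -> E l = group_sum Z g l @^-1` B l.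
  have H l : exists B, measurable B /\ (l \in K -> E l = group_sum Z g l @^-1` B).
    have [lK|lK] := boolP (l \in K); last by exists set0; split.
    by have [C mC <-] := EK l lK; exists C; split=> // _; rewrite setTI.
  by exists (fun l => sval (cid (H l))); split=> l;
    case: (svalP (cid (H l))).
have -> : \bigcap_(i in [set` K]) E i =
    \bigcap_(i in [set` K]) (group_sum Z g i @^-1` B i).
  by apply: eq_bigcapr => l lK; exact: EB.
rewrite (eq_bigr (fun l => P (group_sum Z g l @^-1` B l))); last first.
  by move=> l lK; rewrite EB.
have mG l : measurable_fun [set: Omega] (group_sum Z g l).
  exact: measurable_seq_sum.
(* The groups are handled one at a time: the event fixing the sums of the groups in [s] stays
   independent of the variables outside these groups. *)
suff H (s : seq L) : uniq s ->
    let F := \bigcap_(i in [set` s]) (group_sum Z g i @^-1` B i) in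
    [/\ measurable F, P F = (\prod_(l <- s) P (group_sum Z g l @^-1` B l))%E &
     indep_event P Z F [set i | g i \notin s]%SET].
  have [_ + _] := H (enum K) (enum_uniq _).
  rewrite big_enum /= => <-; congr (P _).
  by apply/seteqP; split=> w Hw i iK; apply: Hw; rewrite /= mem_enum in iK *.
elim: s => [_ F|l s IH /= /andP[ls us]].
  have -> : F = setT by apply/seteqP; split=> // w _ i.
  split; [by []|by rewrite big_nil probability_setT|].
  by move=> K' E' _; apply: ind; exact: finset.subsetT.
have [mF PF indF] := IH us; set F := \bigcap_(i in _) _ in mF PF indF *.
set F' := \bigcap_(i in _) _.
have F'E : F' = F `&` group_sum Z g l @^-1` B l.
  apply/seteqP; split=> [w H|w [H Hl] i /=].
    by split=> [i si|]; apply: H; rewrite /= inE ?eqxx// [X in _ || X]si orbT.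
  by rewrite inE => /predU1P[->//|]; exact: H.
have mGl : measurable (group_sum Z g l @^-1` B l) by exact: measurable_preimage.
have main (K' : {set I}) (E' : I -> set V) : K' \subset [set i | g i \notin s]%SET ->
    {in K', forall i, g i != l} -> (forall i, measurable (E' i)) ->
    P (F `&` group_sum Z g l @^-1` B l `&` cylinder Z K' E') =
    (P F * P (group_sum Z g l @^-1` B l) * \prod_(i in K') P (Z i @^-1` E' i))%E.
  move=> K's K'l mE'.
  apply: (indep_event_seq_sum mZ ind (J := [set i | g i \notin s]%SET)) => //.
  - exact: enum_uniq.
  - by move=> i; rewrite mem_enum !inE => /eqP ->.
  - by move=> i iK; rewrite mem_enum inE; exact: K'l.
split.
- by rewrite F'E; exact: measurableI.
- have := main finset.set0 (fun=> set0) (finset.sub0set _).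
  rewrite cylinder0 setIT finset.big_set0 mule1 F'E => ->.
  + by rewrite big_cons PF muleC.
  + by move=> i; rewrite inE.
  + by [].
- move=> K' E' K's mE'.
  have K'l i : i \in K' -> (g i != l) /\ (g i \notin s).
    by move=> /(fintype.subsetP K's); rewrite !inE negb_or => /andP.
  rewrite F'E main//; last by move=> i /K'l[].
    congr (_ * _)%E.
    have := main finset.set0 (fun=> set0) (finset.sub0set _).
    rewrite cylinder0 setIT finset.big_set0 mule1 => ->//.
    by move=> i; rewrite inE.
  by apply/fintype.subsetP => i /K'l[_]; rewrite inE.
Qed.

End grouping.

(** * The replacement argument *)

Section lindeberg.
Context {R : realType} {d : nat} {d1 d2 : measure_display}
  {O1 : measurableType d1} {O2 : measurableType d2}.
Notation V := 'rV[R]_d.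
Variables (P : probability O1 R) (Q : probability O2 R) (I : finType).
Variables (Z : I -> O1 -> V) (Z' : I -> O2 -> V).
Hypotheses (mZ : forall i, measurable_fun [set: O1] (Z i))
  (mZ' : forall i, measurable_fun [set: O2] (Z' i)).
Hypotheses (indZ : independent_rvs P [set: I]%SET Z)
  (indZ' : independent_rvs Q [set: I]%SET Z').

(** The two families live on different spaces, so hybrid sums are represented by iterated means. The
    error hypothesis and the conclusion hold at every shift [x], because the terms not being
    replaced are frozen and moved into the shift. *)
Lemma lindeberg (f : V -> R) (M : R) (delta : I -> R) :
  measurable_fun [set: V] f -> (forall x, `|f x| <= M) ->
  (forall l x, `|mean P (fun w => f (x + Z l w)) -
                 mean Q (fun w => f (x + Z' l w))| <= delta l) ->
  forall s x, uniq s ->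
  `|mean P (fun w => f (x + seq_sum Z s w)) -
    mean Q (fun w => f (x + seq_sum Z' s w))| <= \sum_(l <- s) delta l.
Proof.
move=> mf fM fdelta; elim=> [|l s IH] x.
  by move=> _; rewrite /seq_sum; under eq_fun do rewrite big_nil;
    under [X in mean Q X]eq_fun do rewrite big_nil; rewrite !mean_cst subrr normr0 big_nil.
move=> /= /andP[ls us].
pose F (x : V) (y : V * V) := f (x + y.1 + y.2).
have mF (y : V) : measurable_fun [set: V * V] (F y).
  apply: (measurableT_comp mf); apply: measurable_rVD; last exact: measurable_snd.
  by apply: measurable_rVD; [exact: measurable_cst|exact: measurable_fst].
have FM y z : `|F y z| <= M by exact: fM.
have EA : mean P (fun w => f (x + seq_sum Z (l :: s) w)) =
    mean P (fun w => mean P (fun w' => F x (seq_sum Z s w, Z l w'))).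
  rewrite -(@mean_indep_pair _ _ _ _ _ _ _ P _ _ _ _ (F x) M)//.
  - congr (mean P _); apply/funext => w.
    by rewrite /F /= /seq_sum big_cons -addrA [Z l w + _]addrC.
  - exact: measurable_seq_sum.
  - exact: indep_pair_seq_sum.
have ED : mean Q (fun w => f (x + seq_sum Z' (l :: s) w)) =
    mean Q (fun w' => mean Q (fun w => F x (Z' l w', seq_sum Z' s w))).
  rewrite -(@mean_indep_pair _ _ _ _ _ _ _ Q _ _ _ _ (F x) M)//.
  - congr (mean Q _); apply/funext => w.
    by rewrite /F /= /seq_sum big_cons addrA.
  - exact: measurable_seq_sum.
  - by apply: indep_pairC; exact: indep_pair_seq_sum.
pose G (z : O1 * O2) := F x (seq_sum Z s z.1, Z' l z.2).
have mG : measurable_fun [set: O1 * O2] G.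
  apply: (measurableT_comp (mF x)); apply: measurable_fun_pair.
    exact: (measurableT_comp (measurable_seq_sum mZ s) measurable_fst).
  exact: (measurableT_comp (mZ' l) measurable_snd).
pose G1 (z : O1 * O1) := F x (seq_sum Z s z.1, Z l z.2).
have mG1 : measurable_fun [set: O1 * O1] G1.
  apply: (measurableT_comp (mF x)); apply: measurable_fun_pair.
    exact: (measurableT_comp (measurable_seq_sum mZ s) measurable_fst).
  exact: (measurableT_comp (mZ l) measurable_snd).
pose G2 (z : O2 * O2) := F x (Z' l z.1, seq_sum Z' s z.2).
have mG2 : measurable_fun [set: O2 * O2] G2.
  apply: (measurableT_comp (mF x)); apply: measurable_fun_pair.
    exact: (measurableT_comp (mZ' l) measurable_fst).
  exact: (measurableT_comp (measurable_seq_sum mZ' s) measurable_snd).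
pose G3 (z : O2 * O1) := F x (seq_sum Z s z.2, Z' l z.1).
have mG3 : measurable_fun [set: O2 * O1] G3.
  apply: (measurableT_comp (mF x)); apply: measurable_fun_pair.
    exact: (measurableT_comp (measurable_seq_sum mZ s) measurable_snd).
  exact: (measurableT_comp (mZ' l) measurable_fst).
(* The hybrid has [Z'] at [l] and [Z] on [s]. Replacing [l] costs [delta l] with the shift
   [x + seq_sum Z s w]; replacing the rest is the induction hypothesis with the shift
   [x + Z' l w]. *)
pose hyb := mean P (fun w => mean Q (fun w' => G (w, w'))).
have hybE : hyb = mean Q (fun w' => mean P (fun w => G (w, w'))).
  by apply: (mean_swap P Q mG (M := M)) => z; exact: FM.
rewrite EA ED big_cons.
apply: (@le_trans _ _ (`|mean P (fun w => mean P (fun w' => G1 (w, w'))) - hyb| +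
  `|hyb - mean Q (fun w' => mean Q (fun w => G2 (w', w)))|)).
  by rewrite -[X in `|X|](subrKA hyb) ler_normD.
have bd (dO : measure_display) (O : measurableType dO) (m : probability O R)
    (h : O -> R) : measurable_fun [set: O] h -> (forall w, `|h w| <= M) ->
    `|mean m h| <= M by exact: mean_norm_le.
have sec1 (dO dO' : measure_display) (O : measurableType dO)
    (O' : measurableType dO') (h : O * O' -> R) w :
    measurable_fun [set: O * O'] h -> measurable_fun [set: O'] (fun w' => h (w, w')).
  by move=> mh; exact: (measurableT_comp mh (pair1_measurable _)).
have sec2 (dO dO' : measure_display) (O : measurableType dO)
    (O' : measurableType dO') (m : probability O R) (m' : probability O' R)
    (h : O * O' -> R) :
    measurable_fun [set: O * O'] h -> (forall z, `|h z| <= M) ->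
    L1 m (fun w => mean m' (fun w' => h (w, w'))).
  move=> mh hM; apply: (@L1_bounded _ _ _ _ _ M).
    exact: (measurable_mean_section m m' mh hM).
  by move=> w; apply: bd; [exact: sec1|move=> w'; exact: hM].
apply: lerD.
- rewrite -meanB; [|by apply: sec2 => // z; exact: FM|by apply: sec2 => // z; exact: FM].
  apply: mean_norm_le; last first.
    by move=> w; exact: (fdelta l (x + seq_sum Z s w)).
  by apply: measurable_funB; apply: (@L1_measurable _ _ _ P); apply: sec2 => // z; exact: FM.
- have -> : hyb = mean Q (fun w' => mean P (fun w => G3 (w', w))) by [].
  rewrite -meanB; [|by apply: sec2 => // z; exact: FM|by apply: sec2 => // z; exact: FM].
  apply: mean_norm_le.
    by apply: measurable_funB; apply: (@L1_measurable _ _ _ Q); apply: sec2 => // z; exact: FM.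
  move=> w; have := IH (x + Z' l w) us.
  rewrite (_ : (fun w0 => f (x + Z' l w + seq_sum Z s w0)) =
    (fun w0 => G3 (w, w0)))//.
  by apply/funext => w0; rewrite /G3 /F /= addrAC.
Qed.

End lindeberg.

(** * Moments determined by 4-wise independence *)

Section equal_laws_rows.
Context {R : realType} {d1 d2 d3 : measure_display} {O1 : measurableType d1}
  {O2 : measurableType d2} {T : measurableType d3} {k : nat}.
Variables (P : probability O1 R) (Q : probability O2 R).
Variables (f : O1 -> 'rV[T]_k) (g : O2 -> 'rV[T]_k).
Hypotheses (mf : measurable_fun [set: O1] f) (mg : measurable_fun [set: O2] g).

Definition box (B : 'I_k -> set T) : set 'rV[T]_k :=
  [set x | forall a, B a (x ord0 a)].

(** Boxes form a pi-system that generates the sigma-algebra of row vectors. *)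
Lemma eq_law_row :
  (forall B : 'I_k -> set T, (forall a, measurable (B a)) ->
    P (f @^-1` box B) = Q (g @^-1` box B)) ->
  forall D, measurable D -> P (f @^-1` D) = Q (g @^-1` D).
Proof.
move=> fg D mD.
pose lf := distribution P (mfun_Sub (mem_set mf) : {mfun O1 >-> 'rV[T]_k}).
pose lg := distribution Q (mfun_Sub (mem_set mg) : {mfun O2 >-> 'rV[T]_k}).
pose G : set (set 'rV[T]_k) :=
  [set A | exists2 B : 'I_k -> set T, (forall a, measurable (B a)) & A = box B].
have boxT : box (fun=> setT) = setT by apply/seteqP; split=> // x.
suff : lf D = lg D by [].
apply: (@g_sigma_algebra_measure_unique _ _ _ G _ (fun=> setT)) => //.
- move=> _ [B mB ->].
  rewrite (_ : box B = \bigcap_(a in [set: 'I_k])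
      ((fun x : 'rV[T]_k => x ord0 a) @^-1` B a)); last first.
    by apply/seteqP; split=> x H a; [move=> _; exact: H|exact: (H a I)].
  apply: fin_bigcap_measurable => // a _.
  by rewrite -[X in measurable X]setTI; apply: measurable_coord.
- by move=> _; exists (fun=> setT).
- by apply/seteqP; split=> // x _; exists 0%N.
- move=> _ _ [B mB ->] [C mC ->]; exists (fun a => B a `&` C a).
    by move=> a; exact: measurableI.
  by apply/seteqP; split=> x; [move=> [H1 H2] a; split|
    move=> H; split=> a; case: (H a)].
- by move=> _ [B mB ->]; exact: fg.
- by move=> n; rewrite (le_lt_trans (probability_le1 _ _))// ltry.
- move: D mD; apply: smallest_sub; first exact: smallest_sigma_algebra.
  move=> A; rewrite -bigcup_seq => -[a /= _ [C mC <-]].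
  apply: sub_sigma_algebra; exists (fun b => if b == a then C else setT).
    by move=> b; case: ifP.
  apply/seteqP; split=> x /=; first by move=> [_ Cx] b; case: eqP => // ->.
  by move=> /(_ a); rewrite eqxx.
Qed.

End equal_laws_rows.

Section mixed_moments.
Context {R : realType} {d : nat} {d1 d2 : measure_display}
  {O1 : measurableType d1} {O2 : measurableType d2} {I : finType}.
Notation V := 'rV[R]_d.
Variables (P : probability O1 R) (Q : probability O2 R).
Variables (X : I -> O1 -> V) (Y : I -> O2 -> V).
Hypotheses (mX : forall i, measurable_fun [set: O1] (X i))
  (mY : forall i, measurable_fun [set: O2] (Y i)).
Variable J : {set I}.
Hypotheses (indX : kwise_independent_rvs P 4 J X)
  (indY : kwise_independent_rvs Q 4 J Y).
Hypothesis XY : forall j B, measurable B -> P (X j @^-1` B) = Q (Y j @^-1` B).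

Definition coord_prod {O : Type} (Z : I -> O -> V) (u : seq (I * 'I_d)) (w : O)
  : R := \prod_(p <- u) Z p.1 w ord0 p.2.

(** Several entries of [u] may share the variable [j]. Collecting their constraints in one set turns
    a box event into one event per distinct variable, the form to which independence applies. *)
Definition slice (u : seq (I * 'I_d)) (p0 : I * 'I_d)
    (B : 'I_(size u) -> set R) (j : I) : set V :=
  [set v | forall a : 'I_(size u), (nth p0 u a).1 = j ->
             B a (v ord0 (nth p0 u a).2)].

Lemma measurable_slice u p0 B j : (forall a, measurable (B a)) ->
  measurable (@slice u p0 B j).
Proof.
move=> mB.
rewrite (_ : slice p0 B j = \bigcap_(a in [set a : 'I_(size u) | (nth p0 u a).1 = j])
    ((fun v : V => v ord0 (nth p0 u a).2) @^-1` B a)); last first.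
  by apply/seteqP; split=> v H a; exact: H.
apply: fin_bigcap_measurable => [|a _]; first exact: finite_finset.
by rewrite -[X in measurable X]setTI; apply: measurable_coord.
Qed.

Lemma kwise_cylinder {dO : measure_display} {O : measurableType dO}
    (m : probability O R) (Z : I -> O -> V) (u : seq (I * 'I_d))
    (p0 : I * 'I_d) (B : 'I_(size u) -> set R) :
  kwise_independent_rvs m 4 J Z -> (size u <= 4)%N ->
  {in u, forall p, p.1 \in J} -> (forall a, measurable (B a)) ->
  m ((fun w => \row_a Z (nth p0 u a).1 w ord0 (nth p0 u a).2) @^-1` box B) =
  (\prod_(j in [set p.1 | p in u]%SET)
    m (Z j @^-1` slice p0 B j))%E.
Proof.
move=> ind u4 uJ mB.
have mC j := measurable_slice p0 j mB.
set K := [set p.1 | p in u]%SET.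
have KJ : K \subset J by apply/fintype.subsetP => _ /imsetP[p pu ->]; exact: uJ.
have K4 : (#|K| <= 4)%N.
  by apply: leq_trans u4; apply: leq_trans (leq_imset_card _ _) (card_size _).
rewrite -(ind K KJ K4 K (fun j => Z j @^-1` slice p0 B j)) //; last first.
  by move=> j _; exists (slice p0 B j) => //; rewrite setTI.
congr (m _); apply/seteqP; split=> w H.
  by move=> j jK a aj; have := H a; rewrite mxE aj.
move=> a; rewrite mxE; apply: (H (nth p0 u a).1 _ a erefl).
by apply/imsetP; exists (nth p0 u a) => //; rewrite mem_nth.
Qed.

(** At most four distinct variables occur, so 4-wise independence and the marginal laws determine
    the joint law of the factors, and with it both integrability and mean. *)
Lemma eq_law_coord_prod (u : seq (I * 'I_d)) : (size u <= 4)%N ->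
  {in u, forall p, p.1 \in J} ->
  (L1 P (coord_prod X u) -> L1 Q (coord_prod Y u)) /\
  mean P (coord_prod X u) = mean Q (coord_prod Y u).
Proof.
(* The empty product is separate because [nth] needs a default entry [p0]. *)
case: u => [|p0 u'].
  move=> _ _; rewrite /coord_prod; under eq_fun do rewrite big_nil.
  under [X in mean Q X]eq_fun do rewrite big_nil.
  rewrite !mean_cst; split=> // _; under eq_fun do rewrite big_nil.
  exact: L1_cst.
set u := p0 :: u' => u4 uJ.
pose row (O : Type) (Z : I -> O -> V) w : 'rV[R]_(size u) :=
  \row_a Z (nth p0 u a).1 w ord0 (nth p0 u a).2.
have mrow (dO : measure_display) (O : measurableType dO) (Z : I -> O -> V) :
    (forall i, measurable_fun [set: O] (Z i)) -> measurable_fun [set: O] (row O Z).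
  move=> mZ; apply: measurable_rV => a.
  rewrite (_ : (fun w => _) = (fun w => Z (nth p0 u a).1 w ord0 (nth p0 u a).2)).
    exact: (measurableT_comp (measurable_coord _) (mZ _)).
  by apply/funext => w; rewrite mxE.
pose F (x : 'rV[R]_(size u)) := \prod_(a < size u) x ord0 a.
have mF : measurable_fun [set: 'rV[R]_(size u)] F.
  apply: measurable_prod => a _; exact: measurable_coord.
have E (O : Type) (Z : I -> O -> V) : coord_prod Z u = (fun w => F (row O Z w)).
  apply/funext => w; rewrite /coord_prod (big_nth p0) big_mkord.
  by apply: eq_bigr => a _; rewrite mxE.
have law D : measurable D -> P (row _ X @^-1` D) = Q (row _ Y @^-1` D).
  move: D; apply: eq_law_row; [exact: mrow|exact: mrow|].
  move=> B mB; rewrite !kwise_cylinder//; apply: eq_bigr => j _; apply: XY.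
  exact: measurable_slice.
rewrite !E; split.
  exact: (L1_eq_law (mrow _ _ _ mX) (mrow _ _ _ mY) law mF).
exact: (mean_eq_law (mrow _ _ _ mX) (mrow _ _ _ mY) law mF).
Qed.

Hypothesis L4X : forall j i, L1 P (fun w => X j w ord0 i ^+ 4).

(** With [M] the maximum of 1 and the [|x p|], the product is at most [M^4], and [M^4] is 1 or one
    of the summands. *)
Lemma prod_le_pow4 (T : Type) (u : seq T) (x : T -> R) : (size u <= 4)%N ->
  `|\prod_(p <- u) x p| <= 1 + \sum_(p <- u) x p ^+ 4.
Proof.
move=> u4.
have [M [M1 MP MS]] : exists M : R, [/\ 1 <= M,
    `|\prod_(p <- u) x p| <= M ^+ size u & M ^+ 4 <= 1 + \sum_(p <- u) x p ^+ 4].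
  elim: u {u4} => [|p u [M [M1 MP MS]]].
    by exists 1; rewrite !big_nil normr1 expr0 expr1n addr0 !lexx.
  have x4 : 0 <= x p ^+ 4 by rewrite -[4%N]/(2 * 2)%N exprM sqr_ge0.
  have M0 : 0 <= M by rewrite (le_trans _ M1).
  exists (Num.max M `|x p|); split.
  - by rewrite le_max M1.
  - rewrite big_cons normrM exprS ler_pM// ?le_max ?lexx ?orbT//.
    apply: le_trans MP _; rewrite lerXn2r ?nnegrE// ?le_max ?lexx ?M0//.
  - rewrite big_cons; have [Mx|Mx] := leP `|x p| M; first by lra.
    rewrite (_ : `|x p| ^+ 4 = x p ^+ 4); last first.
      by rewrite -[4%N]/(2 * 2)%N exprM real_normK ?num_real// -exprM.
    have : 0 <= M ^+ 4 by rewrite exprn_ge0.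
    by have := exprn_ege1 4 M1; lra.
apply: le_trans MP _; apply: le_trans MS.
by rewrite ler_weXn2l.
Qed.

Lemma measurable_coord_prod {dO : measure_display} {O : measurableType dO}
    (Z : I -> O -> V) u : (forall i, measurable_fun [set: O] (Z i)) ->
  measurable_fun [set: O] (coord_prod Z u).
Proof.
move=> mZ; apply: measurable_prod => p _.
exact: (measurableT_comp (measurable_coord _) (mZ _)).
Qed.

Lemma L1_coord_prod u : (size u <= 4)%N -> L1 P (coord_prod X u).
Proof.
move=> u4; apply: (L1_le (g := fun w => 1 + \sum_(p <- u) X p.1 w ord0 p.2 ^+ 4)).
- exact: measurable_coord_prod.
- by apply: L1D; [exact: L1_cst|apply: L1_sum => p; exact: L4X].
- by move=> w; exact: prod_le_pow4.
Qed.

Definition same_mean (F : O1 -> R) (F' : O2 -> R) : Prop :=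
  [/\ L1 P F, L1 Q F' & mean P F = mean Q F'].

Lemma same_meanZ (c : R) F F' : same_mean F F' ->
  same_mean (fun w => c * F w) (fun w => c * F' w).
Proof.
by move=> [IF IF' FF']; split; [exact: L1Z|exact: L1Z|rewrite !meanZ ?FF'].
Qed.

Lemma same_mean_sum (T : eqType) (r : seq T) (F : T -> O1 -> R)
    (F' : T -> O2 -> R) :
  (forall t, t \in r -> same_mean (F t) (F' t)) ->
  same_mean (fun w => \sum_(t <- r) F t w) (fun w => \sum_(t <- r) F' t w).
Proof.
elim: r => [|t r IH] H.
  under eq_fun do rewrite big_nil; under [X in same_mean _ X]eq_fun do rewrite big_nil.
  by split; [exact: L1_cst|exact: L1_cst|rewrite !mean_cst].
have [I1 I2 E] := H t (mem_head _ _).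
have [|I1' I2' E'] := IH; first by move=> t' tr; apply: H; rewrite inE tr orbT.
under eq_fun do rewrite big_cons; under [X in same_mean _ X]eq_fun do rewrite big_cons.
by split; [exact: L1D|exact: L1D|rewrite !meanD// E E'].
Qed.

Variable s : seq I.
Hypothesis sJ : {subset s <= J}.

(** Expanding one factor of [v] over [s] moves a coordinate from [v] to [u]; the total degree stays
    at most 4, and for empty [v] only a product of coordinates remains. *)
Lemma same_mean_monomial (v : seq 'I_d) (u : seq (I * 'I_d)) :
  (size v + size u <= 4)%N -> {in u, forall p, p.1 \in J} ->
  same_mean (fun w => \prod_(i <- v) seq_sum X s w ord0 i * coord_prod X u w)
            (fun w => \prod_(i <- v) seq_sum Y s w ord0 i * coord_prod Y u w).
Proof.
elim: v u => [|i v IH] u vu uJ.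
  under eq_fun do rewrite big_nil mul1r.
  under [X in same_mean _ X]eq_fun do rewrite big_nil mul1r.
  have [H1 H2] := eq_law_coord_prod vu uJ.
  by split=> //; [exact: L1_coord_prod|apply: H1; exact: L1_coord_prod].
have E (O : Type) (Z : I -> O -> V) :
    (fun w => \prod_(i <- i :: v) seq_sum Z s w ord0 i * coord_prod Z u w) =
    (fun w => \sum_(j <- s)
       (\prod_(i <- v) seq_sum Z s w ord0 i * coord_prod Z ((j, i) :: u) w)).
  apply/funext => w; rewrite big_cons {1}/seq_sum summxE !mulr_suml.
  apply: eq_bigr => j _; rewrite /coord_prod [in RHS]big_cons /=.
  by rewrite [RHS]mulrCA mulrA.
rewrite !E; apply: same_mean_sum => j js; apply: IH.
  by rewrite /= addnS -addSn.
by move=> p; rewrite inE => /predU1P[->|/uJ//]; exact: sJ.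
Qed.

(** Each level of [dirsum] hands one coordinate of the argument to [v], which serves as an
    accumulator until a monomial is left. *)
Lemma same_mean_dirsum k (c : seq 'I_d -> R) (w v : seq 'I_d) :
  (k + size v <= 4)%N ->
  same_mean
    (fun o => \prod_(i <- v) seq_sum X s o ord0 i * dirsum k c w (seq_sum X s o))
    (fun o => \prod_(i <- v) seq_sum Y s o ord0 i * dirsum k c w (seq_sum Y s o)).
Proof.
elim: k w v => [|k IH] w v kv.
  have vu : (size v + size ([::] : seq (I * 'I_d)) <= 4)%N by rewrite addn0.
  have uJ : {in [::] : seq (I * 'I_d), forall p, p.1 \in J} by [].
  have [I1 I2 E] := same_meanZ (c w) (same_mean_monomial vu uJ).
  have EE (O : Type) (Z : I -> O -> V) :
      (fun o => \prod_(i <- v) seq_sum Z s o ord0 i * dirsum 0 c w (seq_sum Z s o)) =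
      (fun o => c w * (\prod_(i <- v) seq_sum Z s o ord0 i * coord_prod Z [::] o)).
    by apply/funext => o; rewrite /coord_prod big_nil mulr1 mulrC.
  by rewrite !EE.
have EE (O : Type) (Z : I -> O -> V) :
    (fun o => \prod_(i <- v) seq_sum Z s o ord0 i * dirsum k.+1 c w (seq_sum Z s o)) =
    (fun o => \sum_(j < d) \prod_(i <- j :: v) seq_sum Z s o ord0 i *
      dirsum k c (j :: w) (seq_sum Z s o)).
  apply/funext => o; rewrite /= mulr_sumr; apply: eq_bigr => j _.
  by rewrite big_cons mulrA [X in X * _]mulrC.
rewrite !EE; apply: same_mean_sum => j _; apply: IH.
by rewrite /= addnS -addSn.
Qed.

Lemma same_mean_jet_poly (phi : seq 'I_d -> V -> R) x :
  same_mean (fun o => jet_poly phi x (seq_sum X s o))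
            (fun o => jet_poly phi x (seq_sum Y s o)).
Proof.
rewrite /jet_poly; apply: same_mean_sum => k _.
have kv : (k + size ([::] : seq 'I_d) <= 4)%N by rewrite addn0 ltnW.
have := same_meanZ k`!%:R^-1 (same_mean_dirsum (phi^~ x) [::] kv).
have EE (O : Type) (Z : I -> O -> V) :
    (fun o => dirsum k (phi^~ x) [::] (seq_sum Z s o) * k`!%:R^-1) =
    (fun o => k`!%:R^-1 * (\prod_(i <- [::]) seq_sum Z s o ord0 i *
      dirsum k (phi^~ x) [::] (seq_sum Z s o))).
  by apply/funext => o; rewrite big_nil mul1r mulrC.
by rewrite !EE.
Qed.

Lemma same_mean_coord_pow (i : 'I_d) (k : nat) : (k <= 4)%N ->
  same_mean (fun o => seq_sum X s o ord0 i ^+ k)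
            (fun o => seq_sum Y s o ord0 i ^+ k).
Proof.
move=> k4.
have vu : (size (nseq k i) + size ([::] : seq (I * 'I_d)) <= 4)%N.
  by rewrite size_nseq addn0.
have uJ : {in [::] : seq (I * 'I_d), forall p, p.1 \in J} by [].
have := same_mean_monomial vu uJ.
have EE (O : Type) (Z : I -> O -> V) :
    (fun o => \prod_(j <- nseq k i) seq_sum Z s o ord0 j * coord_prod Z [::] o) =
    (fun o => seq_sum Z s o ord0 i ^+ k).
  apply/funext => o; rewrite /coord_prod big_nil mulr1 big_nseq.
  by rewrite -Monoid.iteropE.
by rewrite !EE.
Qed.

(** The Taylor polynomials have equal means, so only the two remainders count. The fourth moments
    agree as well, hence [A] bounds both sides. The power [d^4] is [d^3] from [sum4_le] times the
    number of coordinates. *)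
Lemma jet_replace (phi : seq 'I_d -> V -> R) (B M A : R) x :
  measurable_fun [set: V] (phi [::]) -> (forall y, `|phi [::] y| <= M) ->
  jet B phi -> 0 <= B ->
  (forall i, mean P (fun o => seq_sum X s o ord0 i ^+ 4) <= A) ->
  `|mean P (fun o => phi [::] (x + seq_sum X s o)) -
    mean Q (fun o => phi [::] (x + seq_sum Y s o))| <= 2 * B * d%:R ^+ 4 * A.
Proof.
move=> mphi phiM jphi B0 A4.
pose p z := jet_poly phi x z.
have [IP IQ EPQ] := same_mean_jet_poly phi x.
have bound (dO : measure_display) (O : measurableType dO)
    (m : probability O R) (Z : I -> O -> V) :
    (forall i, measurable_fun [set: O] (Z i)) ->
    L1 m (fun o => p (seq_sum Z s o)) ->
    (forall i, L1 m (fun o => seq_sum Z s o ord0 i ^+ 4)) ->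
    (forall i, mean m (fun o => seq_sum Z s o ord0 i ^+ 4) <= A) ->
    `|mean m (fun o => phi [::] (x + seq_sum Z s o)) -
      mean m (fun o => p (seq_sum Z s o))| <= B * d%:R ^+ 4 * A.
  move=> mZ Ip I4 mA.
  have Iphi : L1 m (fun o => phi [::] (x + seq_sum Z s o)).
    apply: (@L1_bounded _ _ _ _ _ M) => [|o]; last exact: phiM.
    apply: (measurableT_comp mphi); apply: measurable_rVD.
      exact: measurable_cst.
    exact: measurable_seq_sum.
  rewrite -meanB//; apply: le_trans (mean_norm (L1B Iphi Ip)) _.
  pose G o := B * (d%:R ^+ 3 * \sum_(i < d) seq_sum Z s o ord0 i ^+ 4).
  have IG : L1 m G by apply: L1Z; apply: L1Z; apply: L1_sum.
  apply: (@le_trans _ _ (mean m G)).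
    apply: mean_le => // [|o].
      exact: integrable_norm (L1B Iphi Ip).
    apply: le_trans (jet_taylor _ _ jphi) _; rewrite ler_wpM2l//.
    exact: (sum4_le (fun i => seq_sum Z s o ord0 i)).
  rewrite /G meanZ; last by apply: L1Z; apply: L1_sum.
  rewrite meanZ; last exact: L1_sum.
  rewrite mean_sum// -mulrA ler_wpM2l// [d%:R ^+ 4]exprSr -mulrA ler_wpM2l ?exprn_ge0//.
  apply: le_trans (ler_sum _ (fun i _ => mA i)) _.
  by rewrite sumr_const card_ord mulr_natl.
have H4 i := same_mean_coord_pow i (leqnn 4).
have B1 := bound _ _ P X mX IP (fun i => let: And3 a _ _ := H4 i in a) A4.
have B2 := bound _ _ Q Y mY IQ (fun i => let: And3 _ a _ := H4 i in a).
have {}B2 : `|mean Q (fun o => phi [::] (x + seq_sum Y s o)) -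
    mean Q (fun o => p (seq_sum Y s o))| <= B * d%:R ^+ 4 * A.
  by apply: B2 => i; have [_ _ <-] := H4 i.
apply: (@le_trans _ _ (B * d%:R ^+ 4 * A + B * d%:R ^+ 4 * A)); last by lra.
apply: le_trans (lerD B1 B2); rewrite -[in leLHS](subrKA (mean P (fun o => p (seq_sum X s o)))).
apply: le_trans (ler_normD _ _) _; rewrite lerD2l EPQ.
by rewrite distrC.
Qed.

End mixed_moments.

(** * Fourth moments and small balls for sums of independent vectors *)

Section sums_of_independent.
Context {R : realType} {d : nat} {dd : measure_display}
  {Omega : measurableType dd} {I : finType}.
Notation V := 'rV[R]_d.
Variables (P : probability Omega R) (X : I -> Omega -> V).
Hypothesis mX : forall i, measurable_fun [set: Omega] (X i).
Hypothesis indX : independent_rvs P [set: I]%SET X.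
Hypothesis L4X : forall j i, L1 P (fun w => X j w ord0 i ^+ 4).
Implicit Types (s : seq I) (i : 'I_d) (j l : I).

Lemma independent_kwise (k : nat) (J : {set I}) : kwise_independent_rvs P k J X.
Proof.
move=> K KJ _ K' E K'K HE; apply: indX => //; exact: finset.subsetT.
Qed.

(** Obtained by comparing [X] with itself, since [same_mean] includes integrability. *)
Lemma L1_seq_sum_pow s i (k : nat) : (k <= 4)%N ->
  L1 P (fun w => seq_sum X s w ord0 i ^+ k).
Proof.
move=> k4.
have sT : {subset s <= [set: I]%SET} by move=> j _; rewrite finset.in_setT.
by have [] := same_mean_coord_pow mX mX (@independent_kwise 4 _)
  (@independent_kwise 4 _) (fun _ _ _ => erefl) L4X sT i k4.
Qed.

Lemma seq_sum1 j : seq_sum X [:: j] = X j.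
Proof. by apply/funext => w; rewrite /seq_sum big_seq1. Qed.

Lemma L1_coord_pow j i (k : nat) : (k <= 4)%N -> L1 P (fun w => X j w ord0 i ^+ k).
Proof. by move=> k4; rewrite -seq_sum1; exact: L1_seq_sum_pow. Qed.

Lemma mean_seq_sum_mul s l i (a b : nat) : uniq s -> l \notin s ->
  (a <= 4)%N -> (b <= 4)%N ->
  L1 P (fun w => seq_sum X s w ord0 i ^+ a * X l w ord0 i ^+ b) /\
  mean P (fun w => seq_sum X s w ord0 i ^+ a * X l w ord0 i ^+ b) =
  mean P (fun w => seq_sum X s w ord0 i ^+ a) *
  mean P (fun w => X l w ord0 i ^+ b).
Proof.
move=> us ls a4 b4.
apply: (@mean_indep_mul _ _ _ _ _ _ _ P (seq_sum X s) (X l)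
  (measurable_seq_sum mX s) (mX l)
  (fun v => v ord0 i ^+ a) (fun v => v ord0 i ^+ b)).
- exact: indep_pair_seq_sum.
- by apply: measurable_funX; exact: measurable_coord.
- by apply: measurable_funX; exact: measurable_coord.
- exact: L1_seq_sum_pow.
- exact: L1_coord_pow.
Qed.

Lemma seq_sum_cons s l i w :
  seq_sum X (l :: s) w ord0 i = seq_sum X s w ord0 i + X l w ord0 i.
Proof. by rewrite /seq_sum big_cons mxE addrC. Qed.

Hypothesis EX : forall j i, mean P (fun w => X j w ord0 i) = 0.

Lemma mean_seq_sum_linear s i : mean P (fun w => seq_sum X s w ord0 i) = 0.
Proof.
rewrite (_ : (fun w => _) = (fun w => \sum_(j <- s) X j w ord0 i)); last first.
  by apply/funext => w; rewrite /seq_sum summxE.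
rewrite mean_sum; first by rewrite big1.
by move=> j; have := @L1_coord_pow j i 1 isT; under eq_fun do rewrite expr1.
Qed.

Lemma mean_seq_sum_sq s i : uniq s ->
  mean P (fun w => seq_sum X s w ord0 i ^+ 2) =
  \sum_(j <- s) mean P (fun w => X j w ord0 i ^+ 2).
Proof.
elim: s => [_|l s IH /= /andP[ls us]].
  rewrite big_nil (_ : (fun w => _) = (fun=> 0)) ?mean_cst//.
  by apply/funext => w; rewrite /seq_sum big_nil mxE expr0n.
rewrite big_cons -IH//.
have [I11 E11] := mean_seq_sum_mul i us ls (isT : (1 <= 4)%N) (isT : (1 <= 4)%N).
have I2 := @L1_seq_sum_pow s i 2 isT; have I2' := @L1_coord_pow l i 2 isT.
have E0 : mean P (fun w => seq_sum X s w ord0 i ^+ 1) = 0.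
  by under eq_fun do rewrite expr1; rewrite mean_seq_sum_linear.
rewrite (_ : (fun w => _) = (fun w => seq_sum X s w ord0 i ^+ 2 +
  (2 * (seq_sum X s w ord0 i ^+ 1 * X l w ord0 i ^+ 1) + X l w ord0 i ^+ 2))).
  rewrite meanD//; last by apply: L1D => //; exact: L1Z.
  rewrite meanD//; last exact: L1Z.
  by rewrite meanZ// E11 E0 mul0r mulr0 add0r addrC.
by apply/funext => w; rewrite seq_sum_cons; ring.
Qed.

(** Centering kills the odd terms, so adding a variable of variance bound [g] to a sum of variance
    bound [S] costs [6 S g + K g^2]. The factor 3 is dictated by the cross term: [3 K (S + g)^2]
    contains [6 K S g]. *)
Lemma mean_seq_sum_quartic s i (sg : I -> R) (K : R) : uniq s -> 1 <= K ->
  (forall j, mean P (fun w => X j w ord0 i ^+ 2) <= sg j) ->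
  (forall j, mean P (fun w => X j w ord0 i ^+ 4) <= K * sg j ^+ 2) ->
  mean P (fun w => seq_sum X s w ord0 i ^+ 4) <= 3 * K * (\sum_(j <- s) sg j) ^+ 2.
Proof.
move=> + K1 sg2 sg4; elim: s => [_|l s IH /= /andP[ls us]].
  rewrite big_nil (_ : (fun w => _) = (fun=> 0)).
    by rewrite mean_cst expr0n mulr0.
  by apply/funext => w; rewrite /seq_sum big_nil mxE expr0n.
have {}IH := IH us.
have [I31 E31] := mean_seq_sum_mul i us ls (isT : (3 <= 4)%N) (isT : (1 <= 4)%N).
have [I22 E22] := mean_seq_sum_mul i us ls (isT : (2 <= 4)%N) (isT : (2 <= 4)%N).
have [I13 E13] := mean_seq_sum_mul i us ls (isT : (1 <= 4)%N) (isT : (3 <= 4)%N).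
have I4 := @L1_seq_sum_pow s i 4 isT; have I4' := @L1_coord_pow l i 4 isT.
have E0 : mean P (fun w => seq_sum X s w ord0 i ^+ 1) = 0.
  by under eq_fun do rewrite expr1; rewrite mean_seq_sum_linear.
have E0' : mean P (fun w => X l w ord0 i ^+ 1) = 0.
  by under eq_fun do rewrite expr1; rewrite EX.
rewrite (_ : (fun w => _) = (fun w => seq_sum X s w ord0 i ^+ 4 +
  (4 * (seq_sum X s w ord0 i ^+ 3 * X l w ord0 i ^+ 1) +
  (6 * (seq_sum X s w ord0 i ^+ 2 * X l w ord0 i ^+ 2) +
  (4 * (seq_sum X s w ord0 i ^+ 1 * X l w ord0 i ^+ 3) + X l w ord0 i ^+ 4)))));
  last by apply/funext => w; rewrite seq_sum_cons; ring.
rewrite !meanD ?meanZ//;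
  do ?[exact: L1Z|apply: L1D => //]; do ?[exact: L1Z|apply: L1D => //].
rewrite E31 E22 E13 E0 E0' !mulr0 !mul0r !mulr0 !add0r big_cons.
have V0 : mean P (fun w => seq_sum X s w ord0 i ^+ 2) <= \sum_(j <- s) sg j.
  by rewrite mean_seq_sum_sq// ler_sum.
have p0 : 0 <= mean P (fun w => seq_sum X s w ord0 i ^+ 2).
  by apply: mean_ge0 => w; exact: sqr_ge0.
have p1 : 0 <= mean P (fun w => X l w ord0 i ^+ 2).
  by apply: mean_ge0 => w; exact: sqr_ge0.
have V1 := sg2 l; have V4 := sg4 l.
have H (A A4 B B4 S g : R) : 0 <= A -> 0 <= B -> A <= S -> B <= g ->
    A4 <= 3 * K * S ^+ 2 -> B4 <= K * g ^+ 2 ->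
    A4 + (6 * (A * B) + B4) <= 3 * K * (g + S) ^+ 2.
  move=> A0 B0 AS Bg A4S B4g.
  have h1 : A * B <= S * g by exact: ler_pM.
  have h2 : S * g <= K * (S * g).
    by rewrite ler_peMl// mulr_ge0// (le_trans _ AS, le_trans _ Bg).
  have h3 : 0 <= K * g ^+ 2 by rewrite mulr_ge0 ?sqr_ge0// (le_trans _ K1).
  rewrite (_ : 3 * K * (g + S) ^+ 2 = 3 * K * S ^+ 2 + 6 * (K * (S * g)) +
    3 * (K * g ^+ 2)); last by ring.
  lra.
exact: H.
Qed.

(** The squared modulus of the characteristic function of coordinate [i], in real terms. *)
Definition charsq s i (m : R) : R :=
  mean P (fun w => cos (m * seq_sum X s w ord0 i)) ^+ 2 +
  mean P (fun w => sin (m * seq_sum X s w ord0 i)) ^+ 2.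

Lemma measurable_cos_coord i (m : R) :
  measurable_fun [set: V] (fun v : V => cos (m * v ord0 i)).
Proof.
apply: (measurableT_comp (measurable_funTS (continuous_measurable_fun (@continuous_cos R)))).
by apply: measurable_funM => //; exact: measurable_coord.
Qed.

Lemma measurable_sin_coord i (m : R) :
  measurable_fun [set: V] (fun v : V => sin (m * v ord0 i)).
Proof.
apply: (measurableT_comp (measurable_funTS (continuous_measurable_fun (@continuous_sin R)))).
by apply: measurable_funM => //; exact: measurable_coord.
Qed.

Lemma L1_cos_coord (Z : Omega -> V) i (m : R) : measurable_fun [set: Omega] Z ->
  L1 P (fun w => cos (m * Z w ord0 i)).
Proof.
move=> mZ; apply: (@L1_bounded _ _ _ _ _ 1) => [|w]; last exact: cos_max.
exact: (measurableT_comp (measurable_cos_coord i m) mZ).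
Qed.

Lemma L1_sin_coord (Z : Omega -> V) i (m : R) : measurable_fun [set: Omega] Z ->
  L1 P (fun w => sin (m * Z w ord0 i)).
Proof.
move=> mZ; apply: (@L1_bounded _ _ _ _ _ 1) => [|w]; last exact: sin_max.
exact: (measurableT_comp (measurable_sin_coord i m) mZ).
Qed.

(** Addition formulas, then [(a c - b e)^2 + (b c + a e)^2 = (a^2 + b^2) (c^2 + e^2)]. *)
Lemma charsq_prod s i (m : R) : uniq s ->
  charsq s i m = \prod_(j <- s) charsq [:: j] i m.
Proof.
elim: s => [_|l s IH /= /andP[ls us]].
  rewrite big_nil /charsq.
  rewrite (_ : (fun w => _) = fun=> 1); last first.
    by apply/funext => w; rewrite /seq_sum big_nil mxE mulr0 cos0.
  rewrite (_ : (fun w => sin _) = fun=> 0); last first.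
    by apply/funext => w; rewrite /seq_sum big_nil mxE mulr0 sin0.
  by rewrite !mean_cst expr1n expr0n addr0.
rewrite big_cons -IH// /charsq seq_sum1.
have ind := indep_pair_seq_sum mX indX us ls.
have ms := measurable_seq_sum mX s.
have mul (f g : V -> R) : measurable_fun [set: V] f -> measurable_fun [set: V] g ->
    (forall v, `|f v| <= 1) -> (forall v, `|g v| <= 1) ->
    L1 P (fun w => f (seq_sum X s w) * g (X l w)) /\
    mean P (fun w => f (seq_sum X s w) * g (X l w)) =
    mean P (fun w => f (seq_sum X s w)) * mean P (fun w => g (X l w)).
  move=> mf mg f1 g1; apply: (@mean_indep_mul _ _ _ _ _ _ _ P _ _ ms (mX l)) => //.
    apply: (@L1_bounded _ _ _ _ _ 1) => // ; exact: (measurableT_comp mf ms).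
  apply: (@L1_bounded _ _ _ _ _ 1) => // ; exact: (measurableT_comp mg (mX l)).
have mc := measurable_cos_coord i m; have msn := measurable_sin_coord i m.
have [Icc Ecc] := mul _ _ mc mc (fun v => cos_max _) (fun v => cos_max _).
have [Iss Ess] := mul _ _ msn msn (fun v => sin_max _) (fun v => sin_max _).
have [Ics Ecs] := mul _ _ mc msn (fun v => cos_max _) (fun v => sin_max _).
have [Isc Esc] := mul _ _ msn mc (fun v => sin_max _) (fun v => cos_max _).
rewrite (_ : (fun w => cos (m * seq_sum X (l :: s) w ord0 i)) = (fun w =>
   cos (m * seq_sum X s w ord0 i) * cos (m * X l w ord0 i) -
   sin (m * seq_sum X s w ord0 i) * sin (m * X l w ord0 i))); last first.
  by apply/funext => w; rewrite seq_sum_cons mulrDr cosD.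
rewrite (_ : (fun w => sin (m * seq_sum X (l :: s) w ord0 i)) = (fun w =>
   sin (m * seq_sum X s w ord0 i) * cos (m * X l w ord0 i) +
   cos (m * seq_sum X s w ord0 i) * sin (m * X l w ord0 i))); last first.
  by apply/funext => w; rewrite seq_sum_cons mulrDr sinD.
rewrite meanB// meanD// Ecc Ess Ecs Esc; ring.
Qed.

(** Write [v] and [q] for the second and fourth moments. The mean cosine lies in [[0, 1]], so its
    square is at most [1 - m^2 v / 2 + m^4 q]. The mean sine is at most [m^2 v] by centering, so its
    square is at most [m^4 q]. The hypothesis on [m] gives [m^2 v <= 1], which keeps the mean cosine
    nonnegative. *)
Lemma charsq1_le j i (m : R) :
  m ^+ 4 * mean P (fun w => X j w ord0 i ^+ 4) <= 1 ->
  charsq [:: j] i m <=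
  expR (- (m ^+ 2 / 2) * mean P (fun w => X j w ord0 i ^+ 2) +
        2 * m ^+ 4 * mean P (fun w => X j w ord0 i ^+ 4)).
Proof.
rewrite /charsq seq_sum1 => m4.
have I1 : L1 P (fun w => X j w ord0 i).
  by have := @L1_coord_pow j i 1 isT; under eq_fun do rewrite expr1.
have I2 := @L1_coord_pow j i 2 isT; have I4 := @L1_coord_pow j i 4 isT.
set v := mean P (fun w => X j w ord0 i ^+ 2).
set q := mean P (fun w => X j w ord0 i ^+ 4) in m4 *.
have v0 : 0 <= v by apply: mean_ge0 => w; exact: sqr_ge0.
(* Jensen, from the mean of [(x^2 - v)^2]. *)
have vq : v ^+ 2 <= q.
  have : 0 <= mean P (fun w => X j w ord0 i ^+ 4 +
      ((- 2 * v) * X j w ord0 i ^+ 2 + v ^+ 2)).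
    apply: mean_ge0 => w.
    rewrite (_ : _ + _ = (X j w ord0 i ^+ 2 - v) ^+ 2) ?sqr_ge0//; ring.
  rewrite meanD//; last by apply: L1D; [exact: L1Z|exact: L1_cst].
  rewrite meanD//; [|exact: L1Z|exact: L1_cst].
  rewrite meanZ// mean_cst -/v -/q; lra.
have Ic := L1_cos_coord i m (mX j); have Is := L1_sin_coord i m (mX j).
set c := mean P _ in Ic *; set sn := mean P _ in Is *.
have c1 : c <= 1.
  rewrite -[leRHS](mean_cst P 1); apply: mean_le => //; exact: L1_cst.
have cl : 1 - m ^+ 2 * v <= c.
  rewrite -[1](mean_cst P 1) -meanZ// -meanB//; [|exact: L1_cst|exact: L1Z].
  apply: mean_le => //; first by apply: L1B; [exact: L1_cst|exact: L1Z].
  by move=> w; have := cos_ge_quadratic (m * X j w ord0 i); rewrite exprMn.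
have cu : c <= 1 - m ^+ 2 / 2 * v + m ^+ 4 * q.
  rewrite -[X in X - _ + _](mean_cst P 1) -!meanZ// -meanB//;
    [|exact: L1_cst|exact: L1Z].
  rewrite -meanD//; [|by apply: L1B; [exact: L1_cst|exact: L1Z]|exact: L1Z].
  apply: mean_le => //.
    by apply: L1D; [apply: L1B; [exact: L1_cst|exact: L1Z]|exact: L1Z].
  move=> w; have := cos_le_quartic (m * X j w ord0 i); rewrite !exprMn.
  by move/le_trans; apply; rewrite [X in _ - X + _]mulrAC.
have su : `|sn| <= m ^+ 2 * v.
  have -> : sn = mean P (fun w => sin (m * X j w ord0 i) - m * X j w ord0 i).
    by rewrite meanB//; [rewrite meanZ// EX mulr0 subr0|exact: L1Z].
  have Id : L1 P (fun w => sin (m * X j w ord0 i) - m * X j w ord0 i).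
    by apply: L1B => //; exact: L1Z.
  apply: le_trans (mean_norm Id) _; rewrite -meanZ//; apply: mean_le.
  - exact: integrable_norm Id.
  - exact: L1Z.
  - by move=> w; rewrite -exprMn; exact: sin_sub_id.
have m40 : 0 <= m ^+ 4 by rewrite -[4%N]/(2 * 2)%N exprM sqr_ge0.
have mvq : (m ^+ 2 * v) ^+ 2 <= m ^+ 4 * q.
  by rewrite exprMn -exprM ler_wpM2l.
have mv1 : m ^+ 2 * v <= 1.
  have mv0 : 0 <= m ^+ 2 * v by rewrite mulr_ge0 ?sqr_ge0.
  by rewrite -(@ler_pXn2r _ 2)// ?nnegrE// expr1n; exact: le_trans mvq _.
have c0 : 0 <= c by apply: le_trans cl; lra.
have cc : c ^+ 2 <= c by rewrite expr2 ler_piMr.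
have ss : sn ^+ 2 <= m ^+ 4 * q.
  apply: le_trans mvq; rewrite -(real_normK (num_real sn)).
  by rewrite lerXn2r ?nnegrE// mulr_ge0 ?sqr_ge0.
apply: le_trans (expR_ge1Dx _); lra.
Qed.

(** The fourth-order corrections total at most 2, leaving [exp (2 - m^2 / 2)] for the squared
    modulus; Cauchy-Schwarz removes the phase [m * th]. The Gaussian decay is then weakened to a
    rational function, whose sum over the frequencies telescopes. *)
Lemma mean_cos_le s i (m th eps : R) : uniq s ->
  \sum_(j <- s) mean P (fun w => X j w ord0 i ^+ 2) = 1 ->
  \sum_(j <- s) mean P (fun w => X j w ord0 i ^+ 4) <= eps ->
  m ^+ 4 * eps <= 1 ->
  mean P (fun w => cos (m * (seq_sum X s w ord0 i - th))) <=
  expR 1 * (4 / (4 + m ^+ 2)).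
Proof.
move=> us v1 qeps meps.
have m40 : 0 <= m ^+ 4 by rewrite -[4%N]/(2 * 2)%N exprM sqr_ge0.
have q0 j : 0 <= mean P (fun w => X j w ord0 i ^+ 4).
  by apply: mean_ge0 => w; rewrite -[4%N]/(2 * 2)%N exprM sqr_ge0.
have mq : m ^+ 4 * \sum_(j <- s) mean P (fun w => X j w ord0 i ^+ 4) <= 1.
  by apply: le_trans meps; rewrite ler_wpM2l.
have cs : charsq s i m <= expR (2 - m ^+ 2 / 2).
  rewrite charsq_prod//.
  apply: (@le_trans _ _ (\prod_(j <- s)
      expR (- (m ^+ 2 / 2) * mean P (fun w => X j w ord0 i ^+ 2) +
        2 * m ^+ 4 * mean P (fun w => X j w ord0 i ^+ 4)))).
    rewrite big_seq [leRHS]big_seq; apply: ler_prod => j js.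
    rewrite addr_ge0 ?sqr_ge0//=; apply: charsq1_le; apply: le_trans mq.
    rewrite ler_wpM2l// (big_rem j)//= lerDl.
    by apply: sumr_ge0.
  rewrite -expR_sum ler_expR big_split /= -!mulr_sumr v1 mulr1 addrC.
  by rewrite lerD2r -[2 * _ * _]mulrA; lra.
have ms := measurable_seq_sum mX s.
have Ic := L1_cos_coord i m ms; have Is := L1_sin_coord i m ms.
have -> : mean P (fun w => cos (m * (seq_sum X s w ord0 i - th))) =
    cos (m * th) * mean P (fun w => cos (m * seq_sum X s w ord0 i)) +
    sin (m * th) * mean P (fun w => sin (m * seq_sum X s w ord0 i)).
  rewrite -!meanZ// -meanD; [|exact: L1Z|exact: L1Z].
  congr (mean P _); apply/funext => w; rewrite mulrBr cosB; ring.
move: cs; rewrite /charsq; set c := mean P _; set sn := mean P _ => cs.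
set a := cos (m * th); set b := sin (m * th).
have ab : a ^+ 2 + b ^+ 2 = 1 by rewrite cos2Dsin2.
have e0 : 0 <= expR (1 - m ^+ 2 / 4) by exact: expR_ge0.
have -> : expR 1 * (4 / (4 + m ^+ 2)) = expR 1 * (1 + m ^+ 2 / 4)^-1.
  by congr (_ * _); field; rewrite !gt_eqF// ltr_wpDr ?sqr_ge0.
apply: (@le_trans _ _ (expR (1 - m ^+ 2 / 4))); last first.
  rewrite expRD ler_wpM2l ?expR_ge0// expRN lef_pV2 ?posrE ?expR_gt0//.
    exact: expR_ge1Dx.
  by rewrite ltr_wpDr// divr_ge0 ?sqr_ge0.
have [S0|S0] := leP (a * c + b * sn) 0; first exact: le_trans S0 e0.
rewrite -(@ler_pXn2r _ 2)// ?nnegrE ?(ltW S0)//.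
apply: (@le_trans _ _ (c ^+ 2 + sn ^+ 2)).
  rewrite -[leRHS]mul1r -ab -subr_ge0.
  by rewrite (_ : _ - _ = (a * sn - b * c) ^+ 2) ?sqr_ge0//; ring.
apply: le_trans cs _; rewrite -expRM_natl ler_expR; lra.
Qed.

Lemma mean_fejer_le s i (th eps : R) (N : nat) : uniq s -> (0 < N)%N ->
  \sum_(j <- s) mean P (fun w => X j w ord0 i ^+ 2) = 1 ->
  \sum_(j <- s) mean P (fun w => X j w ord0 i ^+ 4) <= eps ->
  N%:R ^+ 4 * eps <= 1 ->
  mean P (fun w => fejer N (seq_sum X s w ord0 i - th)) <= 68 * expR 1 / N%:R.
Proof.
move=> us N0 v1 qeps Neps.
have eps0 : 0 <= eps.
  apply: le_trans qeps; apply: sumr_ge0 => j _; apply: mean_ge0 => w.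
  by rewrite -[4%N]/(2 * 2)%N exprM sqr_ge0.
have ms := measurable_seq_sum mX s.
have Ic (m : R) : L1 P (fun w => cos (m * (seq_sum X s w ord0 i - th))).
  apply: (@L1_bounded _ _ _ _ _ 1) => [|w]; last exact: cos_max.
  apply: (measurableT_comp (measurable_funTS (continuous_measurable_fun (@continuous_cos R)))).
  apply: measurable_funM => //; apply: measurable_funB => //.
  exact: (measurableT_comp (measurable_coord i) ms).
rewrite /fejer meanZ; last by apply: L1_sum => k; exact: L1_sum.
rewrite mean_sum; last by move=> k; exact: L1_sum.
under eq_bigr do rewrite mean_sum//.
(* The cosine bound is only available for [k, l < N], while [fejer_mean_le] asks for all indices.
   Subtracting 2 elsewhere makes the entry negative without changing the sums. *)
pose c (k l : nat) := mean P (fun w => cos ((k%:R - l%:R) *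
  (seq_sum X s w ord0 i - th))) - 
  (if (k < N)%N && (l < N)%N then 0 else 2).
have sq (k l : nat) : ((k%:R - l%:R) ^+ 2 : R) = ((k - l) + (l - k))%N%:R ^+ 2.
  case: (leqP k l) => [kl|/ltnW kl].
    by rewrite (eqP kl) add0n natrB// -sqrrN opprB.
  by rewrite (eqP kl) addn0 natrB.
have := @fejer_mean_le R c (expR 1) N (expR_ge0 1) N0.
rewrite (eq_bigr (fun k : 'I_N => \sum_(l < N) mean P (fun w =>
   cos ((k%:R - l%:R) * (seq_sum X s w ord0 i - th))))); last first.
  by move=> k _; apply: eq_bigr => l _; rewrite /c !ltn_ord subr0.
apply => k l; rewrite /c -sq; case: ifP => [/andP[kN lN]|_].
  rewrite subr0; apply: (mean_cos_le _ us v1 qeps).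
  apply: le_trans Neps; rewrite ler_wpM2r//.
  have D : `|k%:R - l%:R| <= N%:R :> R.
    have : (k%:R : R) <= N%:R by rewrite ler_nat ltnW.
    have : (l%:R : R) <= N%:R by rewrite ler_nat ltnW.
    have : 0 <= (k%:R : R) by []. have : 0 <= (l%:R : R) by [].
    by rewrite ler_norml; move=> *; apply/andP; split; lra.
  rewrite (_ : _ ^+ 4 = `|k%:R - l%:R| ^+ 4); last first.
    by rewrite -[4%N]/(2 * 2)%N exprM [RHS]exprM real_normK ?num_real.
  by rewrite lerXn2r ?nnegrE.
apply: (@le_trans _ _ (1 - 2)).
  rewrite lerD2r -[leRHS](mean_cst P 1); apply: mean_le => //; exact: L1_cst.
apply: (@le_trans _ _ 0); first by lra.
by rewrite mulr_ge0 ?expR_ge0// divr_ge0// addr_ge0 ?sqr_ge0.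
Qed.

End sums_of_independent.

(** * Comparison for a fixed partition *)

Section sign_patterns.
Context {R : realType} {d : nat}.
Notation V := 'rV[R]_d.

Definition sign_row (s : {ffun 'I_d -> bool}) : V :=
  \row_i (if s i then 1 else -1).

Definition signs (Theta x : V) : {ffun 'I_d -> bool} :=
  [ffun i => 0 <= x ord0 i - Theta ord0 i].

Lemma map_sgn1 (Theta x : V) : map_mx sgn1 (x - Theta) = sign_row (signs Theta x).
Proof. by apply/rowP => i; rewrite !mxE ffunE /sgn1. Qed.

Lemma measurable_signs (Theta : V) (s : {ffun 'I_d -> bool}) :
  measurable [set x : V | signs Theta x = s].
Proof.
rewrite (_ : [set x | _] = \bigcap_(i in [set: 'I_d])
   ((fun x : V => x ord0 i) @^-1`
      (if s i then `[Theta ord0 i, +oo[%classic else `]-oo, Theta ord0 i[%classic))); last first.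
  apply/seteqP; split=> [x /= <- i _|x H] /=.
    rewrite ffunE subr_ge0; case: leP => h; first by rewrite /= in_itv /= h.
    by rewrite /= in_itv /= h.
  apply/ffunP => i; rewrite ffunE subr_ge0; have := H i I => /=.
  by case: (s i) => /=; rewrite in_itv /= ?andbT => h; rewrite ?h// leNgt h.
apply: fin_bigcap_measurable => // i _.
rewrite -[X in measurable X]setTI; apply: measurable_coord => //.
by case: (s i).
Qed.

Lemma measurable_orthant_union (U : set V) (Theta : V) :
  measurable [set x : V | U (map_mx sgn1 (x - Theta))].
Proof.
rewrite (_ : [set x | _] = \bigcup_(s in [set s | U (sign_row s)])
    [set x : V | signs Theta x = s]); last first.
  apply/seteqP; split=> [x /=|x [s /= Us xs] /=]; rewrite map_sgn1 ?xs//.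
  by move=> Ux; exists (signs Theta x).
apply: fin_bigcup_measurable => [|s _]; last exact: measurable_signs.
exact: finite_finset.
Qed.

Definition pattern_weight (U : set V) (s : {ffun 'I_d -> bool}) : R :=
  if `[< U (sign_row s) >] then 1 else 0.

Lemma indic_orthant_union (U : set V) (Theta x : V) :
  \1_[set x : V | U (map_mx sgn1 (x - Theta))] x =
  pattern_weight U (signs Theta x).
Proof.
rewrite /pattern_weight indicE -map_sgn1; case: asboolP => H.
  by rewrite mem_set.
by rewrite memNset.
Qed.

Lemma pattern_weight01 (U : set V) s : 0 <= pattern_weight U s <= 1.
Proof. by rewrite /pattern_weight; case: ifP; rewrite ?lexx ?ler01. Qed.

Lemma measurable_cos_shift (i : 'I_d) (m th : R) :
  measurable_fun [set: V] (fun v : V => cos (m * (v ord0 i - th))).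
Proof.
apply: (measurableT_comp (measurable_funTS (continuous_measurable_fun (@continuous_cos R)))).
apply: measurable_funM => //; apply: measurable_funB => //.
exact: measurable_coord.
Qed.

Lemma continuous_logistic : continuous (@logistic R).
Proof.
move=> x; apply: differentiable_continuous; apply/derivable1_diffP.
by case: (is_derive_logistic x).
Qed.

Lemma measurable_orthant_jet (c : {ffun 'I_d -> bool} -> R) (kappa : R) (th : V) :
  measurable_fun [set: V] (orthant_jet c kappa th [::]).
Proof.
apply: measurable_funM => //; apply: measurable_sum => s.
apply: measurable_funM => //; apply: measurable_prod => i _.
have ml : measurable_fun [set: V]
    (fun x : V => logistic (kappa * (x ord0 i - th ord0 i))).
  apply: (measurableT_comp (measurable_funTS (continuous_measurable_fun continuous_logistic))).
  apply: measurable_funM => //; apply: measurable_funB => //.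
  exact: measurable_coord.
rewrite /sgn_weight /dlog /=; case: (s i) => //.
exact: measurable_funB.
Qed.

End sign_patterns.

Section smoothing.
Context {R : realType} {d : nat} {dd : measure_display} {O : measurableType dd}.
Notation V := 'rV[R]_d.
Variables (m : probability O R) (W : O -> V).
Hypothesis mW : measurable_fun [set: O] W.

Lemma orthant_smoothing (U : set V) (Theta : V) (L : nat) : (0 < L)%N ->
  `|fine (m (W @^-1` [set x : V | U (map_mx sgn1 (x - Theta))])) -
    mean m (fun w => orthant_jet (pattern_weight U) (L%:R ^+ 3) Theta [::] (W w))|
  <= \sum_(i < d) (mean m (fun w => fejer (L ^ 2) (W w ord0 i - Theta ord0 i)) +
                   16 / L%:R ^+ 2).
Proof.
move=> L0; set A := [set x | _].
have k0 : 0 < (L%:R : R) ^+ 3 by rewrite exprn_gt0// ltr0n.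
have mA : measurable A by exact: measurable_orthant_union.
have mWA : measurable (W @^-1` A) by exact: measurable_preimage.
have c01 := pattern_weight01 U.
rewrite -mean_indic//.
have Ipsi : L1 m (fun w => orthant_jet (pattern_weight U) (L%:R ^+ 3) Theta [::] (W w)).
  apply: (@L1_bounded _ _ _ _ _ 1) => [|w].
    exact: (measurableT_comp (measurable_orthant_jet _ _ _) mW).
  by have := @orthant_jet_bound R d (pattern_weight U) (L%:R ^+ 3) Theta [::]
    (W w) isT c01.
have Ifej i : L1 m (fun w => fejer (L ^ 2) (W w ord0 i - Theta ord0 i)).
  rewrite /fejer; apply: L1Z; apply: L1_sum => k; apply: L1_sum => l.
  apply: (@L1_bounded _ _ _ _ _ 1) => [|w]; last exact: cos_max.
  exact: (measurableT_comp (measurable_cos_shift _ _ _) mW).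
have I1 := L1_indic m mWA.
rewrite -meanB//; apply: le_trans (mean_norm (L1B I1 Ipsi)) _.
rewrite (_ : \sum_(i < d) _ = mean m (fun w => \sum_(i < d)
   (fejer (L ^ 2) (W w ord0 i - Theta ord0 i) + 16 / L%:R ^+ 2))); last first.
  rewrite mean_sum; last by move=> i; apply: L1D => //; exact: L1_cst.
  by apply: eq_bigr => i _; rewrite meanD// ?mean_cst//; exact: L1_cst.
apply: mean_le.
- exact: integrable_norm (L1B I1 Ipsi).
- by apply: L1_sum => i; apply: L1D => //; exact: L1_cst.
- move=> w; rewrite (_ : \1_(W @^-1` A) w = \1_A (W w))//.
  rewrite indic_orthant_union.
  apply: le_trans (orthant_jet_approx Theta (W w) k0 c01) _.
  by apply: ler_sum => i _; exact: exp_tail_le_fejer.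
Qed.

End smoothing.

Section bucket_comparison.
Context {R : realType} {d n t : nat} {d1 d2 : measure_display}
  {O1 : measurableType d1} {O2 : measurableType d2}.
Notation V := 'rV[R]_d.
Variables (P : probability O1 R) (Q : probability O2 R).
Variables (X : 'I_n -> O1 -> V) (Y : 'I_n -> O2 -> V).
Variable g : {ffun 'I_n -> 'I_t}.
Hypotheses (mX : forall i, measurable_fun [set: O1] (X i))
  (mY : forall i, measurable_fun [set: O2] (Y i)).
Hypothesis indX : independent_rvs P [set: 'I_n]%SET X.
Hypothesis XY : forall j B, measurable B -> P (X j @^-1` B) = Q (Y j @^-1` B).
Hypothesis kwiseY : forall l, kwise_independent_rvs Q 4 (bucket g l) Y.
Hypothesis bucketsY : independent_systems Q [set: 'I_t]%SET
  (fun l => sigma_family (bucket g l) Y).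
Hypothesis L4X : forall j i, L1 P (fun w => X j w ord0 i ^+ 4).
Hypothesis EX : forall j i, mean P (fun w => X j w ord0 i) = 0.
Variables (sg : 'I_n -> R) (K : R).
Hypothesis K1 : 1 <= K.
Hypothesis sg2 : forall j i, mean P (fun w => X j w ord0 i ^+ 2) <= sg j.
Hypothesis sg4 : forall j i,
  mean P (fun w => X j w ord0 i ^+ 4) <= K * sg j ^+ 2.
Hypothesis var1 : forall i, \sum_j mean P (fun w => X j w ord0 i ^+ 2) = 1.

(** The quantity averaged in [Gamma], for one hash function and without the factor [eta ^- 4]. *)
Definition bucket_energy : R := \sum_(l < t) (\sum_(j in bucket g l) sg j) ^+ 2.

(** Independence is assumed between the sigma-algebras generated by the buckets, so it remains to
    see that each bucket sum is measurable for the one of its own bucket. *)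
Lemma independent_buckets : independent_rvs Q [set: 'I_t]%SET (group_sum Y g).
Proof.
move=> E KK EJ HE; apply: bucketsY => // l lK.
have [B mB <-] := HE l lK; rewrite setTI.
pose G := \bigcup_(j in [set` bucket g l]) sigma_rv (Y j).
have mY' (j : 'I_n) : j \in bucket g l ->
    measurable_fun [set: g_sigma_algebraType G] (Y j : g_sigma_algebraType G -> V).
  move=> jl _ C mC; rewrite setTI; apply: sub_sigma_algebra; exists j => //.
  by exists C => //; rewrite setTI.
have := @measurable_rV_sum_in R d _ (g_sigma_algebraType G) 'I_n
  (enum (bucket g l)) Y.
move=> H; have {}H := H (fun j jl => mY' j (eq_ind _ is_true jl _ (mem_enum _ _))).
by have := H measurableT B mB; rewrite setTI.
Qed.

Let ST (O : Type) (Z : 'I_n -> O -> V) w :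
  seq_sum (group_sum Z g) (index_enum 'I_t) w = \sum_j Z j w.
Proof. exact: sum_group_sum. Qed.

Lemma jet_bucket_comparison (phi : seq 'I_d -> V -> R) (B M : R) :
  measurable_fun [set: V] (phi [::]) -> (forall y, `|phi [::] y| <= M) ->
  jet B phi -> 0 <= B ->
  `|mean P (fun w => phi [::] (\sum_j X j w)) -
    mean Q (fun w => phi [::] (\sum_j Y j w))| <=
  6 * B * d%:R ^+ 4 * K * bucket_energy.
Proof.
move=> mphi phiM jphi B0.
(* The cost in [jet_replace], with the fourth-moment bound of [mean_seq_sum_quartic] as [A]. *)
pose delta (l : 'I_t) := 2 * B * d%:R ^+ 4 *
  (3 * K * (\sum_(j in bucket g l) sg j) ^+ 2).
have H l x : `|mean P (fun w => phi [::] (x + group_sum X g l w)) -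
    mean Q (fun w => phi [::] (x + group_sum Y g l w))| <= delta l.
  have sJ : {subset enum (bucket g l) <= bucket g l} by move=> j; rewrite mem_enum.
  have kX : kwise_independent_rvs P 4 (bucket g l) X by exact: independent_kwise.
  have kY : kwise_independent_rvs Q 4 (bucket g l) Y by exact: kwiseY.
  have H1 := jet_replace mX mY kX kY XY L4X sJ x mphi phiM jphi B0.
  apply: H1 => i.
  have := mean_seq_sum_quartic mX indX L4X EX (enum_uniq (mem (bucket g l))) K1
    (fun j => sg2 j i) (fun j => sg4 j i).
  by rewrite -big_enum.
have mG (dO : measure_display) (O : measurableType dO) (Z : 'I_n -> O -> V) :
    (forall i, measurable_fun [set: O] (Z i)) ->
    forall l, measurable_fun [set: O] (group_sum Z g l).
  by move=> mZ l; exact: measurable_seq_sum.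
have indG : independent_rvs P [set: 'I_t]%SET (group_sum X g).
  exact: independent_group_sum.
have := lindeberg (mG _ _ _ mX) (mG _ _ _ mY) indG independent_buckets mphi phiM H 0 (index_enum_uniq 'I_t).
rewrite (_ : (fun w => phi [::] (0 + _)) = (fun w => phi [::] (\sum_j X j w)));
  last by apply/funext => w; rewrite add0r ST.
rewrite (_ : (fun w => phi [::] (0 + _)) = (fun w => phi [::] (\sum_j Y j w)));
  last by apply/funext => w; rewrite add0r ST.
move/le_trans; apply; rewrite /bucket_energy /delta -mulr_sumr -mulr_sumr.
by rewrite le_eqVlt; apply/orP; left; apply/eqP; ring.
Qed.

Lemma bucket_energy_ge0 : 0 <= bucket_energy.
Proof. by apply: sumr_ge0 => l _; exact: sqr_ge0. Qed.

(** Each of the [N^2] cosines has frequency at most [N], hence fourth derivatives at most [N^4] and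
    error at most [6 D]; the normalisation [4 / N^2] turns the total into [24 D]. *)
Lemma fejer_bucket_comparison (i : 'I_d) (th : R) (N : nat) : (0 < N)%N ->
  mean Q (fun w => fejer N ((\sum_j Y j w) ord0 i - th)) <=
  mean P (fun w => fejer N ((\sum_j X j w) ord0 i - th)) +
  24 * N%:R ^+ 4 * d%:R ^+ 4 * K * bucket_energy.
Proof.
move=> N0; have N0' : 0 < (N%:R : R) by rewrite ltr0n.
set D := N%:R ^+ 4 * d%:R ^+ 4 * K * bucket_energy.
have Icos (dO : measure_display) (O : measurableType dO) (m : probability O R)
    (Z : 'I_n -> O -> V) (k : R) : (forall i, measurable_fun [set: O] (Z i)) ->
    L1 m (fun w => cos (k * ((\sum_j Z j w) ord0 i - th))).
  move=> mZ; apply: (@L1_bounded _ _ _ _ _ 1) => [|w]; last exact: cos_max.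
  exact: (measurableT_comp (measurable_cos_shift _ _ _) (measurable_rV_sum _ mZ)).
have E (dO : measure_display) (O : measurableType dO) (m : probability O R)
    (Z : 'I_n -> O -> V) : (forall i, measurable_fun [set: O] (Z i)) ->
    mean m (fun w => fejer N ((\sum_j Z j w) ord0 i - th)) =
    4 / N%:R ^+ 2 * \sum_(k < N) \sum_(l < N)
      mean m (fun w => cos ((k%:R - l%:R) * ((\sum_j Z j w) ord0 i - th))).
  move=> mZ; rewrite /fejer meanZ; last first.
    by apply: L1_sum => k; apply: L1_sum => l; exact: Icos.
  rewrite mean_sum; last by move=> k; apply: L1_sum => l; exact: Icos.
  by congr (_ * _); apply: eq_bigr => k _; rewrite mean_sum// => l; exact: Icos.
rewrite !E//.
have H (k l : 'I_N) : mean Q (fun w => cos ((k%:R - l%:R) * ((\sum_j Y j w) ord0 i - th)))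
   <= mean P (fun w => cos ((k%:R - l%:R) * ((\sum_j X j w) ord0 i - th))) + 6 * D.
  set m : R := k%:R - l%:R.
  have m4 : 0 <= m ^+ 4 by rewrite -[4%N]/(2 * 2)%N exprM sqr_ge0.
  have mN : m ^+ 4 <= N%:R ^+ 4.
    have D' : `|m| <= N%:R.
      have : (k%:R : R) <= N%:R by rewrite ler_nat ltnW.
      have : (l%:R : R) <= N%:R by rewrite ler_nat ltnW.
      have : 0 <= (k%:R : R) by []. have : 0 <= (l%:R : R) by [].
      by rewrite /m ler_norml; move=> *; apply/andP; split; lra.
    rewrite (_ : m ^+ 4 = `|m| ^+ 4); last first.
      by rewrite -[4%N]/(2 * 2)%N exprM [RHS]exprM real_normK ?num_real.
    by rewrite lerXn2r ?nnegrE.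
  have mc : measurable_fun [set: V] (cos_jet i m th [::]).
    rewrite (_ : cos_jet i m th [::] = (fun v : V => cos (m * (v ord0 i - th)))).
      exact: measurable_cos_shift.
    by apply/funext => v; rewrite cos_jet_nil.
  have := @jet_bucket_comparison (cos_jet i m th) (m ^+ 4) 1 mc _ (cos_jetP i m th) m4.
  move=> /(_ (fun y => _)) => H.
  have {H} : `|mean P (fun w => cos (m * ((\sum_j X j w) ord0 i - th))) -
       mean Q (fun w => cos (m * ((\sum_j Y j w) ord0 i - th)))| <=
       6 * m ^+ 4 * d%:R ^+ 4 * K * bucket_energy.
    rewrite (_ : (fun w => cos _) = (fun w => cos_jet i m th [::] (\sum_j X j w)));
      last by apply/funext => w; rewrite cos_jet_nil.
    rewrite (_ : (fun w => cos _) = (fun w => cos_jet i m th [::] (\sum_j Y j w)));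
      last by apply/funext => w; rewrite cos_jet_nil.
    by apply: H => y; rewrite cos_jet_nil; exact: cos_max.
  have : 6 * m ^+ 4 * d%:R ^+ 4 * K * bucket_energy <= 6 * D.
    rewrite (_ : 6 * _ * _ * _ * _ = 6 * (m ^+ 4 * (d%:R ^+ 4 * (K * bucket_energy))));
      last by ring.
    rewrite (_ : D = N%:R ^+ 4 * (d%:R ^+ 4 * (K * bucket_energy))); last first.
      by rewrite /D; ring.
    rewrite ler_pM2l// ler_wpM2r// !mulr_ge0 ?exprn_ge0 ?bucket_energy_ge0//.
    by rewrite (le_trans _ K1).
  rewrite ler_norml => D6 /andP[h1 h2]; lra.
apply: (@le_trans _ _ (4 / N%:R ^+ 2 * \sum_(k < N) \sum_(l < N)
  (mean P (fun w => cos ((k%:R - l%:R) * ((\sum_j X j w) ord0 i - th))) + 6 * D))).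
  rewrite ler_wpM2l ?divr_ge0 ?exprn_ge0//.
  by apply: ler_sum => k _; apply: ler_sum => l _; exact: H.
under eq_bigr do rewrite big_split /=.
rewrite big_split /= mulrDr lerD2l !sumr_const !card_ord.
rewrite -mulrnA -(mulr_natl (6 * D)) natrM le_eqVlt; apply/orP; left; apply/eqP.
rewrite /D; field; rewrite gt_eqF//.
Qed.

(** Smoothing costs [(68 e + 16) d / L^2] for each of the two sums. Moving the kernel to the second
    sum adds [24 L^8 d^5], and comparing the smooth functions adds [6 (L^3)^4 d^4], both times
    [K * bucket_energy]; the two are merged into [30 d^5 L^12]. The condition on [L] is the
    frequency restriction for [N = L^2]. *)
Lemma orthant_comparison (A : set V) (L : nat) : orthant_union_translate A ->
  (0 < L)%N -> L%:R ^+ 8 * (K * \sum_j sg j ^+ 2) <= 1 ->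
  `|fine (P ((fun w => \sum_j X j w) @^-1` A)) -
    fine (Q ((fun w => \sum_j Y j w) @^-1` A))| <=
  (136 * expR 1 + 32) * (d%:R / L%:R ^+ 2) +
  30 * (d%:R ^+ 5 * L%:R ^+ 12 * K * bucket_energy).
Proof.
move=> [ Theta [U ->]] L0 Leps; have L0' : 0 < (L%:R : R) by rewrite ltr0n.
have N0 : (0 < L ^ 2)%N by rewrite expn_gt0 L0.
have mSX := measurable_rV_sum (index_enum 'I_n) mX.
have mSY := measurable_rV_sum (index_enum 'I_n) mY.
have HP := orthant_smoothing P mSX U Theta L0.
have HQ := orthant_smoothing Q mSY U Theta L0.
pose psi := orthant_jet (pattern_weight U) (L%:R ^+ 3) Theta.
have k0 : 0 <= (L%:R : R) ^+ 3 by rewrite exprn_ge0.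
have Hpsi := @jet_bucket_comparison psi _ 1 (measurable_orthant_jet _ _ _)
  (fun y => @orthant_jet_bound R d (pattern_weight U) (L%:R ^+ 3) Theta [::]
    y isT (pattern_weight01 U)) (orthant_jetP Theta k0 (pattern_weight01 U))
  (exprn_ge0 4 k0).
have fejP i : mean P (fun w => fejer (L ^ 2) ((\sum_j X j w) ord0 i - Theta ord0 i))
    <= 68 * expR 1 / L%:R ^+ 2.
  rewrite -natrX.
  apply: (mean_fejer_le mX indX L4X EX (Theta ord0 i)
    (eps := K * \sum_j sg j ^+ 2) (index_enum_uniq _) N0 (var1 i)).
    by rewrite mulr_sumr; apply: ler_sum => j _; exact: sg4.
  by rewrite natrX -exprM.
set E := bucket_energy in Hpsi *.
have E0 : 0 <= E := bucket_energy_ge0.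
have fejQ i : mean Q (fun w => fejer (L ^ 2) ((\sum_j Y j w) ord0 i - Theta ord0 i))
    <= 68 * expR 1 / L%:R ^+ 2 + 24 * L%:R ^+ 8 * d%:R ^+ 4 * K * E.
  apply: le_trans (fejer_bucket_comparison i (Theta ord0 i) N0) _.
  by rewrite natrX -exprM lerD2r.
have SP : \sum_(i < d) (mean P (fun w => fejer (L ^ 2)
      ((\sum_j X j w) ord0 i - Theta ord0 i)) + 16 / L%:R ^+ 2) <=
    d%:R * (68 * expR 1 / L%:R ^+ 2 + 16 / L%:R ^+ 2).
  apply: (@le_trans _ _ (\sum_(i < d) (68 * expR 1 / L%:R ^+ 2 + 16 / L%:R ^+ 2))).
    by apply: ler_sum => i _; rewrite lerD2r.
  by rewrite sumr_const card_ord (mulr_natl _ d).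
have SQ : \sum_(i < d) (mean Q (fun w => fejer (L ^ 2)
      ((\sum_j Y j w) ord0 i - Theta ord0 i)) + 16 / L%:R ^+ 2) <=
    d%:R * (68 * expR 1 / L%:R ^+ 2 + 24 * L%:R ^+ 8 * d%:R ^+ 4 * K * E
      + 16 / L%:R ^+ 2).
  apply: (@le_trans _ _ (\sum_(i < d) (68 * expR 1 / L%:R ^+ 2 +
      24 * L%:R ^+ 8 * d%:R ^+ 4 * K * E + 16 / L%:R ^+ 2))).
    by apply: ler_sum => i _; rewrite lerD2r.
  by rewrite sumr_const card_ord (mulr_natl _ d).
have {}HP := le_trans HP SP; have {}HQ := le_trans HQ SQ.
have K0 : 0 <= K by rewrite (le_trans _ K1).
have T1 : L%:R ^+ 8 * d%:R ^+ 5 * K * E <= d%:R ^+ 5 * L%:R ^+ 12 * K * E.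
  rewrite ler_wpM2r// ler_wpM2r// mulrC ler_wpM2l ?exprn_ge0//.
  by rewrite ler_weXn2l// ler1n.
have T2 : L%:R ^+ 12 * d%:R ^+ 4 * K * E <= d%:R ^+ 5 * L%:R ^+ 12 * K * E.
  rewrite ler_wpM2r// ler_wpM2r// mulrC ler_wpM2r ?exprn_ge0//.
  by rewrite -!natrX ler_nat; case: (d) => // d'; rewrite leq_pexp2l.
move: Hpsi; rewrite -exprM => Hpsi.
rewrite ler_norml in HP; rewrite ler_norml in HQ; rewrite ler_norml in Hpsi.
case/andP: HP => p1 p2; case/andP: HQ => q1 q2; case/andP: Hpsi => r1 r2.
have R1 : d%:R * (68 * expR 1 / L%:R ^+ 2 + 16 / L%:R ^+ 2) =
  (68 * expR 1 + 16) * (d%:R / L%:R ^+ 2) :> R by field; rewrite gt_eqF.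
have R2 : d%:R * (68 * expR 1 / L%:R ^+ 2 + 24 * L%:R ^+ 8 * d%:R ^+ 4 * K * E
      + 16 / L%:R ^+ 2) =
  (68 * expR 1 + 16) * (d%:R / L%:R ^+ 2) + 24 * (L%:R ^+ 8 * d%:R ^+ 5 * K * E).
  by field; rewrite gt_eqF.
have R3 : 6 * L%:R ^+ (3 * 4) * d%:R ^+ 4 * K * E =
  6 * (L%:R ^+ 12 * d%:R ^+ 4 * K * E) by rewrite -!mulrA.
rewrite R1 in p1 p2; rewrite R2 in q1 q2; rewrite R3 in r1 r2.
move: T1 T2 p1 p2 q1 q2 r1 r2.
move: (L%:R ^+ 8 * d%:R ^+ 5 * K * E) (d%:R ^+ 5 * L%:R ^+ 12 * K * E)
  (L%:R ^+ 12 * d%:R ^+ 4 * K * E) (d%:R / L%:R ^+ 2) (expR 1) => a b c e f.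
rewrite /psi; move=> *; rewrite ler_norml; apply/andP; split; lra.
Qed.

End bucket_comparison.

(** * Hypercontractive moments and averaging over the hash family *)

Section hypercontractive_moments.
Context {R : realType} {d : nat} {dd : measure_display}
  {Omega : measurableType dd}.
Notation V := 'rV[R]_d.
Variables (P : probability Omega R).

Lemma enorm_ge0 (x : V) : 0 <= enorm x.
Proof. exact: sqrtr_ge0. Qed.

Lemma enorm_sq (x : V) : enorm x ^+ 2 = \sum_(i < d) x ord0 i ^+ 2.
Proof. by rewrite sqr_sqrtr// sumr_ge0// => i _; exact: sqr_ge0. Qed.

Lemma coord_sq_le (x : V) i : x ord0 i ^+ 2 <= enorm x ^+ 2.
Proof.
by rewrite enorm_sq (bigD1 i)//= lerDl sumr_ge0// => j _; exact: sqr_ge0.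
Qed.

Lemma coord_pow4_le (x : V) i : x ord0 i ^+ 4 <= enorm x ^+ 4.
Proof.
rewrite -[4%N]/(2 * 2)%N !exprM lerXn2r// ?nnegrE ?sqr_ge0//.
exact: coord_sq_le.
Qed.

Lemma enormZ_sq (a : R) (x : V) : enorm (a *: x) ^+ 2 = a ^+ 2 * enorm x ^+ 2.
Proof.
by rewrite !enorm_sq mulr_sumr; apply: eq_bigr => i _; rewrite mxE exprMn.
Qed.

Variable X : Omega -> V.
Hypothesis mX : measurable_fun [set: Omega] X.

Lemma measurable_enorm_sq : measurable_fun [set: Omega] (fun w => enorm (X w) ^+ 2).
Proof.
under eq_fun do rewrite enorm_sq.
apply: measurable_sum => i; apply: measurable_funX.
exact: (measurableT_comp (measurable_coord i) mX).
Qed.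

Lemma measurable_enorm_pow4 :
  measurable_fun [set: Omega] (fun w => enorm (X w) ^+ 4).
Proof.
rewrite (_ : (fun w => _) = (fun w => (enorm (X w) ^+ 2) ^+ 2)).
  by apply: measurable_funX; exact: measurable_enorm_sq.
by apply/funext => w; rewrite -exprM.
Qed.

Lemma vnormE (p : nat) (Y : Omega -> V) : (0 < p)%N ->
  vnorm P p%:R Y = ((\int[P]_w (enorm (Y w) ^+ p)%:E) `^ p%:R^-1)%E.
Proof.
move=> p0; rewrite /vnorm unlock /=; congr (_ `^ _)%E.
apply: eq_integral => w _ /=.
by rewrite ger0_norm ?enorm_ge0// powR_mulrn// enorm_ge0.
Qed.

Variable eta : R.
Hypothesis eta0 : 0 < eta.
Hypothesis hcX : hypercontractive P eta X.

Lemma L1_enorm_pow4 : L1 P (fun w => enorm (X w) ^+ 4).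
Proof.
apply/integrableP; split; first exact/measurable_EFinP/measurable_enorm_pow4.
have [+ _] := hcX; rewrite (vnormE X (isT : (0 < 4)%N)) => /lty_poweRy H.
have {}H := H (_ : (4%:R^-1 : R) != 0).
rewrite (eq_integral (fun w => (enorm (X w) ^+ 4)%:E)).
  by apply: H; rewrite invr_eq0 pnatr_eq0.
by move=> w _; rewrite /= ger0_norm ?exprn_ge0 ?enorm_ge0.
Qed.

Lemma L1_enorm_sq : L1 P (fun w => enorm (X w) ^+ 2).
Proof.
apply: (L1_le (g := fun w => 1 + enorm (X w) ^+ 4)).
- exact: measurable_enorm_sq.
- by apply: L1D; [exact: L1_cst|exact: L1_enorm_pow4].
- move=> w; rewrite ger0_norm ?sqr_ge0// -[4%N]/(2 * 2)%N exprM.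
  by have := sqr_ge0 (enorm (X w) ^+ 2 - 1); have := sqr_ge0 (enorm (X w) ^+ 2);
    rewrite sqrrB; lra.
Qed.

(** Hypercontractivity at shift 0, raised to the fourth power. *)
Lemma hypercontractive_moments :
  eta ^+ 4 * mean P (fun w => enorm (X w) ^+ 4) <=
  mean P (fun w => enorm (X w) ^+ 2) ^+ 2.
Proof.
have [_ /(_ 0)] := hcX.
rewrite (vnormE _ (isT : (0 < 4)%N)) (vnormE _ (isT : (0 < 2)%N)).
have E4 : (\int[P]_w (enorm (0 + eta *: X w) ^+ 4)%:E =
    (eta ^+ 4 * mean P (fun w => enorm (X w) ^+ 4))%:E)%E.
  rewrite -meanZ; last exact: L1_enorm_pow4.
  rewrite /mean /Rintegral fineK; last first.
    by apply: integrable_fin_num => //; apply: L1Z; exact: L1_enorm_pow4.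
  apply: eq_integral => w _; rewrite add0r -[4%N]/(2 * 2)%N exprM enormZ_sq.
  by rewrite exprMn -!exprM.
have E2 : (\int[P]_w (enorm (0 + X w) ^+ 2)%:E =
    (mean P (fun w => enorm (X w) ^+ 2))%:E)%E.
  rewrite /mean /Rintegral fineK; last first.
    by apply: integrable_fin_num => //; exact: L1_enorm_sq.
  by apply: eq_integral => w _; rewrite add0r.
rewrite E4 E2 /= lee_fin.
set a := eta ^+ 4 * _; set b := mean _ _.
have a0 : 0 <= a.
  rewrite mulr_ge0 ?exprn_ge0 ?(ltW eta0)//; apply: mean_ge0 => w.
  by rewrite exprn_ge0// enorm_ge0.
have b0 : 0 <= b by apply: mean_ge0 => w; exact: sqr_ge0.
move=> H.
have : (a `^ 4%:R^-1) ^+ 4 <= (b `^ 2%:R^-1) ^+ 4.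
  by rewrite lerXn2r// nnegrE powR_ge0.
rewrite -!powR_mulrn ?powR_ge0// -!powRrM mulVf ?pnatr_eq0// powRr1//.
rewrite (_ : 2%:R^-1 * 4%:R = 2%:R :> R) ?powR_mulrn//; by field.
Qed.

End hypercontractive_moments.

(** * Average of the bucket energy over the hash family *)

Section hash_average.
Context {R : realType} {n t : nat}.
Variables (H : {set {ffun 'I_n -> 'I_t}}) (b : R) (sg : 'I_n -> R).
Hypotheses (cpH : collision_preserving b H) (b2 : b <= 2).
Hypothesis sg0 : forall j, 0 <= sg j.

(** Expanding the squares leaves the sum over colliding pairs, whose average only involves collision
    probabilities. *)
Lemma bucket_energyE (g : {ffun 'I_n -> 'I_t}) :
  bucket_energy g sg = \sum_i \sum_j (g i == g j)%:R * (sg i * sg j).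
Proof.
rewrite /bucket_energy.
rewrite (eq_bigr (fun l => \sum_i \sum_j
    ((g i == l)%:R * (g j == l)%:R) * (sg i * sg j))); last first.
  move=> l _; rewrite expr2 big_distrlr /= big_mkcond /=.
  apply: eq_bigr => i _; rewrite inE; case: eqP => gi; last first.
    by rewrite big1// => j _; rewrite !mul0r.
  rewrite big_mkcond; apply: eq_bigr => j _; rewrite inE.
  by case: eqP => gj; rewrite ?mulr0 ?mul0r ?mulr1 ?mul1r.
rewrite exchange_big /=; apply: eq_bigr => i _.
rewrite exchange_big /=; apply: eq_bigr => j _.
rewrite (bigD1 (g i)) //= eqxx mul1r big1 ?addr0; first by rewrite eq_sym.
by move=> l /negPf; rewrite eq_sym => ->; rewrite !mul0r.
Qed.

(** Diagonal pairs always collide and give the sum of squares; every other pair has collision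
    probability at most [b / t <= 2 / t]. *)
Lemma average_bucket_energy :
  \sum_(g in H) #|H|%:R^-1 * bucket_energy g sg <=
  \sum_j sg j ^+ 2 + 2 / t%:R * (\sum_j sg j) ^+ 2.
Proof.
under eq_bigr do rewrite bucket_energyE mulr_sumr.
rewrite exchange_big /=.
have -> : \sum_j sg j ^+ 2 + 2 / t%:R * (\sum_j sg j) ^+ 2 =
    \sum_i (\sum_j ((i == j)%:R + 2 / t%:R) * (sg i * sg j)).
  rewrite expr2 big_distrlr /= mulr_sumr -big_split; apply: eq_bigr => i _ /=.
  under [RHS]eq_bigr do rewrite mulrDl.
  rewrite big_split /= mulr_sumr; congr (_ + _).
  rewrite (bigD1 i) //= eqxx mul1r big1 ?addr0 ?expr2// => j /negPf.
  by rewrite eq_sym => ->; rewrite mul0r.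
apply: ler_sum => i _; under eq_bigr do rewrite mulr_sumr.
rewrite exchange_big /=; apply: ler_sum => j _.
have -> : \sum_(g in H) #|H|%:R^-1 * ((g i == g j)%:R * (sg i * sg j)) =
    unif_prob H (fun h => h i == h j) * (sg i * sg j).
  rewrite (eq_bigr (fun g : {ffun 'I_n -> 'I_t} =>
    #|H|%:R^-1 * (g i == g j)%:R * (sg i * sg j)));
    last by move=> g _; exact: (mulrA _ _ (sg i * sg j)).
  rewrite -mulr_suml; congr (_ * _); rewrite /unif_prob -mulr_sumr mulrC.
  congr (_ * _); rewrite -natr_sum; congr (_%:R).
  rewrite -sum1_card big_mkcond [RHS]big_mkcond /=; apply: eq_bigr => g _.
  by rewrite inE; case: (g \in H); case: eqP.
rewrite ler_wpM2r ?mulr_ge0//.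
have t0 : 0 <= (t%:R^-1 : R) by rewrite invr_ge0.
case: eqVneq => ij; last first.
  by rewrite add0r; apply: le_trans (cpH.2 _ _ ij) _; rewrite ler_wpM2r.
apply: (@le_trans _ _ 1); last by rewrite lerDl mulr_ge0.
(* For an empty family the quotient is 0, as the inverse of 0 is 0. *)
rewrite /unif_prob; have [->|/set0Pn[h hH]] := eqVneq H finset.set0.
  by rewrite finset.cards0 invr0 mulr0.
rewrite ler_pdivrMr ?mul1r ?ler_nat ?ltr0n ?card_gt0; last by apply/set0Pn; exists h.
by apply: subset_leq_card; apply/fintype.subsetP => g; rewrite inE => /andP[].
Qed.

End hash_average.

(** * Decomposition over the values of the hash function *)

Section mixture.
Context {R : realType} {n t : nat} {dd : measure_display}
  {Omega : measurableType dd}.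
Variables (P : probability Omega R) (H : {set {ffun 'I_n -> 'I_t}})
  (h : Omega -> {ffun 'I_n -> 'I_t}).
Hypothesis unif : uniform_rv P H h.

(** Total probability; values of [h] outside [H] have probability 0. *)
Lemma uniform_mixture (B : set Omega) : measurable B ->
  fine (P B) = \sum_(g in H) #|H|%:R^-1 * fine (cond_prob P (h @^-1` [set g]) B).
Proof.
move=> mB.
have mBg g : measurable (B `&` h @^-1` [set g]).
  by apply: measurableI => //; case: (unif g).
rewrite -mean_indic//.
rewrite (_ : \1_B = (fun w => \sum_g \1_(B `&` h @^-1` [set g]) w)); last first.
  apply/funext => w; rewrite (bigD1 (h w)) //= big1 ?addr0.
    rewrite !indicE in_setI; congr (_%:R).
    by rewrite [X in _ && X]mem_set ?andbT.
  move=> g gh; rewrite indicE in_setI [X in _ && X]memNset ?andbF//= => hg.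
  by rewrite hg eqxx in gh.
rewrite mean_sum; last by move=> g; exact: L1_indic.
rewrite (bigID (mem H)) /= [X in _ + X]big1 ?addr0; last first.
  move=> g gH; rewrite mean_indic//; have [mg Pg] := unif g.
  rewrite (negPf gH) in Pg.
  rewrite (_ : P _ = 0%E)//; apply/eqP.
  rewrite eq_le measure_ge0 andbT -[leRHS]/(0%:E) -Pg.
  by rewrite le_measure ?inE//; exact: subIsetr.
apply: eq_bigr => g gH; rewrite mean_indic// /cond_prob.
have [_ ->] := unif g; rewrite gH /= invrK fineM ?fin_num_measure//=.
rewrite [RHS]mulrCA mulVf ?mulr1//.
by rewrite pnatr_eq0 -lt0n card_gt0; apply/set0Pn; exists g.
Qed.

Lemma uniform_nonempty : exists g, g \in H.
Proof.
apply/set0Pn/eqP => H0.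
have := uniform_mixture measurableT; rewrite H0 finset.big_set0.
by rewrite probability_setT /= => /eqP; rewrite oner_eq0.
Qed.

Lemma uniform_cond_probability g : g \in H ->
  exists Q : probability Omega R,
    cond_prob P (h @^-1` [set g]) = (Q : set Omega -> \bar R).
Proof.
move=> gH; have [mg Pg] := unif g.
have P0 : P (h @^-1` [set g]) != 0%E.
  rewrite Pg gH eqe invr_eq0 pnatr_eq0 -lt0n card_gt0.
  by apply/set0Pn; exists g.
have [Q QE] := cond_probability mg P0.
by exists Q; apply/funext => A; rewrite QE.
Qed.

End mixture.

(** * The main theorem *)

(** Isolates the choice of [L]. The claimed bound is a constant times [d r], and [r] is set up so
    that [r^8 = eta^-4 d^5 Delta]. *)
Lemma hash_error_arith (R : realType) (C1 C2 eta Delta s2 av D : R) (d : nat) :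
  0 <= C1 -> 0 <= C2 -> (0 < d)%N -> 0 < eta -> 0 < Delta ->
  0 <= s2 <= Delta -> av <= 2 * Delta -> D <= 1 ->
  (forall L : nat, (0 < L)%N -> L%:R ^+ 8 * (eta ^- 4 * s2) <= 1 ->
    D <= C1 * (d%:R / L%:R ^+ 2) + C2 * (d%:R ^+ 5 * L%:R ^+ 12 * eta ^- 4 * av)) ->
  D <= (4 * C1 + 2 * C2 + 1) *
    (eta `^ (- (1 / 2)) * d%:R `^ (13 / 8)) * Delta `^ (1 / 8).
Proof.
move=> C10 C20 d0 eta0 Delta0 /andP[s20 s2D] avD D1 HL.
have d0' : 0 < (d%:R : R) by rewrite ltr0n.
have d1 : 1 <= (d%:R : R) by rewrite ler1n.
pose r := eta `^ (- (1 / 2)) * d%:R `^ (5 / 8) * Delta `^ (1 / 8).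
have r0 : 0 < r by rewrite !mulr_gt0 ?powR_gt0.
have r8 : r ^+ 8 = eta ^- 4 * d%:R ^+ 5 * Delta.
  have pw (x a : R) : (x `^ a) ^+ 8 = x `^ (a * 8%:R).
    by rewrite powRrM powR_mulrn ?powR_ge0.
  rewrite /r !exprMn !pw.
  rewrite (_ : - (1 / 2) * 8%:R = - 4%:R :> R); last by field.
  rewrite (_ : 5 / 8 * 8%:R = 5%:R :> R); last by field.
  rewrite (_ : 1 / 8 * 8%:R = 1 :> R); last by field.
  by rewrite powRN !powR_mulrn ?powRr1// ltW.
have -> : (4 * C1 + 2 * C2 + 1) * (eta `^ (- (1 / 2)) * d%:R `^ (13 / 8)) *
    Delta `^ (1 / 8) = (4 * C1 + 2 * C2 + 1) * (d%:R * r).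
  rewrite (_ : 13 / 8 = 1 + 5 / 8 :> R); last by field.
  rewrite powRD; last by rewrite (gt_eqF d0') implybT.
  by rewrite powRr1 ?ltW// /r; ring.
have C0 : 1 <= 4 * C1 + 2 * C2 + 1 by lra.
(* For [r >= 1] the right-hand side is at least 1, thanks to the summand 1 in the constant. *)
have [r1|r1] := leP 1 r.
  apply: le_trans D1 _; apply: (@le_trans _ _ (1 * (1 * 1))); first by rewrite !mulr1.
  by rewrite ler_pM// ler_pM.
pose x := Num.sqrt r^-1.
have x2 : x ^+ 2 = r^-1 by rewrite sqr_sqrtr// invr_ge0 ltW.
have x1 : 1 <= x.
  rewrite -(@ler_pXn2r _ 2)// ?nnegrE ?sqrtr_ge0// expr1n x2.
  by rewrite invf_ge1// ltW.
(* From [L <= x < L + 1 <= 2 L] and [x^2 = 1 / r] follows [1 / 4 <= L^2 r <= 1]. *)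
pose L := Num.truncn x.
have x0 : 0 <= x by rewrite sqrtr_ge0.
have /andP[Lx xL] : L%:R <= x < L.+1%:R by exact: truncn_itv.
have L0 : (0 < L)%N.
  by rewrite -ltnS -(ltr_nat R); exact: le_lt_trans x1 xL.
have L1' : 1 <= (L%:R : R) by rewrite ler1n.
have Lr : L%:R ^+ 2 * r <= 1.
  by rewrite -ler_pdivlMr// div1r -x2 lerXn2r ?nnegrE.
have Lr' : 1 <= 4 * L%:R ^+ 2 * r.
  rewrite -ler_pdivrMr// div1r -x2.
  rewrite (_ : 4 * L%:R ^+ 2 = (2 * L%:R) ^+ 2); last by ring.
  rewrite lerXn2r ?nnegrE ?mulr_ge0//; apply: le_trans (ltW xL) _.
  by rewrite -natr1; lra.
set y := L%:R ^+ 2 * r in Lr.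
have y0 : 0 <= y by rewrite mulr_ge0 ?exprn_ge0// ltW.
have e4 : 0 < eta ^- 4 by rewrite invr_gt0 exprn_gt0.
have K8 : eta ^- 4 * Delta <= r ^+ 8.
  rewrite r8 -mulrA [d%:R ^+ 5 * _]mulrC mulrA; apply: ler_peMr.
    by rewrite mulr_ge0// ltW.
  by rewrite exprn_ege1.
have r01 k : r ^+ k <= 1 by rewrite exprn_ile1 ?ltW.
have y1 k : y ^+ k <= 1 by rewrite exprn_ile1.
have cond : L%:R ^+ 8 * (eta ^- 4 * s2) <= 1.
  apply: (@le_trans _ _ (L%:R ^+ 8 * r ^+ 8)).
    rewrite ler_wpM2l ?exprn_ge0//; apply: le_trans K8.
    by rewrite ler_wpM2l// ltW.
  rewrite (_ : L%:R ^+ 8 * r ^+ 8 = y ^+ 4 * r ^+ 4); last by rewrite /y; ring.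
  by rewrite mulr_ile1 ?exprn_ge0// ltW.
apply: le_trans (HL L L0 cond) _.
have T1 : d%:R / L%:R ^+ 2 <= 4 * (d%:R * r).
  rewrite ler_pdivrMr ?exprn_gt0// ?(lt_le_trans ltr01)//.
  rewrite -[leLHS]mulr1 (_ : 4 * _ * _ = d%:R * (4 * L%:R ^+ 2 * r)); last by ring.
  by rewrite ler_pM2l.
(* The left side is at most [2 L^12 r^8 = 2 (L^2 r)^6 r^2], and [r < 1 <= d]. *)
have T2 : d%:R ^+ 5 * L%:R ^+ 12 * eta ^- 4 * av <= 2 * (d%:R * r).
  apply: (@le_trans _ _ (d%:R ^+ 5 * L%:R ^+ 12 * eta ^- 4 * (2 * Delta))).
    by rewrite ler_wpM2l// !mulr_ge0 ?exprn_ge0// ltW.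
  rewrite (_ : d%:R ^+ 5 * _ * _ * _ =
    2 * (L%:R ^+ 12 * (eta ^- 4 * d%:R ^+ 5 * Delta))); last by ring.
  rewrite -r8 ler_pM2l//.
  rewrite (_ : L%:R ^+ 12 * r ^+ 8 = y ^+ 6 * r * r); last by rewrite /y; ring.
  rewrite ler_pM2r//; apply: le_trans d1.
  by rewrite mulr_ile1 ?exprn_ge0 ?(ltW r0) ?(ltW r1).
have dr0 : 0 <= d%:R * r by rewrite mulr_ge0// ltW.
have h1 : C1 * (d%:R / L%:R ^+ 2) <= C1 * (4 * (d%:R * r)) by rewrite ler_wpM2l.
have h2 : C2 * (d%:R ^+ 5 * L%:R ^+ 12 * eta ^- 4 * av) <= C2 * (2 * (d%:R * r)).
  by rewrite ler_wpM2l.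
apply: le_trans (lerD h1 h2) _.
rewrite -subr_ge0 (_ : _ - _ = d%:R * r)//; ring.
Qed.

Lemma row0_eq (R : realType) (x y : 'rV[R]_0) : x = y.
Proof. by apply/rowP => -[]. Qed.

Theorem theorem4p3 (R : realType) :
  exists2 C : R, 0 < C &
  forall (d n t : nat) (eta b : R),
  0 < eta < 1 -> b <= 2 ->
  forall (dX : measure_display) (OmegaX : measurableType dX)
    (PX : probability OmegaX R)
    (X : 'I_n -> {RV PX >-> 'rV[R]_d}),
  let S := fun w => \sum_(j < n) X j w in
  independent_rvs PX [set: 'I_n]%SET X ->
  (forall j, hypercontractive PX eta (X j)) ->
  (forall j, centered PX (X j)) ->
  (forall i : 'I_d, cov_mx PX S i i = 1) ->
  forall H : {set {ffun 'I_n -> 'I_t}},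
  collision_preserving b H ->
  forall (dY : measure_display) (OmegaY : measurableType dY)
    (PY : probability OmegaY R)
    (h : OmegaY -> {ffun 'I_n -> 'I_t})
    (Y : 'I_n -> {RV PY >-> 'rV[R]_d}),
  let T := fun w => \sum_(j < n) Y j w in
  uniform_rv PY H h ->
  (forall g, g \in H ->
     let Q := cond_prob PY (h @^-1` [set g]) in
     [/\ forall (j : 'I_n) (B : set 'rV[R]_d), measurable B ->
           Q (Y j @^-1` B) = PX (X j @^-1` B),
         forall l : 'I_t, kwise_independent_rvs Q 4 (bucket g l) Y &
         independent_systems Q [set: 'I_t]%SET
           (fun l => sigma_family (bucket g l) Y)]) ->
  forall A : set 'rV[R]_d, orthant_union_translate A ->
  `| fine (PX (S @^-1` A)) - fine (PY (T @^-1` A)) |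
    <= C * (eta `^ (- (1 / 2)) * d%:R `^ (13 / 8)) *
       (d%:R ^+ 2 / t%:R
        + \sum_(j < n) second_moment PX (X j) ^+ 2) `^ (1 / 8).
Proof.
(* [C1] and the 30 below are the constants of [orthant_comparison]; [hash_error_arith] combines
   them. *)
set C1 : R := 136 * expR 1 + 32.
have C10 : 0 <= C1 by rewrite addr_ge0// mulr_ge0// expR_ge0.
exists (4 * C1 + 2 * 30 + 1) => [|d n t eta b /andP[eta0 eta1] b2]; first by lra.
move=> dX OmegaX PX X S indX hcX cX covS H cpH dY OmegaY PY h Y T unif HY A oA.
have mX j : measurable_fun setT (X j) by exact: measurable_funPT.
have mY j : measurable_fun setT (Y j) by exact: measurable_funPT.
have mS : measurable_fun setT S by exact: measurable_rV_sum.
have mT : measurable_fun setT T by exact: measurable_rV_sum.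
have mA : measurable A.
  by case: oA => Th [U ->]; exact: measurable_orthant_union.
have mSA : measurable (S @^-1` A) by exact: measurable_preimage.
have mTA : measurable (T @^-1` A) by exact: measurable_preimage.
(* In dimension 0 the space is one point, so [A] is empty or everything and both probabilities
   agree; [hash_error_arith] asks for [0 < d]. *)
have [d0|d0] := posnP d.
  have [A0|A0] := pselect (A 0).
    have preT (Om : Type) (Z : Om -> 'rV[R]_d) : Z @^-1` A = setT.
      apply/seteqP; split=> // w _ /=; move: (Z w) (A) A0.
      by rewrite d0 => z B; rewrite (row0_eq z 0).
    rewrite !preT !probability_setT subrr normr0.
    by rewrite !mulr_ge0 ?powR_ge0//; lra.
  have preT (Om : Type) (Z : Om -> 'rV[R]_d) : Z @^-1` A = set0.
    apply/seteqP; split=> // w /=; move: (Z w) (A) A0.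
    by rewrite d0 => z B; rewrite (row0_eq z 0).
  rewrite !preT !measure0 subrr normr0.
  by rewrite !mulr_ge0 ?powR_ge0//; lra.
pose sg (j : 'I_n) := second_moment PX (X j).
have sgE j : sg j = mean PX (fun w => enorm (X j w) ^+ 2).
  by rewrite /sg /second_moment unlock.
have sg0 j : 0 <= sg j by rewrite sgE; apply: mean_ge0 => w; exact: sqr_ge0.
have L4n j := L1_enorm_pow4 (mX j) (hcX j).
have L2n j := L1_enorm_sq (mX j) (hcX j).
have mXi j (i : 'I_d) : measurable_fun setT (fun w => X j w ord0 i).
  exact: (measurableT_comp (measurable_coord i) (mX j)).
have L4X j (i : 'I_d) : L1 PX (fun w => X j w ord0 i ^+ 4).
  apply: (L1_le _ (L4n j)) => [|w]; first exact: measurable_funX.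
  rewrite ger0_norm; first exact: coord_pow4_le.
  by rewrite -[4%N]/(2 * 2)%N exprM sqr_ge0.
have L2X j (i : 'I_d) : L1 PX (fun w => X j w ord0 i ^+ 2).
  exact: (L1_coord_pow mX indX L4X j i (isT : (2 <= 4)%N)).
have EX j (i : 'I_d) : mean PX (fun w => X j w ord0 i) = 0.
  by have := cX j i; rewrite unlock /mean /Rintegral => ->.
have sg2 j (i : 'I_d) : mean PX (fun w => X j w ord0 i ^+ 2) <= sg j.
  by rewrite sgE; apply: mean_le => // w; exact: coord_sq_le.
pose K : R := eta ^- 4.
have K1 : 1 <= K by rewrite invf_ge1 ?exprn_gt0// exprn_ile1 ?ltW.
have sg4 j (i : 'I_d) : mean PX (fun w => X j w ord0 i ^+ 4) <= K * sg j ^+ 2.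
  apply: (@le_trans _ _ (mean PX (fun w => enorm (X j w) ^+ 4))).
    by apply: mean_le => // w; exact: coord_pow4_le.
  rewrite sgE mulrC ler_pdivlMr ?exprn_gt0// mulrC.
  exact: hypercontractive_moments.
(* Since [S] is centered, its variance is its second moment, which is additive by independence. *)
have var1 (i : 'I_d) : \sum_j mean PX (fun w => X j w ord0 i ^+ 2) = 1.
  rewrite -(mean_seq_sum_sq mX indX L4X EX i (index_enum_uniq _)).
  have ES : fine ('E_PX[fun w => S w ord0 i])%E = 0.
    rewrite unlock; exact: (mean_seq_sum_linear mX indX L4X EX _ i).
  have := covS i; rewrite mxE unlock ES unlock /mean /Rintegral => <-.
  congr fine; apply: eq_integral => w _; congr (_%:E).
  by rewrite -[RHS]/((S w ord0 i - 0) * (S w ord0 i - 0)) !subr0 expr2.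
(* The second moments add up to the trace of the covariance matrix; this produces the [d^2] beside
   [1 / t]. *)
have sumsg : \sum_j sg j = d%:R.
  under eq_bigr do rewrite sgE; under eq_bigr => j _.
    under [X in mean _ X]eq_fun do rewrite enorm_sq.
    rewrite mean_sum//; over.
  rewrite exchange_big /=; under eq_bigr do rewrite var1.
  by rewrite sumr_const card_ord.
have [g0 g0H] := uniform_nonempty unif.
(* A hash function with a nonempty domain has a value in ['I_t], and the domain is nonempty because
   an empty sum could not have variance 1. *)
have t0 : (0 < t)%N.
  pose i0 := Ordinal d0.
  have [n0|n0] := posnP n; last first.
    by have := ltn_ord (g0 (Ordinal n0)); apply: leq_trans.
  have := var1 i0; rewrite big1; first by move/esym/eqP; rewrite oner_eq0.
  by move=> j; have := ltn_ord j; rewrite {2}n0.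
have t0' : 0 < (t%:R : R) by rewrite ltr0n.
set Delta := d%:R ^+ 2 / t%:R + _.
have s20 : 0 <= \sum_(j < n) sg j ^+ 2 by apply: sumr_ge0 => j _; exact: sqr_ge0.
have q0 : 0 < (d%:R : R) ^+ 2 / t%:R by rewrite divr_gt0// exprn_gt0// ltr0n.
have Delta0 : 0 < Delta by rewrite ltr_pwDl.
have Hav : \sum_(g in H) #|H|%:R^-1 * bucket_energy g sg <= 2 * Delta.
  apply: le_trans (average_bucket_energy cpH b2 sg0) _.
  rewrite sumsg /Delta -/(sg _) (_ : 2 / t%:R * d%:R ^+ 2 = 2 * (d%:R ^+ 2 / t%:R));
    last by ring.
  by move: s20; rewrite /sg; lra.
have cardH : (0 < #|H|)%N by rewrite card_gt0; apply/set0Pn; exists g0.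
have cardH' : 0 < (#|H|%:R : R) by rewrite ltr0n.
have avc (c : R) : \sum_(g in H) #|H|%:R^-1 * c = c.
  by rewrite sumr_const -[LHS]mulr_natl mulrA divff ?mul1r// gt_eqF.
apply: (hash_error_arith (s2 := \sum_(j < n) sg j ^+ 2)
  (av := \sum_(g in H) #|H|%:R^-1 * bucket_energy g sg)) => //.
- by rewrite s20 /= /Delta /sg lerDr ltW.
- have p01 (dd : measure_display) (Om : measurableType dd) (P : probability Om R)
      (B : set Om) : measurable B -> 0 <= fine (P B) <= 1.
    move=> mB; rewrite fine_ge0//= -lee_fin fineP//.
    exact: probability_le1.
  have /andP[? ?] := p01 _ _ PX _ mSA; have /andP[? ?] := p01 _ _ PY _ mTA.
  by rewrite ler_norml; apply/andP; split; lra.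
- move=> L L0 cond.
  (* Both probabilities become averages over [H], that of [S] being constant, so the comparison is
     made for each hash function under its conditional law. *)
  rewrite (uniform_mixture unif mTA) -[X in X - _]avc -sumrB.
  apply: le_trans (ler_norm_sum _ _ _) _.
  rewrite -[X in X + _]avc !mulr_sumr -big_split /=; apply: ler_sum => g gH.
  rewrite -mulrBr normrM ger0_norm ?invr_ge0//.
  have [Q QE] := uniform_cond_probability unif gH.
  have [HXY Hk Hb] := HY g gH; rewrite QE in HXY Hk Hb *.
  have := orthant_comparison mX mY indX (fun j B mB => esym (HXY j B mB)) Hk Hb
    L4X EX K1 sg2 sg4 var1 oA L0 cond.
  rewrite -/S -/T -/C1 => Hg.
  apply: (@le_trans _ _ (#|H|%:R^-1 * (C1 * (d%:R / L%:R ^+ 2) +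
      30 * (d%:R ^+ 5 * L%:R ^+ 12 * K * bucket_energy g sg)))).
    by rewrite ler_wpM2l// invr_ge0.
  rewrite mulrDr; apply: lerD => //.
  by rewrite le_eqVlt; apply/orP; left; apply/eqP; rewrite /K; ring.
Qed.
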